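(* Let $F(x,y)\in\mathbb{Z}[x,y]$ be an irreducible binary form of degree $n\geq 3$ and discriminant $D$. Let $\epsilon$ be a real number with $0<\epsilon<\frac{1}{4(n-1)}$ and let $m$ be an integer with $$0<m\leq \frac{|D|^{\frac{1}{4(n-1)}-\epsilon}}{(3.5)^{n/2}\, n^{\frac{n}{4(n-1)}}}.$$ Then the inequality $0<|F(x,y)|\leq m$ has at most $7n+\frac{n}{2(n-1)\epsilon}$ primitive solutions if $n\geq 5$, and at most $9n+\frac{n}{2(n-1)\epsilon}$ primitive solutions if $n=3,4$. If in addition the polynomial $F(X,1)$ has exactly $2q$ non-real roots, then the number of primitive solutions does not exceed $7n-12q+\frac{n-q}{2(n-1)\epsilon}$ if $n\geq 5$, and $9n-16q+\frac{n-q}{2(n-1)\epsilon}$ if $n=3,4$.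
   Context: A pair $(x,y)\in\mathbb{Z}^2$ is a primitive solution of an inequality or equation in $x,y$ if it satisfies it and $\gcd(x,y)=1$. Solutions $(x,y)$ and $(-x,-y)$ are regarded as one and the same solution when counting. *)

(* Defs.v *)
From HB Require Import structures.
From mathcomp Require Import all_boot all_order all_algebra.
From mathcomp Require Import complex mpoly.
From mathcomp Require Import boolp classical_sets cardinality reals exp.

Set Implicit Arguments.
Unset Strict Implicit.
Unset Printing Implicit Defensive.

Import Order.TTheory GRing.Theory Num.Theory.

Local Open Scope classical_set_scope.
Local Open Scope ring_scope.

Definition irreducible_elt (A : unitRingType) (p : A) : Prop :=
  [/\ p != 0, p \isn't a GRing.unit &
      forall a b : A, p = a * b -> a \is a GRing.unit \/ b \is a GRing.unit].

(* Irreducibility is over Q, the usual convention for integral binary forms: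
   non-primitive forms such as 2 (x^3 - 2 y^3) are allowed, while every form of
   positive degree that is irreducible in Z[x,y] is covered by Gauss's lemma. *)
Definition irreducible_binary_form (n : nat) (F : {mpoly int[2]}) : Prop :=
  F \is n.-homog /\
  irreducible_elt (map_mpoly (intr : int -> rat) F : {mpoly rat[2]}).

Definition coords (T : Type) (x y : T) : 'I_2 -> T :=
  fun i => if i == ord0 then x else y.

(* If F = \prod_i (a_i x - b_i y) over the complex numbers, then
   D(F) = \prod_(i < j) (a_i b_j - a_j b_i)^2; this does not depend on the
   factorization chosen, and it is an integer. *)
Definition is_discriminant (R : realType) (n : nat) (F : {mpoly int[2]})
    (D : int) : Prop :=
  exists a b : 'I_n -> R[i],
    map_mpoly (intr : int -> R[i]) F =
      \prod_(i < n) (a i *: 'X_ord0 - b i *: 'X_ord_max) /\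
    D%:~R = \prod_(i < n) \prod_(j < n | (i < j)%N)
              (a i * b j - a j * b i) ^+ 2.

Definition primitive_solutions (F : {mpoly int[2]}) (m : int) :
    set (int * int) :=
  [set p | 0 < `|F.@[coords p.1 p.2]| <= m /\ gcdz p.1 p.2 = 1].

(* (x, y) and (-x, -y) are one and the same solution. *)
Definition primitive_solution_classes (F : {mpoly int[2]}) (m : int) :
    set (set (int * int)) :=
  [set [set p; - p] | p in primitive_solutions F m].

Definition card_at_most (R : realType) (T : Type) (A : set T) (B : R) : Prop :=
  exists k : nat, (A #= `I_k)%card /\ k%:R <= B.

(* F(X, 1) *)
Definition dehomogenize (F : {mpoly int[2]}) : {poly int} :=
  mmap polyC (coords 'X 1) F.

(* Distinct roots are counted; for an irreducible form of degree at least 2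
   all roots of F(X, 1) are simple. *)
Definition non_real_roots (R : realType) (F : {mpoly int[2]}) : set R[i] :=
  [set z | root (map_poly (intr : int -> R[i]) (dehomogenize F)) z /\
           complex.Im z != 0].

Arguments non_real_roots : clear implicits.

(* Main.v *)
(**
Replace F by an SL2(Z)-equivalent form whose Mahler measure M is within a factor
17/16 of the infimum M0 over the equivalence class; the hypothesis on m says that
Lam = ln M0 - n ln (7/2) - ln m is a definite proportion of ln M0.

Solutions with max(|x|,|y|) <= M0^2: completing (x,y) to a basis of Z^2 and using the
minimality of M0 attaches to (x,y) weights, one for each root, of total at least Lam;
the weights attached to one root telescope, up to the last solution near that root.
For non-real roots the last term is controlled by a Hadamard estimate of the
Vandermonde determinant which gains the imaginary parts.

Larger solutions are very good approximations to the nearest root, which has to be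
real.  They satisfy a gap principle, and a Thue-Siegel argument (an auxiliary
polynomial A(x) + y B(x) vanishing to high order at (alpha, alpha), with the
Wronskian to ensure non-vanishing) leaves at most 5 of them near each root, 7 in
degree 4 and 8 in degree 3.  The cubic case also needs M0 << |D|^(1/2), which follows
from the reduction of a positive definite covariant.
*)
Require Import Defs.
From HB Require Import structures.
From mathcomp Require Import all_boot all_order all_algebra.
From mathcomp Require Import complex mpoly.
From mathcomp Require Import boolp classical_sets cardinality reals exp.
From mathcomp Require Import sequences ring lra zify.

Import Order.TTheory GRing.Theory Num.Theory.

Local Open Scope ring_scope.
Local Open Scope complex_scope.

Set Implicit Arguments.
Unset Strict Implicit.
Unset Printing Implicit Defensive.

(** The hypothesis on [m] enters as [2 * lm + N * K <= (1 - e) * a], where e = 4 (n - 1) eps and [a]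
    is the lower bound for ln M0 from Mahler's inequality |D| <= n^n M^(2n-2). It yields e ln M0 <=
    Lam, so the weights at one root, which telescope to at most 2 ln M0, account for 2 / e = 1 / (2
    (n - 1) eps) solutions. The linear term counts, for each real root, one last small solution and
    the large ones: 1 + 8, 1 + 7, 1 + 5 in degree 3, 4 and at least 5. A pair of non-real roots
    shares its last small solution and has no large ones, whence the savings in q. For a cubic with
    real roots this leaves no room for the solution (1, 0), which is paid for by sharper bounds at
    roots of modulus above 2. The infimum M0 need not be attained a priori; 17/16 is close enough to
    1 to be absorbed in ln 2 / 10. The analysis concerns an integer polynomial with its list of
    complex roots; irreducibility appears there as conjugacy: an integer polynomial vanishing at one
    root vanishes at all. *)

Local Notation cRe := complex.Re.
Local Notation cIm := complex.Im.

(** * Real-valued modulus of complex numbers *)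

Section Modulus.
Variable R : realType.
Implicit Types z w : R[i].

(** The norm of [R[i]] takes its values in [R[i]]; [cm] is the same quantity in [R], where
    logarithms and linear arithmetic are available. *)
Definition cm z : R := cRe `|z|.

Lemma cmE z : `|z| = (cm z)%:C.
Proof. by rewrite /cm normc_def. Qed.

Lemma cm_ge0 z : 0 <= cm z.
Proof. by rewrite -lecR -cmE normr_ge0. Qed.

Lemma cmM z w : cm (z * w) = cm z * cm w.
Proof. by apply: complexI; rewrite rmorphM/= -!cmE normrM. Qed.

Lemma cm0 : cm 0 = 0.
Proof. by apply: complexI; rewrite -cmE normr0. Qed.

Lemma cm1 : cm 1 = 1.
Proof. by apply: complexI; rewrite -cmE normr1. Qed.

Lemma cmN z : cm (- z) = cm z.
Proof. by rewrite /cm normrN. Qed.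

Lemma cmB z w : cm (z - w) = cm (w - z).
Proof. by rewrite /cm distrC. Qed.

Lemma cmD z w : cm (z + w) <= cm z + cm w.
Proof. by rewrite -lecR rmorphD/= -!cmE ler_normD. Qed.

Lemma cm_eq0 z : (cm z == 0) = (z == 0).
Proof.
rewrite -(normr_eq0 z) cmE; apply/eqP/eqP => [->//|].
by move/complexI.
Qed.

Lemma cm_gt0 z : (0 < cm z) = (z != 0).
Proof. by rewrite lt_def cm_ge0 andbT cm_eq0. Qed.

Lemma cmX z n : cm (z ^+ n) = cm z ^+ n.
Proof. by apply: complexI; rewrite rmorphXn/= -!cmE normrX. Qed.

Lemma cmV z : cm z^-1 = (cm z)^-1.
Proof. by apply: complexI; rewrite fmorphV/= -!cmE normfV. Qed.

Lemma cm_prod (I : Type) (r : seq I) (P : pred I) (F : I -> R[i]) :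
  cm (\prod_(i <- r | P i) F i) = \prod_(i <- r | P i) cm (F i).
Proof. exact: (big_morph cm cmM cm1). Qed.

Lemma cm_sum (I : Type) (r : seq I) (P : pred I) (F : I -> R[i]) :
  cm (\sum_(i <- r | P i) F i) <= \sum_(i <- r | P i) cm (F i).
Proof.
elim/big_rec2: _ => [|i x y _ h]; first by rewrite cm0.
by apply: le_trans (cmD _ _) _; rewrite lerD2l.
Qed.

Lemma cm_real (x : R) : cm x%:C = `|x|.
Proof. by rewrite /cm normc_def/= expr0n/= addr0 sqrtr_sqr. Qed.

Lemma cm_int (k : int) : cm k%:~R = `|k%:~R : R|.
Proof. by rewrite -cm_real rmorph_int. Qed.

Lemma cm_nat (k : nat) : cm k%:R = k%:R.
Proof. by rewrite -[k%:R](rmorph_nat (real_complex R)) cm_real ger0_norm. Qed.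

Lemma cm_conj z : cm z^* = cm z.
Proof. by rewrite /cm normcJ. Qed.

Lemma cm_geRe z : `|cRe z| <= cm z.
Proof. by rewrite -lecR -cmE normc_ge_Re. Qed.

Lemma cm_sqr z : cm z ^+ 2 = cRe z ^+ 2 + cIm z ^+ 2.
Proof. by rewrite /cm normc_def/= sqr_sqrtr// addr_ge0 ?sqr_ge0. Qed.

Lemma cm_geIm z : `|cIm z| <= cm z.
Proof.
rewrite -(ler_pXn2r (ltn0Sn 1)) ?nnegrE ?cm_ge0//.
by rewrite cm_sqr real_normK ?num_real// lerDr sqr_ge0.
Qed.

Lemma cm_leReIm z : cm z <= `|cRe z| + `|cIm z|.
Proof.
rewrite -(ler_pXn2r (ltn0Sn 1)) ?nnegrE ?cm_ge0 ?addr_ge0//.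
rewrite cm_sqr sqrrD !real_normK ?num_real//.
by rewrite addrAC lerDl mulrn_wge0 ?mulr_ge0.
Qed.

End Modulus.

(** * Hadamard's inequality *)

Section Hadamard.

(* Gram-Schmidt turns A into a triangular matrix L whose rows have the same
   norms as those of A. *)
Lemma hadamard (K : numClosedFieldType) (n : nat) (A : 'M[K]_n) :
  `|\det A| ^+ 2 <= \prod_(i < n) \sum_(j < n) `|A i j| ^+ 2.
Proof.
pose U := spectral.schmidt A.
have Uu : U \is spectral.unitarymx by apply: spectral.schmidt_unitarymx.
pose L := A *m (map_mx Num.conj U^T).
have AE : A = L *m U by rewrite /L spectral.mulmxKtV.
have detU : `|\det U| = 1.
  have /spectral.unitarymxP/(congr1 (fun M => `|\det M|)) := Uu.
  rewrite det_mulmx det_map_mx det_tr det1 normr1 normrM norm_conjC => /eqP.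
  by rewrite -expr2 sqrf_eq1 => /orP[/eqP//|/eqP E]; have := normr_ge0 (\det U); rewrite E ler0N1.
have Ltrig : is_trig_mx L.
  apply/is_trig_mxP => i j lij.
  have := spectral.row_schmidt_sub A i.
  move/sub_sumsmxP => [u E].
  have -> : L i j = (row i A *m (map_mx Num.conj (row j U)^T)) 0 0.
    by rewrite /L !mxE; apply: eq_bigr => k _; rewrite !mxE.
  rewrite E mulmx_suml summxE big1// => k lki.
  have /submxP[w ->] : (u k *m <<row k U>> <= row k U)%MS.
    by rewrite (submx_trans (submxMl _ _))// genmxE.
  have /spectral.row_unitarymxP/(_ k j) := Uu.
  rewrite spectral.dotmxE => h.
  rewrite -mulmxA mxE big_ord1 h (_ : k == j = false) ?mulr0//.
  by apply/negbTE; rewrite -val_eqE/= neq_ltn (leq_ltn_trans lki lij).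
have rows i : \sum_(j < n) `|L i j| ^+ 2 = \sum_(j < n) `|A i j| ^+ 2.
  have hh (B : 'M[K]_n) : \sum_(j < n) `|B i j| ^+ 2 = (B *m (map_mx Num.conj B^T)) i i.
    by rewrite mxE; apply: eq_bigr => j _; rewrite !mxE normCK.
  rewrite !hh /L trmx_mul map_mxM mulmxA -[X in X *m _]mulmxA.
  have -> : map_mx Num.conj U^T *m map_mx Num.conj (map_mx Num.conj U^T)^T = 1%:M.
    apply: mulmx1C; rewrite map_trmx trmxK.
    have -> : map_mx Num.conj (map_mx Num.conj U) = U.
      by apply/matrixP => x y; rewrite !mxE conjCK.
    exact/spectral.unitarymxP.
  by rewrite mulmx1.
rewrite [X in \det X]AE det_mulmx normrM detU mulr1 det_trig// normr_prod -prodrXl.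
apply: ler_prod => i _; rewrite exprn_ge0//= -rows (bigD1 i)//= lerDl.
by apply: sumr_ge0 => j _; rewrite exprn_ge0.
Qed.

End Hadamard.

(** * Integer polynomials with conjugate roots, and resultants *)

Section RootSystem.
Variable R : realType.

Record root_system (n : nat) (f : {poly int}) (al : 'I_n -> R[i]) : Prop :=
  RootSystem {
    rs_fact : map_poly intr f =
      (lead_coef f)%:~R *: \prod_(i < n) ('X - (al i)%:P);
    rs_neq0 : f != 0;
    rs_inj : injective al;
    (* algebraic conjugacy of the roots; equivalent to the irreducibility of f *)
    rs_irr : forall (g : {poly int}) i j,
      root (map_poly intr g) (al i) -> root (map_poly intr g) (al j) }.

Variables (n : nat) (f : {poly int}) (al : 'I_n -> R[i]).
Hypothesis fal : root_system f al.

Lemma lead_neq0 : (lead_coef f)%:~R != 0 :> R[i].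
Proof. by rewrite intr_eq0 lead_coef_eq0 (rs_neq0 fal). Qed.

Lemma rs_size : size f = n.+1.
Proof.
have := congr1 (fun p : {poly R[i]} => size p) (rs_fact fal).
rewrite size_scale ?lead_neq0// size_prod_XsubC size_map_poly_id0 ?lead_neq0//.
by move=> ->; rewrite /index_enum -enumT size_enum_ord.
Qed.

Lemma horner_rs z : (map_poly intr f).[z] =
  (lead_coef f)%:~R * \prod_(i < n) (z - al i).
Proof.
rewrite (rs_fact fal) hornerZ horner_prod; congr (_ * _).
by apply: eq_bigr => i _; rewrite hornerXsubC.
Qed.

Lemma rs_root i : root (map_poly intr f) (al i).
Proof. by rewrite rootE horner_rs (bigD1 i)//= subrr mul0r mulr0. Qed.

Lemma rs_rootP z : root (map_poly intr f) z -> exists i, z = al i.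
Proof.
rewrite rootE horner_rs mulf_eq0 (negPf lead_neq0)/= prodf_seq_eq0.
by move/hasP => [i _ /=]; rewrite subr_eq0 => /eqP ->; exists i.
Qed.

Lemma conj_index : exists cj : 'I_n -> 'I_n,
  (forall i, al (cj i) = (al i)^*) /\ involutive cj.
Proof.
have h i : exists j, al j == (al i)^*.
  have rr : root (map_poly intr f) (al i)^*.
    rewrite -complex_root_conj (_ : map_poly _ _ = map_poly intr f) ?rs_root//.
    rewrite -map_poly_comp; apply: eq_map_poly => x /=.
    by rewrite rmorph_int.
  by have [j ->] := rs_rootP rr; exists j.
pose cj i := xchoose (h i); have cjE i : al (cj i) = (al i)^* by apply/eqP/(xchooseP (h i)).
exists cj; split=> // i; apply: (rs_inj fal).
by rewrite !cjE conjcK.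
Qed.

(* The integer is the resultant of f and g: multiply their Sylvester matrix by
   the matrix of evaluations at the roots of f. *)
Lemma norm_int (g : {poly int}) (e : nat) : (size g <= e.+1)%N ->
  exists z : int,
    (lead_coef f)%:~R ^+ e * \prod_(i < n) (map_poly intr g).[al i] = z%:~R.
Proof.
move=> sg.
pose G : 'M[int]_(n, n + e) := \matrix_(i, c) ('X^i * g)`_c.
pose Fm : 'M[int]_(e, n + e) := \matrix_(i, c) ('X^i * f)`_c.
pose a : 'rV[R[i]]_n := \row_j al j.
pose E1 : 'M[R[i]]_(n + e, n) := \matrix_(c, j) al j ^+ c.
(* [E2] completes the evaluation columns [E1] to a square matrix with the determinant of [V]. The
   product of [Fm] with [E2] only reads coefficients of index at least n, so it is triangular with
   the leading coefficient of [f] on the diagonal. *)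
pose E2 : 'M[R[i]]_(n + e, e) := \matrix_(c, j) ((c : nat) == n + j)%:R.
pose V := Vandermonde n a.
have hev (p : {poly int}) i : (size p <= n + e)%N ->
    \sum_(c < n + e) (p`_c)%:~R * al i ^+ c = (map_poly intr p).[al i].
  move=> sp; rewrite (@horner_coef_wide _ (n + e)) ?(leq_trans (size_poly _ _))//.
  by apply: eq_bigr => c _; rewrite coef_map.
have hco (p : {poly int}) (j : 'I_e) :
    \sum_(c < n + e) (p`_c)%:~R * ((c : nat) == n + j)%:R = (p`_(n + j))%:~R :> R[i].
  have lt : (n + j < n + e)%N by rewrite ltn_add2l.
  rewrite (bigD1 (Ordinal lt))//= eqxx mulr1 big1 ?addr0// => c /negPf.
  by rewrite -val_eqE/= => ->; rewrite mulr0.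
have sX (p : {poly int}) i : size ('X^i * p) = if p == 0 then 0%N else (i + size p)%N.
  case: eqP => [->|/eqP p0]; first by rewrite mulr0 size_poly0.
  by rewrite mulrC size_mulXn.
have detE : \det (row_mx E1 E2) = \det V.
  rewrite -[row_mx E1 E2]submxK.
  have -> : ulsubmx (row_mx E1 E2) = V.
    by apply/matrixP => i j; rewrite 2!mxE row_mxEl !mxE.
  have -> : ursubmx (row_mx E1 E2) = 0.
    apply/matrixP => i j; rewrite 2!mxE row_mxEr !mxE/=.
    by rewrite (_ : _ == _ = false)//; apply/negbTE; rewrite neq_ltn ltn_addr.
  have -> : drsubmx (row_mx E1 E2) = 1%:M.
    by apply/matrixP => i j; rewrite 2!mxE row_mxEr !mxE/= eqn_add2l.
  by rewrite det_lblock det1 mulr1.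
have GE : map_mx intr G *m E1 = V *m diag_mx (\row_j (map_poly intr g).[al j]).
  apply/matrixP => i j; rewrite mul_mx_diag !mxE.
  rewrite -[RHS](_ : (map_poly intr ('X^i * g)).[al j] = _); last first.
    by rewrite rmorphM/= map_polyXn hornerM hornerXn.
  rewrite -hev; last first.
    rewrite sX; case: eqP => // _; rewrite (leq_trans (leq_add (leqnn _) sg))//.
    by rewrite addnS -addSn leq_add2r.
  by apply: eq_bigr => c _; rewrite !mxE.
have FE1 : map_mx intr Fm *m E1 = 0.
  apply/matrixP => i j; rewrite !mxE.
  rewrite -[RHS](_ : (map_poly intr ('X^i * f)).[al j] = _); last first.
    by rewrite rmorphM/= map_polyXn hornerM hornerXn (eqP (rs_root j)) mulr0.
  rewrite -hev; last first.
    by rewrite sX (negPf (rs_neq0 fal)) rs_size addnS -addSn addnC leq_add2l.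
  by apply: eq_bigr => c _; rewrite !mxE.
have FE2 : \det (map_mx intr Fm *m E2) = (lead_coef f)%:~R ^+ e.
  have FE i j : (map_mx intr Fm *m E2) i j = (('X^i * f)`_(n + j))%:~R.
    by rewrite !mxE -hco; apply: eq_bigr => c _; rewrite !mxE.
  have tr : is_trig_mx (map_mx intr Fm *m E2).
    apply/is_trig_mxP => i j lij; rewrite FE coefXnM.
    by rewrite ltnNge (leq_trans (ltnW lij) (leq_addl _ _))/= nth_default// rs_size; lia.
  rewrite det_trig// (eq_bigr (fun=> (lead_coef f)%:~R)) ?prodr_const ?card_ord//.
  move=> i _; rewrite FE coefXnM ltnNge leq_addl/= addnK.
  by rewrite lead_coefE rs_size.
have Vn0 : \det V != 0.
  rewrite det_Vandermonde; apply/prodf_neq0 => i _; apply/prodf_neq0 => j ij.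
  by rewrite !mxE subr_eq0 (inj_eq (rs_inj fal)) -val_eqE/= neq_ltn ij orbT.
exists (\det (col_mx G Fm)).
apply: (mulIf Vn0); rewrite -[in RHS]detE -(det_map_mx intr) -det_mulmx map_col_mx.
rewrite mul_col_row FE1 det_ublock FE2 GE det_mulmx det_diag.
have dE : \prod_i (\row_j (map_poly intr g).[al j]) 0 i =
    \prod_i (map_poly intr g).[al i] by apply: eq_bigr => j _; rewrite mxE.
by rewrite dE; ring.
Qed.

End RootSystem.

(** * Upper bound for Vandermonde determinants with conjugate points *)

Section VandermondeBound.
Variable R : realType.

Lemma vandermonde_sqr (n : nat) (b : 'I_n -> R[i]) :
  cm (\det (Vandermonde n (\row_j b j))) ^+ 2 =
  \prod_(i < n) \prod_(j < n | j != i) cm (b i - b j).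
Proof.
rewrite det_Vandermonde cm_prod.
under eq_bigr => i _ do rewrite cm_prod.
rewrite expr2 {2}(exchange_big_dep predT)//= -big_split/=.
apply: eq_bigr => i _; rewrite [RHS](bigID (fun j : 'I_n => (i < j)%N))/=.
congr (_ * _).
  by apply: eq_big => [j|j _]; rewrite ?mxE 1?cmB// -val_eqE/= neq_ltn; lia.
by apply: eq_big => [j|j _]; rewrite ?mxE// -val_eqE/= neq_ltn; lia.
Qed.

Lemma hadamard_cm (n : nat) (W : 'M[R[i]]_n) :
  cm (\det W) ^+ 2 <= \prod_(i < n) \sum_(k < n) cm (W i k) ^+ 2.
Proof.
have := hadamard W; rewrite cmE -rmorphXn/=.
rewrite (eq_bigr (fun i => (\sum_(k < n) cm (W i k) ^+ 2)%:C)); last first.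
  by move=> i _; rewrite rmorph_sum; apply: eq_bigr => k _; rewrite cmE -rmorphXn.
by rewrite -rmorph_prod lecR.
Qed.

(* Replacing the row of conj(b p) by the difference of the rows of b p and
   conj(b p) does not change the determinant but gains the factor Im (b p). *)
Lemma vandermonde_bound (n : nat) (b : 'I_n -> R[i]) (cj : 'I_n -> 'I_n)
    (S : {set 'I_n}) :
  involutive cj -> (forall i, b (cj i) = (b i)^*) ->
  (forall i, i \in S -> cj i \notin S) ->
  \prod_(i < n) \prod_(j < n | j != i) cm (b i - b j) <=
  n%:R ^+ n * (\prod_(i < n) Num.max 1 (cm (b i))) ^+ (2 * n.-1)
    * \prod_(i in S) (2 * `|cIm (b i)| * n%:R) ^+ 2.
Proof.
move=> cjK bcj Scj.
pose A i := Num.max 1 (cm (b i)).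
have A1 i : 1 <= A i by rewrite le_max lexx.
have A0 i : 0 <= A i by apply: le_trans (A1 i).
have AX i k : (k < n)%N -> cm (b i) ^+ k <= A i ^+ n.-1.
  move=> kn; apply: (@le_trans _ _ (A i ^+ k)).
    by rewrite lerXn2r ?nnegrE ?cm_ge0// le_max lexx orbT.
  by rewrite ler_weXn2l//; lia.
(* When cj i is in S, row i of [U] is the difference of the unit rows at cj i and i. As i and cj i
   are never both in S, [U] is an involution, and |det U| = 1 follows without computing it. *)
pose U : 'M[R[i]]_n := \matrix_(i, j)
  (if cj i \in S then (j == cj i)%:R - (j == i)%:R else (j == i)%:R).
pose V := (Vandermonde n (\row_j b j))^T.
have sumd (i : 'I_n) (F : 'I_n -> R[i]) : \sum_j (j == i)%:R * F j = F i.
  rewrite (bigD1 i)//= eqxx mul1r big1 ?addr0// => j /negPf ->.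
  by rewrite mul0r.
have UU : U *m U = 1%:M.
  apply/matrixP => i j; rewrite !mxE.
  under eq_bigr => k _ do rewrite [U i k]mxE.
  case: (boolP (cj i \in S)) => ci; last by rewrite sumd mxE (negPf ci) eq_sym.
  under eq_bigr => k _ do rewrite mulrBl.
  rewrite sumrB !sumd !mxE cjK ci.
  have := Scj _ ci; rewrite cjK => /negPf ->.
  by rewrite opprB addrC subrK eq_sym.
have detU : cm (\det U) = 1.
  have := congr1 (fun M => cm (\det M)) UU; rewrite det_mulmx det1 cmM cm1 => /eqP.
  rewrite -expr2 sqrf_eq1 => /orP[/eqP//|/eqP E].
  by have := cm_ge0 (\det U); rewrite E ler0N1.
rewrite -vandermonde_sqr -det_tr -/V.
have -> : cm (\det V) = cm (\det (U *m V)) by rewrite det_mulmx cmM detU mul1r.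
have UV i k : (U *m V) i k = if cj i \in S then b (cj i) ^+ k - b i ^+ k else b i ^+ k.
  rewrite mxE; under eq_bigr => j _ do rewrite [U i j]mxE [V j k]mxE [Vandermonde _ _ _ _]mxE [_ 0 j]mxE.
  case: (boolP (cj i \in S)) => _; last by rewrite sumd.
  under eq_bigr => j _ do rewrite mulrBl.
  by rewrite sumrB !sumd.
apply: le_trans (hadamard_cm _) _.
have row i : \sum_(k < n) cm ((U *m V) i k) ^+ 2 <=
    n%:R * A i ^+ (2 * n.-1) * (if cj i \in S then (2 * `|cIm (b i)| * n%:R) ^+ 2 else 1).
  have -> : n%:R * A i ^+ (2 * n.-1) * (if cj i \in S then (2 * `|cIm (b i)| * n%:R) ^+ 2 else 1)
    = \sum_(k < n) A i ^+ (2 * n.-1) * (if cj i \in S then (2 * `|cIm (b i)| * n%:R) ^+ 2 else 1).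
    by rewrite sumr_const card_ord -[RHS]mulr_natl mulrA.
  apply: ler_sum => k _; rewrite UV; case: ifP => _; last first.
    by rewrite mulr1 cmX [(2 * _)%N]mulnC [A i ^+ _]exprM lerXn2r ?nnegrE ?exprn_ge0 ?cm_ge0// AX.
  rewrite [(2 * _)%N]mulnC exprM -exprMn lerXn2r ?nnegrE ?cm_ge0 ?mulr_ge0 ?exprn_ge0//.
  (* The k-th powers of b i and of its conjugate differ by 2 Im (b i), up to a unit, times a sum of
     k monomials of degree k - 1. *)
  rewrite bcj -opprB cmN subrXX cmM.
  have -> : cm (b i - (b i)^*) = 2 * `|cIm (b i)|.
    rewrite subcJ !cmM cm_real (cm_nat _ 2) -[RHS]mulr1; congr (_ * _).
    by rewrite /cm normc_def/= expr0n expr1n add0r sqrtr1.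
  rewrite [X in _ <= X]mulrC -!mulrA; apply: ler_wpM2l => //.
  apply: ler_wpM2l => //.
  apply: le_trans (cm_sum _ _ _) _.
  apply: (@le_trans _ _ (\sum_(l < k) A i ^+ n.-1)).
    apply: ler_sum => l _; rewrite cmM !cmX cm_conj -exprD AX//.
    by have := ltn_ord k; have := ltn_ord l; lia.
  rewrite sumr_const card_ord -[X in X <= _]mulr_natl ler_wpM2r ?exprn_ge0// ler_nat.
  exact: ltnW.
apply: (@le_trans _ _ (\prod_(i < n) (n%:R * A i ^+ (2 * n.-1) * (if cj i \in S then (2 * `|cIm (b i)| * n%:R) ^+ 2 else 1)))).
  apply: ler_prod => i _; rewrite row andbT.
  by apply: sumr_ge0 => k _; rewrite exprn_ge0 ?cm_ge0.
have eqS : \prod_(i < n | cj i \in S) (2 * `|cIm (b i)| * n%:R) ^+ 2 =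
    \prod_(i in S) (2 * `|cIm (b i)| * n%:R) ^+ 2.
  rewrite [RHS](reindex_inj (inv_inj cjK))/=.
  by apply: eq_bigr => i _; rewrite bcj; case: (b i) => x y /=; rewrite normrN.
by rewrite [X in X <= _]big_split/= [X in X * _ <= _]big_split/= prodr_const card_ord
  -big_mkcond/= eqS prodrXl.
Qed.

End VandermondeBound.

(** * Orders of vanishing and Wronskians *)

Section Vanishing.

Lemma taylor_poly (K : comNzRingType) (p : {poly K}) x :
  p = \sum_(i < size p) (p^`N(i)).[x] *: ('X - x%:P) ^+ i.
Proof.
have := @nderiv_taylor _ (map_poly polyC p) x%:P ('X - x%:P) (mulrC _ _).
rewrite addrC subrK -/(p \Po 'X) comp_polyXr => {1}->.
rewrite size_map_polyC; apply: eq_bigr => i _.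
by rewrite nderivn_map horner_map -mul_polyC.
Qed.

Lemma vanish_dvdp (K : fieldType) (p : {poly K}) x k :
  (forall j, (j < k)%N -> (p^`N(j)).[x] = 0) -> ('X - x%:P) ^+ k %| p.
Proof.
move=> h; rewrite (taylor_poly p x); apply: (big_ind (fun q => _ %| q)) => [|u v|i _].
- exact: dvdp0.
- exact: dvdp_add.
- have [/h ->|ki] := ltnP i k; first by rewrite scale0r dvdp0.
  by rewrite -mul_polyC dvdp_mull// dvdp_exp2l.
Qed.

Lemma dvdp_prod_XsubC (K : fieldType) (I : finType) (P : pred I) (b : I -> K) e p :
  injective b -> (forall i, P i -> ('X - (b i)%:P) ^+ e %| p) ->
  \prod_(i | P i) ('X - (b i)%:P) ^+ e %| p.
Proof.
move=> bI h; rewrite -big_filter.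
have : uniq [seq i <- index_enum I | P i] by rewrite filter_uniq ?index_enum_uniq.
have : {in [seq i <- index_enum I | P i], forall i, P i}.
  by move=> i; rewrite mem_filter => /andP[].
elim: [seq i <- _ | _] => [|i r IH] rP /=; first by rewrite big_nil dvd1p.
move=> /andP[ir ur]; rewrite big_cons Gauss_dvdp ?h ?rP ?mem_head//=.
  by apply: IH => // j jr; apply: rP; rewrite in_cons jr orbT.
rewrite big_seq; apply: (big_ind (fun q => coprimep _ q)) => [|u v|j jr].
- exact: coprimep1.
- by rewrite coprimepMr => -> ->.
- rewrite coprimep_expl// coprimep_expr// coprimep_XsubC root_XsubC.
  by apply: contraNneq ir => /bI E; first [rewrite E; done | rewrite -E; done].
Qed.

Lemma size_prod_XsubC_exp (K : fieldType) (I : finType) (P : pred I) (b : I -> K) e :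
  size (\prod_(i | P i) ('X - (b i)%:P) ^+ e) = (#|P| * e).+1.
Proof.
rewrite size_prod => [|i _]; last by rewrite expf_neq0// polyXsubC_eq0.
rewrite (eq_bigr (fun=> e.+1)) => [|i _]; last by rewrite size_exp_XsubC.
by rewrite sum_nat_const; lia.
Qed.

Definition wronsk (K : comNzRingType) (A B : {poly K}) := A * B^`() - A^`() * B.

Lemma wronskDZ (K : comNzRingType) (A B : {poly K}) c :
  wronsk (A + c *: B) B = wronsk A B.
Proof. by rewrite /wronsk derivD derivZ -!mul_polyC; ring. Qed.

Lemma wronskC (K : comNzRingType) (A B : {poly K}) : wronsk A B = - wronsk B A.
Proof. by rewrite /wronsk; ring. Qed.

(** Replacing [A] by [A + c *: B] does not change the Wronskian; the derivative then costs one order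
    of vanishing. *)
Lemma wronsk_dvdp (K : fieldType) (A B : {poly K}) c x e :
  ('X - x%:P) ^+ e.+1 %| A + c *: B -> ('X - x%:P) ^+ e %| wronsk A B.
Proof.
move=> /dvdpP[q E]; rewrite -(wronskDZ A B c) /wronsk E derivM deriv_exp derivXsubC mul1r/=.
set X := 'X - x%:P.
apply/dvdpP; exists (q * X * B^`() - (q^`() * X + q *+ e.+1) * B).
by rewrite exprS -mulr_natr -[in RHS]mulr_natr; ring.
Qed.

(** One better than the naive bound: subtracting a multiple of [B] from [A] lowers a degree without
    changing the Wronskian. The degree count in [wronsk_nonvanishing] has no unit to spare. *)
Lemma size_wronsk (K : fieldType) (A B : {poly K}) d :
  (size A <= d.+1)%N -> (size B <= d.+1)%N -> (size (wronsk A B) <= (2 * d).-1)%N.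
Proof.
have main (P Q : {poly K}) : (size P <= d)%N -> (size Q <= d.+1)%N ->
    (size (wronsk P Q) <= (2 * d).-1)%N.
  move=> sP sQ; rewrite /wronsk (leq_trans (size_polyD _ _))// geq_max size_polyN.
  have sP' : (size P^`() <= d.-1)%N.
    have [->|P0] := eqVneq P 0; first by rewrite deriv0 size_poly0.
    by have := lt_size_deriv P0; lia.
  have sQ' : (size Q^`() <= d)%N.
    have [->|Q0] := eqVneq Q 0; first by rewrite deriv0 size_poly0.
    by have := lt_size_deriv Q0; lia.
  have [P0|P0] := eqVneq P 0.
    by rewrite P0 deriv0 !mul0r size_poly0.
  have := size_poly_gt0 P; rewrite P0 => Pp.
  have dp : (0 < d)%N by apply: leq_trans sP.
  apply/andP; split; apply: leq_trans (size_polyMleq _ _) _.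
    by move: (size P) (size Q^`()) sP sQ' => a b; lia.
  by move: (size P^`()) (size Q) sP' sQ => a b; lia.
move=> sA sB; have [B0|B0] := eqVneq B`_d 0.
  rewrite wronskC size_polyN; apply: main => //.
  by apply/leq_sizeP => j; rewrite leq_eqVlt => /orP[/eqP <-//|dj]; rewrite nth_default// (leq_trans sB).
rewrite -(wronskDZ A B (- (A`_d / B`_d))); apply: main => //.
apply/leq_sizeP => j; rewrite leq_eqVlt coefD coefZ => /orP[/eqP <-|dj].
  by rewrite mulNr divfK// subrr.
by rewrite [A`_j]nth_default ?(leq_trans sA dj)// [B`_j]nth_default ?(leq_trans sB dj)// mulr0 addr0.
Qed.


(** After division by the gcd, a b' = a' b with a and b coprime forces a to divide a' and b to
    divide b'; in characteristic 0 both are then constant. *)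
Lemma wronsk_eq0 (K : numFieldType) (A B : {poly K}) : wronsk A B = 0 ->
  exists (G : {poly K}) (u v : K), A = u *: G /\ B = v *: G.
Proof.
have cst (p : {poly K}) : p %| p^`() -> exists c, p = c%:P.
  have [->|p0] := eqVneq p 0; first by exists 0; rewrite polyC0.
  move=> dv; have p'0 : p^`() = 0.
    apply/eqP; apply: contraTT dv => n0; apply/negP => /(dvdp_leq n0).
    by rewrite leqNgt lt_size_deriv.
  exists p`_0; apply/polyP => -[|i]; rewrite coefC//=.
  have := congr1 (fun q : {poly K} => q`_i) p'0; rewrite coef_deriv coef0.
  by move/eqP; rewrite mulrn_eq0/= => /eqP.
have [->|A0] := eqVneq A 0.
  by exists B, 0, 1; rewrite scale0r scale1r.
move=> W0; pose G := gcdp A B.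
have G0 : G != 0 by rewrite gcdp_eq0 negb_and A0.
have /dvdpP[a Ea] : G %| A by apply: dvdp_gcdl.
have /dvdpP[b Eb] : G %| B by apply: dvdp_gcdr.
have cab : coprimep a b.
  have := @coprimep_div_gcd _ A B; rewrite A0/= => /(_ isT).
  by rewrite -/G Ea Eb !mulpK.
have wab : a * b^`() = a^`() * b.
  apply/eqP; rewrite -subr_eq0; have : wronsk a b * G ^+ 2 == 0.
    by apply/eqP; rewrite -W0 Ea Eb /wronsk !derivM; ring.
  by rewrite mulf_eq0 expf_eq0 (negPf G0)/= orbF.
have [u Eu] : exists u, a = u%:P.
  by apply: cst; rewrite -(Gauss_dvdpl _ cab) -wab dvdp_mulr.
have [v Ev] : exists v, b = v%:P.
  apply: cst; rewrite -(@Gauss_dvdpr _ _ a) ?wab ?dvdp_mull//.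
  by rewrite coprimep_sym.
by exists G, u, v; rewrite Ea Eb Eu Ev !mul_polyC.
Qed.

(* The Wronskian of A and B vanishes to order k - 1 at every b i, so its degree
   leaves no room for a zero of order J at x1. *)
Lemma wronsk_nonvanishing (K : numFieldType) (n k d J : nat) (b : 'I_n -> K)
    (x1 x2 : K) (A B : {poly K}) :
  injective b -> (forall i, x1 != b i) -> (0 < n)%N -> (0 < k)%N ->
  (size A <= d.+1)%N -> (size B <= d.+1)%N -> (A != 0) || (B != 0) ->
  (d < n.-1 * k)%N -> (2 * d <= J + n * k.-1 + 1)%N ->
  (forall i j, (j < k)%N -> ((A + b i *: B)^`N(j)).[b i] = 0) ->
  exists2 j, (j <= J)%N & ((A + x2 *: B)^`N(j)).[x1] != 0.
Proof.
move=> bI x1b n0 k0 sA sB AB0 dk dJ van.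
have dv i : ('X - (b i)%:P) ^+ k %| A + b i *: B.
  by apply: vanish_dvdp => j jk; rewrite van.
have W0 : wronsk A B != 0.
  (* If the Wronskian vanished, then A = u G and B = v G. As u + b_i v is zero for at most one i, G
     would have a zero of order k at n - 1 of the points, too many for degree d < (n - 1) k. *)
  apply/eqP => /wronsk_eq0[G [u [v [EA EB]]]].
  have G0 : G != 0.
    by apply: contraTneq AB0 => G0; rewrite EA EB G0 !scaler0 eqxx.
  have uv0 : (u != 0) || (v != 0).
    apply: contraTT AB0; rewrite !negb_or !negbK EA EB => /andP[/eqP -> /eqP ->].
    by rewrite !scale0r eqxx.
  have [i0 hi0] : exists i0, forall i, i != i0 -> u + b i * v != 0.
    have [i0 /eqP h0|h] := pickP (fun i => u + b i * v == 0).
      exists i0 => i; apply: contra_neq => h1; apply: bI.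
      have E : (b i - b i0) * v = (u + b i * v) - (u + b i0 * v) by ring.
      have : (b i - b i0) * v == 0 by rewrite E h1 h0 subrr.
      rewrite mulf_eq0 subr_eq0 => /orP[/eqP//|/eqP v0].
      by move: uv0 h0; rewrite v0 mulr0 addr0 eqxx orbF => /negPf u0 /eqP; rewrite u0.
    by exists (Ordinal n0) => i _; rewrite h.
  have hd : \prod_(i | i != i0) ('X - (b i)%:P) ^+ k %| G.
    apply: dvdp_prod_XsubC => // i ii0.
    have := dv i; rewrite EA EB scalerA -scalerDl.
    by rewrite dvdpZr// hi0.
  have := dvdp_leq G0 hd; rewrite size_prod_XsubC_exp => hs.
  have sG : (size G <= d.+1)%N.
    have [u0|v0] := orP uv0; first by move: sA; rewrite EA size_scale.
    by move: sB; rewrite EB size_scale.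
  have cardi : #|[pred i | i != i0]| = n.-1 by rewrite cardC1 card_ord.
  move: hs; rewrite (eq_card (B := [pred i | i != i0]))// cardi => hs.
  by have := leq_trans hs sG; rewrite ltnS leqNgt dk.
have [/existsP[j hj]|] := boolP [exists j : 'I_J.+1, ((A + x2 *: B)^`N(j)).[x1] != 0].
  by exists j => //; rewrite -ltnS.
rewrite negb_exists => /forallP nh.
have dvx : ('X - x1%:P) ^+ J.+1 %| A + x2 *: B.
  by apply: vanish_dvdp => j jk; apply/eqP; have := nh (Ordinal jk); rewrite negbK.
have dW1 := wronsk_dvdp dvx.
have dW2 : \prod_(i < n) ('X - (b i)%:P) ^+ k.-1 %| wronsk A B.
  apply: dvdp_prod_XsubC => // i _; apply: (@wronsk_dvdp _ _ _ (b i)).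
  by rewrite prednK.
have cop : coprimep (('X - x1%:P) ^+ J) (\prod_(i < n) ('X - (b i)%:P) ^+ k.-1).
  apply: (big_ind (fun q => coprimep _ q)) => [|p q|i _].
  - exact: coprimep1.
  - by rewrite coprimepMr => -> ->.
  - by rewrite coprimep_expl// coprimep_expr// coprimep_XsubC root_XsubC eq_sym.
have dW : ('X - x1%:P) ^+ J * \prod_(i < n) ('X - (b i)%:P) ^+ k.-1 %| wronsk A B.
  by rewrite (Gauss_dvdp _ cop) dW1 dW2.
have := dvdp_leq W0 dW.
have p0 : \prod_(i < n) ('X - (b i)%:P) ^+ k.-1 != 0.
  by apply/prodf_neq0 => i _; rewrite expf_neq0// polyXsubC_eq0.
rewrite size_mul ?expf_neq0 ?polyXsubC_eq0// size_exp_XsubC size_prod_XsubC_exp.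
move/leq_trans => /(_ _ (size_wronsk sA sB)).
have -> : #|(fun _ : 'I_n => true)| = n by rewrite -[RHS]card_ord; apply: eq_card.
by rewrite addnS/= => h; exfalso; move: h dJ; move: (n * k.-1)%N => c; clear -d; lia.
Qed.

End Vanishing.

(** * The auxiliary polynomial from the box principle *)

Section AuxiliaryPolynomial.
Variable R : realType.

Lemma sum_bin_shift (j e : nat) :
  (\sum_(l < e.+1) 'C(j + l, j) = 'C((j + e).+1, j.+1))%N.
Proof.
elim: e => [|e IH]; first by rewrite big_ord_recr big_ord0 /= addn0 !binn.
by rewrite big_ord_recr /= IH addnS [in RHS]binS.
Qed.

Lemma bin_le_expn (n m : nat) : ('C(n, m) <= 2 ^ n)%N.
Proof.
elim: n m => [|n IH] [|m]; rewrite ?bin0 ?expn_gt0// ?bin0n//.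
by rewrite binS expnS mul2n -addnn leq_add.
Qed.

(** Divided derivatives keep integer coefficients; the binomial coefficients they bring in sum to
    'C(d+1, j+1), at most 2^(d+1). *)
Lemma nderiv_bound (p : {poly R[i]}) (d j : nat) (B A : R) (z : R[i]) :
  (size p <= d.+1)%N -> (forall i, cm p`_i <= B) -> 1 <= A -> cm z <= A ->
  (j <= d)%N -> cm (p^`N(j)).[z] <= B * 2 ^+ d.+1 * A ^+ (d - j).
Proof.
move=> sp pB A1 zA jd.
have A0 : 0 <= A by apply: le_trans A1.
have B0 : 0 <= B by apply: le_trans (cm_ge0 _) (pB 0%N).
rewrite (@horner_coef_wide _ (d - j).+1); last first.
  by rewrite (leq_trans (size_poly _ _))// -subSn// leq_sub2r.
apply: le_trans (cm_sum _ _ _) _.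
apply: (@le_trans _ _ (\sum_(l < (d - j).+1) B * A ^+ (d - j) * ('C(j + l, j))%:R)).
  apply: ler_sum => l _; rewrite coef_nderivn cmM cmX -[p`_(j + l) *+ _]mulr_natr cmM cm_nat.
  rewrite -mulrA [X in _ <= X]mulrAC -mulrA; apply: ler_pM => //.
  - exact: cm_ge0.
  - by rewrite mulr_ge0 ?exprn_ge0 ?cm_ge0.
  - rewrite ler_wpM2l//; apply: (@le_trans _ _ (A ^+ l)).
      by rewrite lerXn2r ?nnegrE ?cm_ge0.
    by rewrite ler_weXn2l// -ltnS.
rewrite -mulr_sumr -natr_sum sum_bin_shift subnKC// [X in _ <= X]mulrAC.
rewrite ler_wpM2l ?mulr_ge0 ?exprn_ge0// -natrX ler_nat.
exact: bin_le_expn.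
Qed.

Lemma card_boxes (I : finType) (N : nat) (q : I -> nat) :
  (forall p, (q p <= N)%N) ->
  (#|[set h : {ffun I -> 'I_N} | [forall p, (h p < q p)%N]]| = \prod_p q p)%N.
Proof.
move=> qN.
pose F (p : I) : pred 'I_N := fun z => (z < q p)%N.
have := @card_family I (fun=> 'I_N) F.
rewrite foldrE big_map enumT => E.
rewrite -(eq_card (_ : family F =i _)) => [|h]; last by rewrite !inE.
rewrite E; apply: eq_bigr => p _.
have wi : injective (widen_ord (qN p)) by move=> z w /(congr1 val) /= /val_inj.
rewrite -[RHS]card_ord -(card_imset _ wi).
apply: eq_card => z; apply/idP/imsetP => [h|[z' _ ->]].
  by exists (Ordinal (h : (z < q p)%N)) => //; apply: val_inj.
exact: (ltn_ord z').
Qed.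

Definition mahler (n : nat) (f : {poly int}) (al : 'I_n -> R[i]) : R :=
  `|(lead_coef f)%:~R| * \prod_(i < n) Num.max 1 (cm (al i)).

Variables (n : nat) (f : {poly int}) (al : 'I_n -> R[i]).
Hypothesis fal : root_system f al.
Hypothesis n_gt0 : (0 < n)%N.
Local Notation M := (mahler f al).
Local Notation ic := (map_poly (intr : int -> R[i])).

Lemma abs_lead_ge1 : 1 <= `|(lead_coef f)%:~R : R|.
Proof.
rewrite -intr_norm -[1]/(1%:~R) ler_int.
have := rs_neq0 fal; rewrite -lead_coef_eq0 -normr_gt0.
by rewrite gtz0_ge1.
Qed.

Lemma mahler_ge1 : 1 <= M.
Proof.
rewrite /mahler mulr_ege1 ?abs_lead_ge1//.
by apply: (big_ind (fun x => 1 <= x)) => // [x y|i _]; [exact: mulr_ege1|rewrite le_max lexx].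
Qed.

Let Ae (i : 'I_n) := Num.max 1 (cm (al i)).

Let Ae1 i : 1 <= Ae i. Proof. by rewrite le_max lexx. Qed.

(* Dirichlet's box principle: B ^ (2d+2) pairs (A, B) against
   prod_j (2 x_j) ^ n boxes; two pairs in the same box differ by a pair whose
   norms are integers of absolute value less than 1. *)
Lemma aux_poly (d k g : nat) (b : R) :
  (0 < k)%N -> (k <= d.+1)%N -> (0 < g)%N -> (n * k + g = 2 * d + 2)%N ->
  g%:R * b = (n * k * (d + 5))%:R * ln 2
             + (k%:R * (2 * d%:R + 3 - k%:R) / 2) * ln M ->
  exists A B : {poly int},
    [/\ (size A <= d.+1)%N /\ (size B <= d.+1)%N, (A != 0) || (B != 0),
        (forall i, cm (ic A)`_i <= expR b) /\ (forall i, cm (ic B)`_i <= expR b) &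
        forall i j, (j < k)%N -> ((ic A + al i *: ic B)^`N(j)).[al i] = 0].
Proof.
move=> k0 kd g0 nkg gb.
have M1 := mahler_ge1; have M0 : 0 < M by apply: lt_le_trans M1.
have lM0 : 0 <= ln M by apply: ln_ge0.
have l20 : 0 <= ln 2 :> R by apply: ln_ge0; rewrite ler1n.
have b0 : 0 <= b.
  have g0' : 0 < g%:R :> R by rewrite ltr0n.
  rewrite -(pmulr_rge0 _ g0') gb addr_ge0 ?mulr_ge0// ?invr_ge0//.
  by rewrite subr_ge0 -[3]/(3%:R) -natrM -natrD ler_nat; lia.
have eb1 : 1 <= expR b by rewrite -expR0 ler_expR.
pose N := Num.trunc (expR b).
have /andP[NB NB1] : N%:R <= expR b < N.+1%:R by apply: truncn_itv; rewrite expR_ge0.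
have N1 : (0 < N)%N by rewrite truncn_gt0.
pose e j := (d.+1 - j)%N.
(* The n-th power of [y j] is M^(e j), the contribution of the Mahler measure to the norm bound of
   order j; dividing by [y j] at each of the n roots removes it. *)
pose y j : R := expR ((e j)%:R / n%:R * ln M).
have y1 j : 1 <= y j.
  by rewrite -expR0 ler_expR mulr_ge0// divr_ge0.
pose x j : R := expR b * 2 ^+ (d + 4) * y j.
have x16 j : 2 <= x j.
  rewrite /x -[X in X <= _]mulr1 ler_pM//.
  rewrite -[X in X <= _]mul1r ler_pM// -natrX ler_nat addnS expnS.
  by rewrite -[X in (X <= _)%N]muln1 leq_mul// expn_gt0.
have x0 j : 0 < x j by apply: lt_le_trans (x16 j).
pose Q j := (Num.trunc (x j)).+1.
have Qx j : x j < (Q j)%:R by have /andP[] := truncn_itv (ltW (x0 j)).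
have Q2 j : (Q j).+1%:R <= 2 * x j.
  have -> : (Q j).+1%:R = (Num.trunc (x j))%:R + 2 :> R by rewrite -natrD addn2.
  by have /andP[h _] := truncn_itv (ltW (x0 j)); have := x16 j; lra.
pose T := ({ffun 'I_d.+1 -> 'I_N.+1} * {ffun 'I_d.+1 -> 'I_N.+1})%type.
pose mk (c : {ffun 'I_d.+1 -> 'I_N.+1}) : {poly int} := \poly_(i < d.+1) ((c (inord i) : nat) : int).
(* At al i this integer polynomial takes the value of the j-th divided derivative of A + al_i B, so
   [norm_int] applies to these values. *)
pose G (A B : {poly int}) j : {poly int} := A^`N(j) + 'X * B^`N(j).
have Gev A B j i : (ic (G A B j)).[al i] = ((ic A + al i *: ic B)^`N(j)).[al i].
  rewrite nderivnD nderivnZ hornerD hornerZ !nderivn_map rmorphD rmorphM/= map_polyX.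
  by rewrite hornerD hornerM hornerX.
pose vl (c : T) j i : R[i] := (ic (G (mk c.1) (mk c.2) j)).[al i].
pose rr j i : R := N%:R * 2 ^+ (d + 2) * Ae i ^+ e j.
have rr0 j i : 0 < rr j i.
  by rewrite !mulr_gt0 ?exprn_gt0// ?ltr0n// (lt_le_trans _ (Ae1 i)).
have mkc c i : cm (ic (mk c))`_i <= N%:R.
  rewrite coef_map/= coef_poly; case: ifP => _; last by rewrite mulr0z cm0.
  by rewrite -[_%:~R]/(_%:R) cm_nat ler_nat -ltnS.
have mks c : (size (ic (mk c)) <= d.+1)%N.
  by rewrite (leq_trans (size_poly _ _))// (leq_trans (size_poly _ _)).
have vlb c j i : (j < k)%N -> cm (vl c j i) <= rr j i.
  move=> jk; have jd : (j <= d)%N by rewrite -ltnS (leq_trans jk).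
  rewrite /vl Gev nderivnD nderivnZ hornerD hornerZ.
  apply: le_trans (cmD _ _) _; rewrite cmM.
  have hb c' := nderiv_bound (mks c') (mkc c') (Ae1 i) (_ : cm (al i) <= Ae i) jd.
  have aA : cm (al i) <= Ae i by rewrite le_max lexx orbT.
  apply: (@le_trans _ _ (N%:R * 2 ^+ d.+1 * Ae i ^+ (d - j) + Ae i * (N%:R * 2 ^+ d.+1 * Ae i ^+ (d - j)))).
    by rewrite lerD ?hb// ler_pM ?cm_ge0 ?hb.
  rewrite /rr /e subSn// addn2 !exprS.
  set E := _ ^+ (d - j); set D := 2 ^+ d.
  have E0 : 0 <= E by rewrite exprn_ge0// (le_trans _ (Ae1 i)).
  have D0 : 0 <= D by rewrite exprn_ge0.
  have -> : N%:R * (2 * D) * E + Ae i * (N%:R * (2 * D) * E) = (1 + Ae i) * (N%:R * (2 * D) * E) by ring.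
  have -> : N%:R * (2 * (2 * D)) * (Ae i * E) = (2 * Ae i) * (N%:R * (2 * D) * E) by ring.
  by rewrite ler_wpM2r ?mulr_ge0//; have := Ae1 i; lra.
(* Values at conjugate roots are conjugate, so one of the two indices records the real part and the
   other the imaginary part: n real coordinates determine all n values. *)
pose v c j i : R := if 0 <= cIm (al i) then cRe (vl c j i) else cIm (vl c j i).
have vb c j i : (j < k)%N -> `|v c j i| <= rr j i.
  move=> jk; apply: le_trans (vlb c j i jk); rewrite /v.
  by case: ifP => _; rewrite ?cm_geRe ?cm_geIm.
pose t c j i : R := (v c j i + rr j i) * ((Q j)%:R / (2 * rr j i)).
have Qr0 j i : 0 < (Q j)%:R / (2 * rr j i).
  apply: divr_gt0; [by rewrite ltr0n|apply: mulr_gt0; [by rewrite ltr0n|exact: rr0]].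
have t0 c j i : (j < k)%N -> 0 <= t c j i.
  move=> jk; rewrite mulr_ge0 ?(ltW (Qr0 _ _))//.
  by have := vb c j i jk; rewrite ler_norml => /andP[h _]; rewrite -lerBlDr sub0r.
have tQ c j i : (j < k)%N -> (Num.trunc (t c j i) <= Q j)%N.
  move=> jk; rewrite truncn_le_nat (@le_lt_trans _ _ (Q j)%:R) ?ltr_nat//.
  have := vb c j i jk; rewrite ler_norml => /andP[_ h].
  have r2 : 0 < 2 * rr j i by rewrite mulr_gt0 ?rr0 ?ltr0n.
  rewrite /t mulrA ler_pdivrMr// [X in _ <= X]mulrC ler_wpM2r//.
  by lra.
pose QM := \max_(j < k) Q j.
have QQM (j : 'I_k) : (Q j <= QM)%N by apply: leq_bigmax.
pose bx (c : T) : {ffun 'I_k * 'I_n -> 'I_QM.+1} :=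
  [ffun p : 'I_k * 'I_n => inord (Num.trunc (t c p.1 p.2))].
pose fam := [set h : {ffun 'I_k * 'I_n -> 'I_QM.+1} | [forall p : 'I_k * 'I_n, (h p < (Q p.1).+1)%N]].
have bxE c (p : 'I_k * 'I_n) : (bx c p : nat) = Num.trunc (t c p.1 p.2).
  by rewrite ffunE inordK// ltnS (leq_trans (tQ _ _ _ _)).
have bxfam c : bx c \in fam.
  by rewrite inE; apply/forallP => p; rewrite bxE ltnS tQ.
have cfam : (#|fam| = \prod_(j < k) ((Q j).+1 ^ n))%N.
  rewrite (@card_boxes _ _ (fun p : 'I_k * 'I_n => (Q p.1).+1)); last by move=> p; rewrite ltnS.
  rewrite -(pair_big predT predT (fun (j : 'I_k) (i : 'I_n) => (Q j).+1))/=.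
  by apply: eq_bigr => j _; rewrite prod_nat_const card_ord.
have lt_card : (#|fam| < #|{: T}|)%N.
  rewrite cfam card_prod card_ffun !card_ord -expnD addnn -mul2n.
  rewrite -(ltr_nat R) natr_prod natrX.
  apply: (@le_lt_trans _ _ (expR b ^+ (2 * d.+1))); last first.
    by rewrite ltrXn2r// ?expR_ge0.
  apply: (@le_trans _ _ (\prod_(j < k) (2 * x j) ^+ n)).
    apply: ler_prod => j _; rewrite ler0n natrX/= lerXn2r ?nnegrE//.
    by rewrite mulr_ge0// ltW.
  have xE j : (2 * x j) ^+ n = expR (n%:R * b + (n * (d + 5))%:R * ln 2 + (e j)%:R * ln M).
    rewrite !expRD.
    have -> : expR ((n * (d + 5))%:R * ln 2) = (2 ^+ (d + 5)) ^+ n :> R.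
      by rewrite expRM_natl lnK ?posrE// -exprM mulnC.
    have -> : expR ((e j)%:R * ln M) = y j ^+ n.
      rewrite -expRM_natl mulrA mulrCA divff ?mulr1//.
      by rewrite pnatr_eq0 -lt0n.
    rewrite expRM_natl -!exprMn; congr (_ ^+ _).
    have -> : 2 ^+ (d + 5) = 2 * 2 ^+ (d + 4) :> R by rewrite -exprS -addnS.
    by rewrite /x; ring.
  rewrite (eq_bigr (fun j : 'I_k => expR (n%:R * b + (n * (d + 5))%:R * ln 2 + (e j)%:R * ln M))) => [|j _]; last exact: xE.
  rewrite -expR_sum -expRM_natl ler_expR.
  rewrite big_split/= sumr_const card_ord -mulr_suml.
  have -> : \sum_(j < k) (e j)%:R = k%:R * (2 * d%:R + 3 - k%:R) / 2 :> R.
    rewrite /e; elim: (k) kd => [|k' IH] kd'; first by rewrite big_ord0 !mul0r.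
    rewrite big_ord_recr/= IH ?(ltnW kd')// natrB ?(ltnW kd')// -!natr1.
    by field.
  have -> : (n%:R * b + (n * (d + 5))%:R * ln 2) *+ k + k%:R * (2 * d%:R + 3 - k%:R) / 2 * ln M
     = (n * k)%:R * b + g%:R * b.
    by rewrite gb -mulr_natr !natrM; ring.
  by rewrite -mulrDl -natrD nkg mulnS addnC.
have [c [c' [cc' bb]]] : exists c c', c != c' /\ bx c = bx c'.
  apply: contrapT => h; have inj : injective bx.
    move=> c c' bb; apply: contrapT => /eqP cc'; apply: h; by exists c, c'.
  have : (#|bx @: [set: T]| <= #|fam|)%N.
    by apply/subset_leq_card/fintype.subsetP => z /imsetP[c _ ->].
  by rewrite card_imset// cardsT leqNgt lt_card.
pose A := mk c.1 - mk c'.1; pose B := mk c.2 - mk c'.2.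
have sz c1 c2 : (size (mk c1 - mk c2)%R <= d.+1)%N.
  rewrite (leq_trans (size_polyD _ _))// size_polyN geq_max.
  by rewrite !(leq_trans (size_poly _ _)).
have co c1 c2 i : cm (ic (mk c1 - mk c2))`_i <= expR b.
  rewrite coef_map/= coefB !coef_poly; case: ifP => _; last by rewrite subr0 mulr0z cm0 expR_ge0.
  rewrite cm_int; apply: le_trans NB; rewrite rmorphB/= -![_%:~R]/(_%:R).
  rewrite ler_norml; have := ltn_ord (c1 (inord i)); have := ltn_ord (c2 (inord i)).
  rewrite !ltnS -!(ler_nat R); set u := _%:R; set w := _%:R => h1 h2.
  have := ler0n R (c1 (inord i)); have := ler0n R (c2 (inord i)).
  by rewrite -/u -/w => h3 h4; apply/andP; split; lra.
exists A, B; split.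
- by rewrite !sz.
- apply: contraNT cc'; rewrite negb_or !negbK !subr_eq0 => /andP[/eqP e1 /eqP e2].
  have inj c1 c2 : mk c1 = mk c2 -> c1 = c2.
    move=> E; apply/ffunP => i; apply: val_inj.
    have := congr1 (fun p : {poly int} => p`_i) E; rewrite !coef_poly ltn_ord !inord_val.
    by move=> [].
  by apply/eqP; rewrite [c]surjective_pairing [c']surjective_pairing (inj _ _ e1) (inj _ _ e2).
- by split=> i; apply: co.
move=> i j jk; rewrite -Gev.
have jd : (j <= d)%N by rewrite -ltnS (leq_trans jk).
have GB : G A B j = G (mk c.1) (mk c.2) j - G (mk c'.1) (mk c'.2) j.
  by rewrite /G /A /B !nderivnB; ring.
have GBv l : (ic (G A B j)).[al l] = vl c j l - vl c' j l.
  by rewrite GB rmorphB/= hornerD hornerN.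
have small l : `|v c j l - v c' j l| <= 2 * rr j l / (Q j)%:R.
  have := congr1 (fun h : {ffun _ -> 'I_QM.+1} => h (Ordinal jk, l) : nat) bb.
  rewrite !bxE/= => E.
  have /andP[u1 u2] := truncn_itv (t0 c j l jk).
  have /andP[w1 w2] := truncn_itv (t0 c' j l jk).
  rewrite E in u1 u2.
  have : `|t c j l - t c' j l| <= 1.
    rewrite -natr1 in u2 w2; rewrite ler_norml; apply/andP; split; lra.
  have -> : t c j l - t c' j l = (v c j l - v c' j l) * ((Q j)%:R / (2 * rr j l)) by rewrite /t; ring.
  rewrite normrM (ger0_norm (ltW (Qr0 _ _))) -ler_pdivlMr//.
  by rewrite invfM invrK mul1r mulrC.
have [cj [cjE cjK]] := conj_index fal.
have vlconj c0 l : vl c0 j (cj l) = (vl c0 j l)^*.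
  rewrite /vl cjE -horner_map -map_poly_comp; congr (_.[_]).
  by apply: eq_map_poly => z /=; rewrite rmorph_int.
have rrc l : rr j (cj l) = rr j l by rewrite /rr /Ae cjE cm_conj.
have vlsmall l : cm (vl c j l - vl c' j l) <= 4 * rr j l / (Q j)%:R.
  have q0 : 0 <= 2 * rr j l / (Q j)%:R by apply: divr_ge0 => //; rewrite mulr_ge0 // ltW.
  apply: le_trans (cm_leReIm _) _.
  have -> : 4 * rr j l / (Q j)%:R = 2 * rr j l / (Q j)%:R + 2 * rr j l / (Q j)%:R by ring.
  have ImJ (z : R[i]) : cIm z^* = - cIm z by case: z.
  have ReJ (z : R[i]) : cRe z^* = cRe z by case: z.
  have ReB (z w : R[i]) : cRe (z - w) = cRe z - cRe w by case: z => ? ?; case: w.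
  have ImB (z w : R[i]) : cIm (z - w) = cIm z - cIm w by case: z => ? ?; case: w.
  have s1 := small l; have s2 := small (cj l); move: s1 s2.
  rewrite /v rrc cjE ImJ !vlconj ReB ImB.
  have [lp|lp|lz] := ltgtP 0 (cIm (al l)).
  - rewrite (_ : 0 <= - _ = false) => [s1 s2|]; last by apply/negbTE; rewrite -ltNge oppr_lt0.
    by apply: lerD => //; move: s2; rewrite !ImJ opprK addrC distrC.
  - rewrite (_ : 0 <= - _) ?oppr_ge0 ?(ltW lp)// => s1 s2.
    by rewrite addrC; apply: lerD => //; move: s2; rewrite !ReJ.
  - move=> s1 _; apply: lerD => //.
    have cjl : cj l = l.
      apply: (rs_inj fal); rewrite cjE; move: lz; case: (al l) => p q /= <-.
      by rewrite oppr0.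
    have im0 c0 : cIm (vl c0 j l) = 0.
      have := congr1 (fun z => cIm z) (vlconj c0 l); rewrite cjl ImJ => E.
      by lra.
    by rewrite !im0 subrr normr0.
(* [Q j] exceeds [x j] strictly; this factor below 1 makes the norm strictly less than 1. *)
pose th := x j / (Q j)%:R.
have Q0 : 0 < (Q j)%:R :> R by rewrite ltr0n.
have th0 : 0 <= th by rewrite divr_ge0// ltW.
have th1 : th < 1 by rewrite ltr_pdivrMr// mul1r.
have vl2 l : cm (ic (G A B j)).[al l] <= Ae l ^+ e j * (y j)^-1 * th.
  rewrite GBv; apply: le_trans (vlsmall l) _.
  have y0 : 0 < y j by apply: lt_le_trans (y1 j).
  have -> : Ae l ^+ e j * (y j)^-1 * th = (4 * (expR b * 2 ^+ (d + 2) * Ae l ^+ e j)) / (Q j)%:R.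
    have -> : th = expR b * (2 ^+ (d + 2) * 4) * y j / (Q j)%:R.
      have e4 : 2 ^+ (d + 4) = 2 ^+ (d + 2) * 4 :> R.
        by rewrite [in LHS](_ : (d + 4)%N = (d + 2).+2) ?addnS// !exprSr -mulrA -natrM.
      by rewrite /th /x e4.
    by field; rewrite !gt_eqF.
  rewrite ler_pM2r ?invr_gt0// ler_pM2l// /rr -!mulrA.
  by rewrite ler_wpM2r// mulr_ge0 ?exprn_ge0// (le_trans _ (Ae1 l)).
have sG : (size (G A B j) <= (e j).+1)%N.
  have sd (p : {poly int}) : (size p <= d.+1)%N -> (size p^`N(j) <= d.+1 - j)%N.
    by move=> sp; rewrite (leq_trans (size_poly _ _))// leq_sub2r.
  rewrite (leq_trans (size_polyD _ _))// geq_max (leq_trans (sd _ (sz _ _))) ?leqnSn//=.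
  rewrite (leq_trans (size_polyMleq _ _))// size_polyX.
  by rewrite add2n /= ltnS; apply: sd (sz _ _).
have [z Ez] := norm_int fal sG.
have z0 : z = 0.
  apply/eqP; have : `|z%:~R : R| < 1.
    rewrite -cm_int -Ez cmM cm_prod cmX cm_int.
    apply: (@le_lt_trans _ _ (`|(lead_coef f)%:~R| ^+ e j * \prod_(l < n) (Ae l ^+ e j * (y j)^-1 * th))).
      rewrite ler_wpM2l ?exprn_ge0//; apply: ler_prod => l _.
      by rewrite cm_ge0 vl2.
    have PE : `|(lead_coef f)%:~R| ^+ e j * \prod_(l < n) Ae l ^+ e j = M ^+ e j.
      by rewrite prodrXl -exprMn.
    have yn : (y j)^-1 ^+ n = (M ^+ e j)^-1.
      rewrite exprVn -expRM_natl mulrA mulrCA divff ?pnatr_eq0 -?lt0n// mulr1.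
      by rewrite expRM_natl lnK ?posrE.
    rewrite [X in _ * X]big_split/= [X in _ * (X * _)]big_split/= !prodr_const card_ord -!mulrA mulrA PE mulrA yn.
    rewrite divff ?gt_eqF ?exprn_gt0// mul1r.
    by rewrite exprn_ilt1// -lt0n.
  by rewrite -intr_norm -[1]/(1%:~R) ltr_int -[X in _ < X]add0r ltzD1 normr_le0.
have : \prod_(l < n) (ic (G A B j)).[al l] == 0.
  have := Ez; rewrite z0 mulr0z => /eqP; rewrite mulf_eq0 expf_eq0.
  by rewrite (negPf (lead_neq0 fal)) andbF.
rewrite prodf_seq_eq0 => /hasP[l _ /=] hl.
(* The norm being 0, some value vanishes; conjugacy carries the zero to every root. *)
by apply/eqP; apply: (rs_irr fal) hl.
Qed.

End AuxiliaryPolynomial.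

(** * The Thue inequality for two rational approximations *)

Section ThueStep.
Variable R : realType.
Local Notation ic := (map_poly (intr : int -> R[i])).

Lemma nderivn_nderivn_eq0 (K : numFieldType) (p : {poly K}) (i j : nat) x :
  (p^`N(i + j)).[x] = 0 -> ((p^`N(j))^`N(i)).[x] = 0.
Proof.
move=> h; have E : (p^`N(j))^`N(i) *+ i`! *+ j`! = p^`N(i + j) *+ (i + j)`!.
  by rewrite -[_ *+ i`!]nderivn_def -derivnMn -!nderivn_def /derivn -iterD.
have := congr1 (fun q : {poly K} => q.[x]) E.
rewrite !hornerMn h mul0rn => /eqP.
by rewrite !mulrn_eq0 !eqn0Ngt !fact_gt0/= => /eqP.
Qed.

Lemma horner_frac_int (p : {poly int}) (e : nat) (a b : int) : b != 0 ->
  (size p <= e.+1)%N ->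
  exists z : int, (ic p).[a%:~R / b%:~R] * b%:~R ^+ e = z%:~R.
Proof.
move=> b0 sp; exists (\sum_(i < e.+1) p`_i * a ^+ i * b ^+ (e - i)).
have b0' : b%:~R != 0 :> R[i] by rewrite intr_eq0.
rewrite (@horner_coef_wide _ e.+1); last by rewrite (leq_trans (size_poly _ _)).
rewrite mulr_suml rmorph_sum/=; apply: eq_bigr => i _.
rewrite coef_map/= !rmorphM/= !rmorphXn/= expr_div_n -!mulrA; congr (_ * (_ * _)).
have -> : b%:~R ^+ e = b%:~R ^+ i * b%:~R ^+ (e - i) :> R[i].
  by rewrite -exprD subnKC// -ltnS.
by rewrite mulrA mulVf ?mul1r// expf_neq0.
Qed.

Variables (n : nat) (f : {poly int}) (al : 'I_n -> R[i]).
Hypothesis fal : root_system f al.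
Hypothesis n_gt1 : (1 < n)%N.

(** At a rational root b X - a vanishes, hence it vanishes at all n > 1 conjugates, which are
    distinct. *)
Lemma rs_irrational (a b : int) i : b != 0 -> a%:~R / b%:~R != al i.
Proof.
move=> b0; have b0' : b%:~R != 0 :> R[i] by rewrite intr_eq0.
apply/eqP => E; pose g : {poly int} := b *: 'X - a%:P.
have gE z : (ic g).[z] = b%:~R * z - a%:~R.
  by rewrite rmorphB/= map_polyZ map_polyX map_polyC/= hornerD hornerN hornerZ hornerX hornerC.
have ri : root (ic g) (al i) by rewrite rootE gE -E mulrC divfK// subrr.
have rj j : al j = al i.
  have := rs_irr fal j ri; rewrite rootE gE subr_eq0 => /eqP h.
  by rewrite -E -h mulrC mulKf.
have := rs_inj fal (etrans (rj (Ordinal (ltnW n_gt1))) (esym (rj (Ordinal n_gt1)))).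
by move/(congr1 val).
Qed.

(** The j-th divided derivative of A + x2 B at x1, multiplied by q1^(d-j) q2, is a nonzero integer,
    hence at least 1 in absolute value. For the upper bound (x2 - a) B is split off and A + a B is
    expanded at a, where it vanishes to order k. Here g = 2 d + 2 - n k is the excess of
    coefficients over vanishing conditions, and J = g + n - 3 makes the degree count of
    [wronsk_nonvanishing] an equality. *)
Lemma thue_step (l : 'I_n) (a b : R) (d k g J : nat) (p1 q1 p2 q2 : int) :
  al l = a%:C -> 0 < q1 -> 0 < q2 ->
  (0 < k)%N -> (k <= d)%N -> (0 < g)%N -> (n * k + g = 2 * d + 2)%N ->
  (J + 3 = g + n)%N -> (J < k)%N -> (d < n.-1 * k)%N ->
  g%:R * b = (n * k * (d + 5))%:R * ln 2
             + (k%:R * (2 * d%:R + 3 - k%:R) / 2) * ln (mahler f al) ->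
  `|p1%:~R / q1%:~R - a| <= 1 ->
  exists2 j, (j <= J)%N &
    1 <= q1%:~R ^+ (d - j) * q2%:~R * (8 ^+ d.+1 * expR b) *
      (Num.max 1 `|a| ^+ (d.+1 - k) * `|p1%:~R / q1%:~R - a| ^+ (k - j)
       + Num.max 1 `|a| ^+ d * `|p2%:~R / q2%:~R - a|).
Proof.
move=> ala q10 q20 k0 kd g0 nkg Jg Jk dk gb x1a.
have kd1 : (k <= d.+1)%N by rewrite ltnW.
have [A [B [[sA sB] AB0 [cA cB] van]]] := aux_poly fal (ltnW n_gt1) k0 kd1 g0 nkg gb.
have sic (p : {poly int}) : (size p <= d.+1)%N -> (size (ic p) <= d.+1)%N.
  by move=> sp; rewrite (leq_trans (size_poly _ _)).
have ic0 (p : {poly int}) : (ic p == 0) = (p == 0).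
  by rewrite -!size_poly_eq0 size_map_inj_poly//; exact: intr_inj.
pose x1 : R[i] := p1%:~R / q1%:~R; pose x2 : R[i] := p2%:~R / q2%:~R.
pose y1 : R := p1%:~R / q1%:~R; pose y2 : R := p2%:~R / q2%:~R.
have x1E : x1 = y1%:C by rewrite /x1 /y1 rmorphM fmorphV !rmorph_int.
have x2E : x2 = y2%:C by rewrite /x2 /y2 rmorphM fmorphV !rmorph_int.
have q1n : q1 != 0 by rewrite gt_eqF.
have q2n : q2 != 0 by rewrite gt_eqF.
have ABi : (ic A != 0) || (ic B != 0) by rewrite !ic0.
have dJ : (2 * d <= J + n * k.-1 + 1)%N.
  have : (n * k = n * k.-1 + n)%N by rewrite -mulnSr prednK.
  by move: Jg nkg; clear; lia.
have [j jJ V0] := @wronsk_nonvanishing R[i] n k d J al x1 x2 (ic A) (ic B)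
  (rs_inj fal) (fun i => rs_irrational p1 i q1n) (ltnW n_gt1) k0
  (sic _ sA) (sic _ sB) ABi dk dJ van.
have jk : (j < k)%N by apply: leq_ltn_trans Jk.
have jd : (j <= d)%N by apply: leq_trans (ltnW jk) kd.
exists j => //.
set Am := Num.max 1 `|a|.
have Am1 : 1 <= Am by rewrite le_max lexx.
have Am0 : 0 <= Am by apply: le_trans Am1.
have eb0 : 0 <= expR b by apply: expR_ge0.
pose V := ((ic A + x2 *: ic B)^`N(j)).[x1].
have snd (p : {poly int}) : (size p <= d.+1)%N -> (size p^`N(j) <= (d - j).+1)%N.
  by move=> sp; rewrite (leq_trans (size_poly _ _))// -subSn// leq_sub2r.
have low : 1 <= q1%:~R ^+ (d - j) * q2%:~R * cm V.
  have [zA EA] := horner_frac_int p1 q1n (snd _ sA).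
  have [zB EB] := horner_frac_int p1 q1n (snd _ sB).
  have VE : V * (q1%:~R ^+ (d - j) * q2%:~R) = (zA * q2 + p2 * zB)%:~R.
    rewrite /V nderivnD nderivnZ hornerD hornerZ !nderivn_map.
    rewrite rmorphD !rmorphM/= -EA -EB /x1 /x2.
    by field; rewrite intr_eq0.
  have := congr1 (@cm R) VE; rewrite !cmM cmX !cm_int => E.
  rewrite -(ger0_norm (_ : 0 <= q1%:~R)) ?ler0z ?(ltW q10)//.
  rewrite -(ger0_norm (_ : 0 <= q2%:~R)) ?ler0z ?(ltW q20)//.
  rewrite mulrC E -intr_norm -[1]/(1%:~R) ler_int -gtz0_ge1 normr_gt0.
  rewrite -(intr_eq0 R[i]) -VE mulf_neq0// mulf_neq0 ?expf_neq0 ?intr_eq0//.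
apply: le_trans low _; rewrite -!mulrA ler_wpM2l ?exprn_ge0 ?ler0z ?(ltW q10)//.
rewrite ler_wpM2l ?ler0z ?(ltW q20)//.
pose h := ic A + a%:C *: ic B.
have VE : V = (h^`N(j)).[x1] + (x2 - a%:C) * ((ic B)^`N(j)).[x1].
  by rewrite /V /h !nderivnD !nderivnZ !hornerD !hornerZ; ring.
have x2a : cm (x2 - a%:C) = `|y2 - a| by rewrite x2E -rmorphB cm_real.
have Bb : cm ((ic B)^`N(j)).[x1] <= 8 ^+ d.+1 * expR b * Am ^+ d.
  have x1A : cm x1 <= 2 * Am.
    rewrite x1E cm_real.
    have : `|y1| <= `|y1 - a| + `|a| by rewrite -{1}(subrK a y1) ler_normD.
    have : `|a| <= Am by rewrite le_max lexx orbT.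
    by move: x1a; rewrite -/y1; lra.
  have A21 : 1 <= 2 * Am by lra.
  apply: le_trans (nderiv_bound (sic _ sB) cB A21 x1A jd) _.
  apply: (@le_trans _ _ (expR b * 2 ^+ d.+1 * (2 * Am) ^+ d)).
    by rewrite ler_wpM2l ?mulr_ge0 ?exprn_ge0// ler_weXn2l// leq_subr.
  rewrite exprMn mulrA ler_wpM2r ?exprn_ge0// [X in _ <= X]mulrC -mulrA ler_wpM2l//.
  rewrite -exprD (_ : 8 = 2 ^+ 3); last by rewrite -natrX.
  by rewrite -exprM ler_weXn2l ?ler1n//; clear; lia.
have hb : cm (h^`N(j)).[x1] <= 8 ^+ d.+1 * expR b * (Am ^+ (d.+1 - k) * `|y1 - a| ^+ (k - j)).
  have sh : (size h <= d.+1)%N.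
    rewrite (leq_trans (size_polyD _ _))// geq_max sic//=.
    by rewrite (leq_trans (size_scale_leq _ _))// sic.
  have ch i : cm h`_i <= 2 * Am * expR b.
    rewrite coefD coefZ; apply: le_trans (cmD _ _) _; rewrite cmM cm_real.
    have aA : `|a| <= Am by rewrite le_max lexx orbT.
    have := ler_pM (normr_ge0 a) (cm_ge0 _) aA (cB i).
    have := cA i; have := ler_wpM2r eb0 Am1; lra.
  have shj : (size h^`N(j) <= (d - j).+1)%N.
    by rewrite (leq_trans (size_poly _ _))// -subSn// leq_sub2r.
  have chj i : cm (h^`N(j))`_i <= 2 * Am * expR b * 2 ^+ d.
    rewrite coef_nderivn -[h`_(j + i) *+ _]mulr_natr cmM cm_nat.
    have [lt|le] := ltnP (j + i) d.+1.
      apply: ler_pM (cm_ge0 _) (ler0n _ _) (ch _) _.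
      rewrite -natrX ler_nat (leq_trans (bin_le_expn _ _))//.
      by rewrite leq_exp2l// -ltnS.
    by rewrite nth_default ?(leq_trans sh)// cm0 mul0r !mulr_ge0 ?exprn_ge0.
  have x1d : x1 = a%:C + (y1 - a)%:C by rewrite x1E -rmorphD addrC subrK.
  have := @nderiv_taylor_wide _ (d - j).+1 (h^`N(j)) a%:C (y1 - a)%:C (mulrC _ _) shj.
  rewrite -x1d => ->.
  apply: le_trans (cm_sum _ _ _) _.
  pose T := 2 * Am * expR b * 2 ^+ d * 2 ^+ d.+1 * (Am ^+ (d - k) * `|y1 - a| ^+ (k - j)).
  have T0 : 0 <= T by rewrite !mulr_ge0 ?exprn_ge0.
  apply: (@le_trans _ _ (\sum_(i < (d - j).+1) T)).
    apply: ler_sum => i _; rewrite cmM cmX cm_real.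
    have [ik|ki] := ltnP (i + j) k.
      rewrite nderivn_nderivn_eq0 ?cm0 ?mul0r//.
      by rewrite /h -ala; apply: van.
    have id : (i <= d - j)%N by rewrite -ltnS.
    have aA : cm a%:C <= Am by rewrite cm_real le_max lexx orbT.
    apply: (@le_trans _ _ ((2 * Am * expR b * 2 ^+ d * 2 ^+ (d - j).+1 * Am ^+ (d - j - i)) * `|y1 - a| ^+ (k - j))).
      apply: ler_pM; rewrite ?cm_ge0 ?exprn_ge0//.
        exact: nderiv_bound.
      by apply: ler_wiXn2l => //; move: ki jk; clear; lia.
    rewrite /T mulrA ler_wpM2r ?exprn_ge0//.
    apply: ler_pM; rewrite ?mulr_ge0 ?exprn_ge0//.
      by rewrite ler_wpM2l ?mulr_ge0 ?exprn_ge0// ler_weXn2l ?ler1n// ltnS leq_subr.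
    by rewrite ler_weXn2l//; move: ki id jk jd kd; clear; lia.
  rewrite sumr_const card_ord -[X in X <= _]mulr_natr.
  have nd : (d - j).+1%:R <= 2 ^+ d :> R.
    by rewrite -natrX ler_nat (leq_trans _ (ltn_expl _ _))// ltnS leq_subr.
  apply: (@le_trans _ _ (T * 2 ^+ d)); first by rewrite ler_wpM2l.
  rewrite /T subSn// [Am ^+ (d - k).+1]exprS.
  have -> : 2 * Am * expR b * 2 ^+ d * 2 ^+ d.+1 * (Am ^+ (d - k) * `|y1 - a| ^+ (k - j)) * 2 ^+ d
    = (2 * 2 ^+ d * 2 ^+ d.+1 * 2 ^+ d) * (expR b * (Am * Am ^+ (d - k) * `|y1 - a| ^+ (k - j))) by ring.
  rewrite -[X in _ <= X]mulrA ler_wpM2r ?mulr_ge0 ?exprn_ge0//.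
  rewrite -exprS -!exprD (_ : 8 = 2 ^+ 3); last by rewrite -natrX.
  by rewrite -exprM ler_weXn2l ?ler1n//; clear; lia.
rewrite VE; apply: le_trans (cmD _ _) _; rewrite cmM x2a.
have -> : 8 ^+ d.+1 * (expR b * (Am ^+ (d.+1 - k) * `|y1 - a| ^+ (k - j) + Am ^+ d * `|y2 - a|)) =
  8 ^+ d.+1 * expR b * (Am ^+ (d.+1 - k) * `|y1 - a| ^+ (k - j)) + `|y2 - a| * (8 ^+ d.+1 * expR b * Am ^+ d) by ring.
by apply: lerD => //; apply: ler_wpM2l.
Qed.

End ThueStep.

(** * Gap principle and Thue alternative for good approximations *)

Section LargeSolutions.
Variable R : realType.

Lemma ln_nat2_gt0 : 0 < ln 2 :> R.
Proof. by rewrite ln_gt0// ltr1n. Qed.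

(** Numerical constants are compared in multiples of ln 2; (7/2)^5 is about 525, just above 2^9. *)
Lemma ln72_ge : 9 / 5 * ln 2 <= ln (7 / 2) :> R.
Proof.
have h : ln (2 ^+ 9) <= ln ((7 / 2) ^+ 5) :> R.
  rewrite ler_ln ?posrE ?exprn_gt0//; last by lra.
  by rewrite !exprS !expr0; lra.
move: h; rewrite !lnXn; [|lra|lra].
rewrite -[ln _ *+ 9]mulr_natl -[ln _ *+ 5]mulr_natl; lra.
Qed.

Lemma norm_intr_ge1 (z : int) : z != 0 -> 1 <= `|z%:~R : R|.
Proof. by rewrite -normr_gt0 gtz0_ge1 => h; rewrite -intr_norm (ler_int _ 1). Qed.

Lemma intr_ge1 (z : int) : 0 < z -> 1 <= z%:~R :> R.
Proof. by rewrite gtz0_ge1 => h; rewrite (ler_int _ 1). Qed.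

Variables (n : nat) (f : {poly int}) (al : 'I_n -> R[i]).
Hypothesis fal : root_system f al.
Hypothesis n_ge3 : (3 <= n)%N.
Variables (l : 'I_n) (a : R).
Hypothesis ala : al l = a%:C.
Let m := ln (mahler f al).
Let s := ln (Num.max 1 `|a|).
Variable kap : R.
Hypothesis kap0 : 0 <= kap.
Let mu := m - s - kap.

Definition approx (p : int * int) : Prop :=
  0 < p.2 /\
  `|p.1%:~R / p.2%:~R - a| <= expR ((n%:R - 2) * mu) / (2 * p.2%:~R ^+ n).

(** Measuring ln y from [mu] absorbs the constant of the gap principle, which becomes a pure
    multiplication by n - 1. The margin [kap] inside [mu] is fixed later, depending on the
    degree. *)
Definition zeta (p : int * int) : R := ln p.2%:~R - mu.

Let A1 : 1 <= Num.max 1 `|a|. Proof. by rewrite le_max lexx. Qed.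
Let A0 : 0 < Num.max 1 `|a|. Proof. exact: lt_le_trans A1. Qed.

Lemma max_le_mahler (i : 'I_n) : Num.max 1 (cm (al i)) <= mahler f al.
Proof.
rewrite /mahler (bigD1 i)//= mulrCA -[X in X <= _]mulr1.
rewrite ler_wpM2l ?le_max ?ler01// mulr_ege1 ?(abs_lead_ge1 fal)//.
by apply: (big_ind (fun x => 1 <= x)) => // [x y|j _]; [exact: mulr_ege1|rewrite le_max lexx].
Qed.

Let sm : s <= m.
Proof.
by have := max_le_mahler l; rewrite ala cm_real => h; rewrite /s /m ler_ln ?posrE// (lt_le_trans A0).
Qed.

Lemma approx_expR p : approx p ->
  `|p.1%:~R / p.2%:~R - a| <= expR (- 2 * mu - n%:R * zeta p) / 2.
Proof.
case=> p0 h; apply: le_trans h _.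
have pp : 0 < p.2%:~R :> R by rewrite ltr0z.
have -> : - 2 * mu - n%:R * zeta p = (n%:R - 2) * mu - n%:R * ln p.2%:~R.
  by rewrite /zeta; ring.
rewrite expRD expRN expRM_natl lnK ?posrE// invfM.
by rewrite mulrA mulrAC.
Qed.

Lemma zeta_gap p p' : approx p -> approx p' -> p.1 * p'.2 != p'.1 * p.2 ->
  p.2 <= p'.2 -> (n%:R - 1) * zeta p <= zeta p'.
Proof.
move=> hp hp' cr le.
have [p0 h] := hp; have [p0' h'] := hp'.
have pp : 0 < p.2%:~R :> R by rewrite ltr0z.
have pp' : 0 < p'.2%:~R :> R by rewrite ltr0z.
have ler : p.2%:~R <= p'.2%:~R :> R by rewrite ler_int.
pose E := expR ((n%:R - 2) * mu).
have E0 : 0 < E by apply: expR_gt0.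
have h2 : `|p'.1%:~R / p'.2%:~R - a| <= E / (2 * p.2%:~R ^+ n).
  apply: le_trans h' _; rewrite ler_wpM2l ?(ltW E0)// lef_pV2 ?posrE ?mulr_gt0 ?exprn_gt0//.
  by rewrite ler_wpM2l//; apply: lerXn2r => //; rewrite nnegrE ltW.
have tri : `|p.1%:~R / p.2%:~R - p'.1%:~R / p'.2%:~R| <= E / p.2%:~R ^+ n.
  have -> : p.1%:~R / p.2%:~R - p'.1%:~R / p'.2%:~R =
     (p.1%:~R / p.2%:~R - a) - (p'.1%:~R / p'.2%:~R - a) :> R by ring.
  apply: le_trans (ler_normB _ _) _; apply: le_trans (lerD h h2) _.
  have -> : E / (2 * p.2%:~R ^+ n) + E / (2 * p.2%:~R ^+ n) = E / p.2%:~R ^+ n; last by [].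
  by rewrite invfM; lra.
have low : 1 <= `|p.1%:~R / p.2%:~R - p'.1%:~R / p'.2%:~R| * (p.2%:~R * p'.2%:~R) :> R.
  rewrite -[X in _ <= _ * X]ger0_norm ?mulr_ge0 ?(ltW pp) ?(ltW pp')// -normrM.
  have -> : (p.1%:~R / p.2%:~R - p'.1%:~R / p'.2%:~R) * (p.2%:~R * p'.2%:~R) =
     (p.1 * p'.2 - p'.1 * p.2)%:~R :> R.
    by rewrite rmorphB !rmorphM/=; field; rewrite !gt_eqF.
  by rewrite norm_intr_ge1 ?subr_eq0.
have big : 1 <= E / p.2%:~R ^+ n * (p.2%:~R * p'.2%:~R).
  by apply: le_trans low _; rewrite ler_wpM2r// mulr_ge0 ?(ltW pp) ?(ltW pp').
have yn0 : 0 < p.2%:~R ^+ n :> R by apply: exprn_gt0.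
have En : 0 < E / p.2%:~R ^+ n by apply: divr_gt0.
have yy : 0 < p.2%:~R * p'.2%:~R :> R by apply: mulr_gt0.
have lnE : ln (E / p.2%:~R ^+ n * (p.2%:~R * p'.2%:~R)) =
    (n%:R - 2) * mu - n%:R * ln p.2%:~R + (ln p.2%:~R + ln p'.2%:~R).
  rewrite lnM ?posrE// ln_div ?posrE// lnM ?posrE// lnXn// -[ln _ *+ n]mulr_natl.
  by rewrite /E expRK.
have := ln_ge0 big; rewrite lnE /zeta; lra.
Qed.

(** One of the two terms of [thue_step] carries at least half of the right-hand side, and this
    factor 2 is absorbed by the 1/2 in [approx_expR]. After taking logarithms the unknown order j is
    replaced by its worst value, J next to [zeta p1] in the first case and 0 in the second. *)
Lemma thue_alternative (p1 p2 : int * int) (d k g J : nat) (b c : R) :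
  approx p1 -> approx p2 -> 0 <= zeta p1 -> 2 * kap <= n%:R * zeta p1 ->
  (0 < k)%N -> (k <= d)%N -> (0 < g)%N -> (n * k + g = 2 * d + 2)%N ->
  (J + 3 = g + n)%N -> (J < k)%N -> (d < n.-1 * k)%N ->
  g%:R * b = (n * k * (d + 5))%:R * ln 2 + (k%:R * (2 * d%:R + 3 - k%:R) / 2) * m ->
  0 <= c -> 2 * k%:R - d%:R - 1 <= c ->
  (n%:R * k%:R - d%:R - (n%:R - 1) * J%:R) * zeta p1 <=
    zeta p2 + (d%:R + 1 - k%:R) * m + c * kap + 3 * (d%:R + 1) * ln 2 + b \/
  (n%:R - 1) * zeta p2 <=
    d%:R * zeta p1 + d%:R * m + b + 3 * (d%:R + 1) * ln 2 - (d%:R - 1) * kap.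
Proof.
move=> h1 h2 z10 z1k k0 kd g0 nkg Jg Jk dk gb c0 ck.
have [q10 _] := h1; have [q20 _] := h2.
have qq1 : 0 < p1.2%:~R :> R by rewrite ltr0z.
have qq2 : 0 < p2.2%:~R :> R by rewrite ltr0z.
have e1 := approx_expR h1; have e2 := approx_expR h2.
have small : `|p1.1%:~R / p1.2%:~R - a| <= 1.
  apply: le_trans e1 _.
  have : expR (- 2 * mu - n%:R * zeta p1) <= 1.
    by rewrite -[X in _ <= X]expR0 ler_expR /mu; have := sm; lra.
  by have := expR_ge0 (- 2 * mu - n%:R * zeta p1); lra.
have [j jJ] := thue_step fal (ltnW n_ge3) p2.1 ala q10 q20 k0 kd g0 nkg Jg Jk dk gb small.
have jk : (j < k)%N by apply: leq_ltn_trans Jk.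
have jd : (j <= d)%N by apply: leq_trans (ltnW jk) kd.
set X1 := `|_ / p1.2%:~R - a|; set X2 := `|_ / p2.2%:~R - a|; set Am := Num.max _ _.
set Cst := p1.2%:~R ^+ (d - j) * p2.2%:~R * (8 ^+ d.+1 * expR b).
have kd1 : (k <= d.+1)%N by apply: leqW.
have eb0 : 0 < expR b by apply: expR_gt0.
have Cst0 : 0 < Cst by rewrite !mulr_gt0 ?exprn_gt0.
have lq1 : ln (p1.2%:~R : R) = zeta p1 + mu by rewrite /zeta subrK.
have lq2 : ln (p2.2%:~R : R) = zeta p2 + mu by rewrite /zeta subrK.
have lq10 : 0 <= ln p1.2%:~R :> R by apply: ln_ge0; apply: intr_ge1.
have ln8 : ln 8 = 3 * ln 2 :> R.
  by rewrite (_ : 8 = 2 ^+ 3) ?lnXn -?[ln _ *+ _]mulr_natl// -natrX.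
have lnC : ln Cst = (d%:R - j%:R) * (zeta p1 + mu) + (zeta p2 + mu) + 3 * (d%:R + 1) * ln 2 + b.
  rewrite /Cst !lnM ?posrE ?mulr_gt0 ?exprn_gt0// !lnXn// -![ln _ *+ _]mulr_natl expRK ln8 lq1 lq2.
  by rewrite natrB// -natr1; ring.
move=> h; clearbody Cst.
have [hI|hII] : 1 <= Cst * (2 * (Am ^+ (d.+1 - k) * X1 ^+ (k - j))) \/ 1 <= Cst * (2 * (Am ^+ d * X2)).
  move: h; rewrite mulrDr => h; set u := Cst * (Am ^+ (d.+1 - k) * X1 ^+ (k - j)) in h *.
  set w := Cst * (Am ^+ d * X2) in h *.
  have -> : Cst * (2 * (Am ^+ (d.+1 - k) * X1 ^+ (k - j))) = 2 * u by rewrite /u; ring.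
  have -> : Cst * (2 * (Am ^+ d * X2)) = 2 * w by rewrite /w; ring.
  by have [?|?] := lerP w u; [left|right]; lra.
- left.
  have X1b : 2 * X1 ^+ (k - j) <= expR (- 2 * mu - n%:R * zeta p1) ^+ (k - j).
    set E := expR _ in e1 *; have E0 : 0 <= E by apply: expR_ge0.
    have kj : (k - j = (k - j).-1.+1)%N by rewrite prednK// subn_gt0.
    rewrite kj !exprS; apply: (@le_trans _ _ (2 * (E / 2 * E ^+ (k - j).-1))).
      have X10 : 0 <= X1 by apply: normr_ge0.
      have e1' : X1 <= E / 2 by exact: e1.
      have X1E : X1 <= E by lra.
      rewrite ler_wpM2l//; apply: ler_pM => //; first by rewrite exprn_ge0.
      exact: lerXn2r.
    by rewrite mulrA mulrCA divff ?mulr1// pnatr_eq0.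
  have hI' : 1 <= Cst * (Am ^+ (d.+1 - k) * expR (- 2 * mu - n%:R * zeta p1) ^+ (k - j)).
    by apply: le_trans hI _; rewrite ler_wpM2l ?(ltW Cst0)// mulrCA ler_wpM2l// exprn_ge0// (ltW A0).
  move: hI' => /ln_ge0.
  rewrite !lnM ?posrE ?mulr_gt0 ?exprn_gt0 ?expR_gt0// !lnXn ?expR_gt0// -![ln _ *+ _]mulr_natl expRK lnC.
  rewrite (natrB _ kd1) (natrB _ (ltnW jk)) -[d.+1%:R]natr1 -/s => hI'.
  have jJ' : j%:R <= J%:R :> R by rewrite ler_nat.
  have jk' : j%:R <= k%:R :> R by rewrite ler_nat ltnW.
  have n1 : 3 <= n%:R :> R by rewrite (ler_nat _ 3).
  have j0 : 0 <= j%:R :> R by [].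
  have nJ : 0 <= (n%:R - 1) * (J%:R - j%:R) * zeta p1 by rewrite !mulr_ge0//; lra.
  have key : (d%:R + 1 + j%:R - 2 * k%:R) * mu + (d%:R + 1 - k%:R) * s <= (d%:R + 1 - k%:R) * m + c * kap.
    have t1 : 0 <= (k%:R - j%:R) * (m - s) by rewrite mulr_ge0//; have := sm; lra.
    have t2 : 0 <= (c + (d%:R + 1 + j%:R - 2 * k%:R)) * kap by rewrite mulr_ge0//; lra.
    by rewrite /mu; nra.
  nra.
- right.
  have hII' : 1 <= Cst * (Am ^+ d * expR (- 2 * mu - n%:R * zeta p2)).
    apply: le_trans hII _; rewrite ler_wpM2l ?(ltW Cst0)// mulrCA ler_wpM2l ?exprn_ge0 ?(ltW A0)//.
    by move: e2; rewrite -/X2; lra.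
  move: hII' => /ln_ge0.
  rewrite !lnM ?posrE ?mulr_gt0 ?exprn_gt0 ?expR_gt0// !lnXn ?expR_gt0// -![ln _ *+ _]mulr_natl expRK lnC.
  rewrite -/s => hII'.
  have j0 : 0 <= j%:R :> R by [].
  have t1 : 0 <= j%:R * (zeta p1 + mu) by rewrite mulr_ge0// -lq1.
  have := sm; rewrite /mu in t1 hII' *; nra.
Qed.

(* U is the logarithmic unit in which all constants are absorbed. *)
Lemma thue_contradiction (p1 p2 : int * int) (d k g J : nat) (c om Del : R) :
  let U := m + om in let h := k%:R * (2 * d%:R + 3 - k%:R) / (2 * g%:R) in
  approx p1 -> approx p2 -> 0 < U -> 0 < Del -> Del * U <= zeta p1 ->
  2 * kap <= n%:R * zeta p1 ->
  (0 < k)%N -> (k <= d)%N -> (0 < g)%N -> (n * k + g = 2 * d + 2)%N ->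
  (J + 3 = g + n)%N -> (J < k)%N -> (d < n.-1 * k)%N ->
  0 <= c -> 2 * k%:R - d%:R - 1 <= c ->
  (d%:R + 1 - k%:R) * m + c * kap + 3 * (d%:R + 1) * ln 2 <= d%:R * U ->
  3 * (d%:R + 1) * ln 2 <= (d%:R - 1) * kap ->
  2 * n%:R * (d%:R + 5) * ln 2 <= (2 * d%:R + 3 - k%:R) * om ->
  Del * zeta p2 < (Del * (n%:R * k%:R - d%:R - (n%:R - 1) * J%:R) - (d%:R + h)) * zeta p1 ->
  (Del * d%:R + d%:R + h) * zeta p1 < Del * (n%:R - 1) * zeta p2 ->
  False.
Proof.
move=> U h h1 h2 U0 D0 DU z1k k0 kd g0 nkg Jg Jk dk c0 ck H1 H2 H3 HI HII.
have z10 : 0 < zeta p1 by apply: lt_le_trans DU; rewrite mulr_gt0.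
have g0' : 0 < g%:R :> R by rewrite ltr0n.
have k0' : 0 < k%:R :> R by rewrite ltr0n.
have kd' : k%:R <= d%:R :> R by rewrite ler_nat.
pose b := ((n * k * (d + 5))%:R * ln 2 + (k%:R * (2 * d%:R + 3 - k%:R) / 2) * m) / g%:R.
have gb : g%:R * b = (n * k * (d + 5))%:R * ln 2 + (k%:R * (2 * d%:R + 3 - k%:R) / 2) * m.
  by rewrite /b mulrCA divff ?mulr1// gt_eqF.
have h0 : 0 <= h by rewrite divr_ge0 ?mulr_ge0//; lra.
have bU : b <= h * U.
  rewrite /b ler_pdivrMr//.
  have -> : h * U * g%:R = k%:R * (2 * d%:R + 3 - k%:R) / 2 * U.
    by rewrite /h; field; rewrite gt_eqF.
  rewrite !natrM natrD /U mulrDr.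
  have := ler_wpM2l (ltW k0') H3.
  set T := k%:R * _ / 2; have -> : k%:R * ((2 * d%:R + 3 - k%:R) * om) = 2 * (T * om) by rewrite /T; field.
  have -> : k%:R * (2 * n%:R * (d%:R + 5) * ln 2) = 2 * (n%:R * k%:R * (d%:R + 5) * ln 2) :> R by ring.
  by lra.
have dh0 : 0 <= d%:R + h by rewrite addr_ge0.
(* As U is at most [zeta p1] / Del, every constant becomes a fraction of [zeta p1]. [HI] and [HII]
   then place the ratio of [zeta p2] to [zeta p1] in a window where both alternatives fail. *)
have dhU : Del * ((d%:R + h) * U) <= (d%:R + h) * zeta p1.
  by rewrite mulrCA ler_wpM2l.
have dm : d%:R * m + b + 3 * (d%:R + 1) * ln 2 - (d%:R - 1) * kap <= (d%:R + h) * U.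
  have om0 : 0 <= om.
    have l2 := ln_nat2_gt0.
    have : 0 <= (2 * d%:R + 3 - k%:R) * om.
      by apply: le_trans H3; rewrite !mulr_ge0 ?addr_ge0// ltW.
    by rewrite pmulr_rge0//; have : 0 <= d%:R :> R by []; lra.
  have : 0 <= d%:R * om by rewrite mulr_ge0.
  by rewrite mulrDl; rewrite /U in bU *; lra.
have [hI|hII] := thue_alternative h1 h2 (ltW z10) z1k k0 kd g0 nkg Jg Jk dk gb c0 ck.
- have : Del * ((n%:R * k%:R - d%:R - (n%:R - 1) * J%:R) * zeta p1) <= Del * (zeta p2 + (d%:R + h) * U).
    rewrite ler_wpM2l ?(ltW D0)//; apply: le_trans hI _.
    by move: H1 bU; clear; clearbody U h; lra.
  by move: HI dhU; clear; nra.
- have : Del * ((n%:R - 1) * zeta p2) <= Del * (d%:R * zeta p1 + (d%:R + h) * U).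
    by rewrite ler_wpM2l ?(ltW D0)//; apply: le_trans hII _; move: dm; clear; lra.
  by move: HII dhU; clear; nra.
Qed.

End LargeSolutions.

(** * Number of large solutions near one real root *)

Section LargeCount.
Variable R : realType.
Variables (n : nat) (f : {poly int}) (al : 'I_n -> R[i]).
Hypothesis fal : root_system f al.
Hypothesis n_ge3 : (3 <= n)%N.
Variables (l : 'I_n) (a : R).
Hypothesis ala : al l = a%:C.
Let m := ln (mahler f al).
Variable kap : R.
Local Notation approx := (approx f al a kap).
Local Notation zeta := (zeta f al a kap).

Let m0 : 0 <= m. Proof. exact/ln_ge0/(mahler_ge1 fal). Qed.
Let l20 : 0 < ln 2 :> R. Proof. exact: ln_nat2_gt0. Qed.

(** Each choice of (d, k) excludes a window of ratios [zeta p2] / [zeta p1]. The windows of d = 8 G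
    - 1, k = 5 G leave gaps for small G, which are filled by those of d = 8 G + 2, k = 5 G + 2. *)
Lemma large_pair3 (p1 p2 : int * int) : n = 3%N -> kap = m / 9 + 7 * ln 2 ->
  approx p1 -> approx p2 -> 71 * (m + 6 * ln 2) <= zeta p1 ->
  4 * zeta p1 <= zeta p2 -> False.
Proof.
move=> n3 kapE h1 h2 z1U z12; have m0' := m0; have l20' := l20.
have nR : n%:R = 3 :> R by rewrite n3.
have kap0 : 0 <= kap by rewrite kapE; lra.
have z1 : 0 < zeta p1 by lra.
have U0 : 0 < m + 6 * ln 2 by lra.
have z1k : 2 * kap <= n%:R * zeta p1 by rewrite nR; lra.
(* The lower ends of the first windows grow with slope 1207 / 284 in G. The integer part of [X] is,
   up to rounding, the largest G whose first window starts below the ratio; past its upper end the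
   second family takes over. *)
pose X := (284 * zeta p2 + 138 * zeta p1) / (1207 * zeta p1).
have den : 0 < 1207 * zeta p1 by lra.
have X1 : 1 <= X by rewrite ler_pdivlMr//; lra.
have /andP[gX Xg] := truncn_itv (le_trans ler01 X1).
have : (0 < Num.trunc X)%N by rewrite truncn_gt0.
case E : (Num.trunc X) => [//|g] _.
pose G : R := g%:R + 1.
have gX' : G <= X by move: gX; rewrite E -[g.+1%:R]natr1.
have Xg' : X < G + 1 by move: Xg; rewrite E -[g.+2%:R]natr1 -[g.+1%:R]natr1.
have G1 : 1 <= G by rewrite /G lerDr.
have XE : X * (1207 * zeta p1) = 284 * zeta p2 + 138 * zeta p1.
  by rewrite /X divfK// gt_eqF.
have lo : (603 + 1/2) * (G * zeta p1) <= 142 * zeta p2 + 69 * zeta p1.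
  by have := ler_wpM2r (ltW den) gX'; rewrite XE; lra.
have hi : 142 * zeta p2 + 69 * zeta p1 < (603 + 1/2) * (G * zeta p1 + zeta p1).
  by move: Xg'; rewrite -(ltr_pM2r den) XE; lra.
have Gz : zeta p1 <= G * zeta p1 by rewrite -[X in X <= _]mul1r ler_wpM2r// ltW.
have GK : G * kap = G * m / 9 + 7 * (G * ln 2) by rewrite kapE; ring.
have Gm : m <= G * m by rewrite -[X in X <= _]mul1r ler_wpM2r.
have Gl : ln 2 <= G * ln 2 by rewrite -[X in X <= _]mul1r ler_wpM2r// ltW.
have [c1|c2] := ltP (71 * zeta p2) ((319 + 1/2) * (G * zeta p1) + (69 + 1/2) * zeta p1).
- have dE : (8 * g + 7)%:R = 8 * G - 1 :> R by rewrite natrD natrM /G; ring.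
  have kE : (5 * g + 5)%:R = 5 * G :> R by rewrite natrD natrM /G; ring.
  have JE : (g + 1)%:R = G :> R by rewrite natrD.
  have gE : g.+1%:R = G :> R by rewrite -natr1.
  have hE : 5 * G * (2 * (8 * G - 1) + 3 - 5 * G) / (2 * G) = 27 * G + G / 2 + 2 + 1/2.
    by field; rewrite gt_eqF//; lra.
  apply: (@thue_contradiction _ _ _ _ fal n_ge3 l a ala kap kap0 p1 p2
    (8 * g + 7) (5 * g + 5) g.+1 (g + 1) (5 / 2 * G) (6 * ln 2) 71);
  rewrite ?dE ?kE ?JE ?gE ?nR ?hE -/m //; first [by (clear -n3; lia)|lra].
- have dE : (8 * g + 10)%:R = 8 * G + 2 :> R by rewrite natrD natrM /G; ring.
  have kE : (5 * g + 7)%:R = 5 * G + 2 :> R by rewrite natrD natrM /G; ring.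
  have JE : (g + 1)%:R = G :> R by rewrite natrD.
  have gE : g.+1%:R = G :> R by rewrite -natr1.
  pose h := (5 * G + 2) * (2 * (8 * G + 2) + 3 - (5 * G + 2)) / (2 * G).
  have hz : h * zeta p1 <= (27 * G + G / 2 + 28 + 1/2) * zeta p1.
    rewrite ler_wpM2r ?(ltW z1)// ler_pdivrMr; last by lra.
    nra.
  have hz0 : 0 <= h by rewrite divr_ge0 ?mulr_ge0//; lra.
  apply: (@thue_contradiction _ _ _ _ fal n_ge3 l a ala kap kap0 p1 p2
    (8 * g + 10) (5 * g + 7) g.+1 (g + 1) (5 / 2 * G + 1) (6 * ln 2) 71);
  rewrite ?dE ?kE ?JE ?gE ?nR -/h -/m //; first [by (clear -n3; lia)|lra].
Qed.

Section AtLeastFour.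
Hypothesis n_ge4 : (4 <= n)%N.
Hypothesis kapE : kap = n%:R * ln (7 / 2) - ln 2.
Let om := kap - ln 2 / 5.

Let nR4 : 4 <= n%:R :> R. Proof. by rewrite (ler_nat _ 4). Qed.

Let om_ge : (9 / 5 * n%:R - 6 / 5) * ln 2 <= om.
Proof.
have l20' := l20; have := ler_wpM2l (ler0n R n) (ln72_ge R).
rewrite /om kapE; lra.
Qed.

Let om6 : 6 * ln 2 <= om.
Proof. by apply: le_trans om_ge; rewrite ler_wpM2r ?(ltW l20)//; have := nR4; lra. Qed.

(** With c = 0 and [om6], the conditions of [thue_contradiction] on [kap] and [om] follow once for
    all, except for one inequality between n, d and k. *)
Lemma large_pair_gen (p1 p2 : int * int) (d k g J : nat) (Del : R) :
  let h := k%:R * (2 * d%:R + 3 - k%:R) / (2 * g%:R) in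
  approx p1 -> approx p2 -> 1 <= Del -> Del * (m + om) <= zeta p1 ->
  (0 < k)%N -> (k <= d)%N -> (0 < g)%N -> (n * k + g = 2 * d + 2)%N ->
  (J + 3 = g + n)%N -> (J < k)%N -> (d < n.-1 * k)%N -> (3 <= d)%N ->
  2 * k%:R - d%:R - 1 <= 0 :> R ->
  2 * n%:R * (d%:R + 5) <= (2 * d%:R + 3 - k%:R) * (9 / 5 * n%:R - 6 / 5) :> R ->
  Del * zeta p2 < (Del * (n%:R * k%:R - d%:R - (n%:R - 1) * J%:R) - (d%:R + h)) * zeta p1 ->
  (Del * d%:R + d%:R + h) * zeta p1 < Del * (n%:R - 1) * zeta p2 ->
  False.
Proof.
move=> h h1 h2 D1 z1U k0 kd g0 nkg Jg Jk dk d3 kd2 H3 HI HII.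
have m0' := m0; have l20' := l20; have om6' := om6; have nR4' := nR4.
have kap0 : 0 <= kap by move: om6; rewrite /om; have := l20; lra.
have U0 : 0 < m + om by have := om6; have := l20; have := m0; lra.
have d3' : 3 <= d%:R :> R by rewrite (ler_nat _ 3).
have k1' : 1 <= k%:R :> R by rewrite (ler_nat _ 1).
have kd' : k%:R <= d%:R :> R by rewrite ler_nat.
have z1om : m + om <= zeta p1.
  by apply: le_trans z1U; rewrite -[X in X <= _]mul1r ler_wpM2r// ltW.
apply: (@thue_contradiction _ _ _ _ fal n_ge3 l a ala kap kap0 p1 p2 d k g J 0 om Del) => //.
- by lra.
- apply: (@le_trans _ _ (4 * zeta p1)).
    by have := om6; have := m0; have := l20; rewrite /om in z1om *; lra.
  by rewrite ler_wpM2r//; have := om6; have := m0; have := l20; lra.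
- rewrite mul0r addr0 -/m.
  have t1 : (d%:R + 1 - k%:R) * m <= d%:R * m by rewrite ler_wpM2r//; lra.
  have t2 : d%:R * (6 * ln 2) <= d%:R * om by rewrite ler_wpM2l//; lra.
  have t3 : 3 * ln 2 <= d%:R * ln 2 :> R by rewrite ler_wpM2r// ltW.
  lra.
- have t2 : (d%:R - 1) * (6 * ln 2) <= (d%:R - 1) * kap.
    have d1 : 0 <= d%:R - 1 :> R by lra.
    by apply: (ler_wpM2l d1); move: om6'; rewrite /om; lra.
  have t3 : 3 * ln 2 <= d%:R * ln 2 :> R by rewrite ler_wpM2r// ltW.
  lra.
- apply: (@le_trans _ _ ((2 * d%:R + 3 - k%:R) * ((9 / 5 * n%:R - 6 / 5) * ln 2))).
    by rewrite mulrA ler_wpM2r// ltW.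
  have p0 : 0 <= 2 * d%:R + 3 - k%:R :> R by lra.
  exact: (ler_wpM2l p0 om_ge).
Qed.

(** The parameters are k = 16 T, d = (8 n + 1) T - 1, g = 2 T, J = 2 T + n - 3; the upper bound on n
    is what J < k demands. *)
Lemma large_pair_family (p1 p2 : int * int) (t : nat) (Del : R) :
  let T := t.+1%:R in
  approx p1 -> approx p2 -> 1 <= Del -> Del * (m + om) <= zeta p1 ->
  (n <= 14 * t.+1 + 2)%N ->
  Del * zeta p2 < (Del * ((6 * n%:R + 1) * T + 1 - (n%:R - 1) * (n%:R - 3))
                   - ((72 * n%:R - 55) * T + 3)) * zeta p1 ->
  (Del * ((8 * n%:R + 1) * T - 1) + (72 * n%:R - 55) * T + 3) * zeta p1
    < Del * (n%:R - 1) * zeta p2 ->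
  False.
Proof.
move=> T h1 h2 D1 z1U nt HI HII; have nR4' := nR4.
have T1 : 1 <= T by rewrite /T (ler_nat _ 1).
pose d := ((8 * n + 1) * t + 8 * n)%N.
have dE : d%:R = (8 * n%:R + 1) * T - 1 :> R.
  by rewrite /d /T !(natrD, natrM) -[t.+1%:R]natr1; ring.
have kE : (16 * t.+1)%:R = 16 * T :> R by rewrite natrM.
have gE : (2 * t.+1)%:R = 2 * T :> R by rewrite natrM.
have JE : (2 * t.+1 + (n - 3))%:R = 2 * T + n%:R - 3 :> R.
  by rewrite natrD natrM natrB// addrA.
have hE : 16 * T * (2 * ((8 * n%:R + 1) * T - 1) + 3 - 16 * T) / (2 * (2 * T)) =
    (64 * n%:R - 56) * T + 4.
  by field; rewrite gt_eqF//; lra.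
have nT : 4 * T <= n%:R * T by rewrite ler_wpM2r//; lra.
have n4T : 4 * (n%:R * T) <= n%:R * (n%:R * T).
  by rewrite ler_wpM2r ?mulr_ge0//; lra.
apply: (@large_pair_gen p1 p2 d (16 * t.+1) (2 * t.+1) (2 * t.+1 + (n - 3)) Del);
  rewrite ?dE ?kE ?gE ?JE ?hE//.
- by rewrite /d; clear -n_ge4; nia.
- by rewrite /d; clear; nia.
- by clear -n_ge4; lia.
- by clear -nt n_ge4; lia.
- by rewrite /d; clear -n_ge4; nia.
- by rewrite /d; clear -n_ge4; nia.
- by lra.
- set N := n%:R in nR4' nT n4T *.
  have q : 0 <= (N - 4) * (64 / 5 * N - 7 / 5) by rewrite mulr_ge0//; lra.
  have q2 : 0 <= ((N - 4) * (64 / 5 * N - 7 / 5) + 10 + 31 / 5 * N + 6 / 5) * (T - 1).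
    by rewrite mulr_ge0//; lra.
  lra.
- by move: HI; lra.
- by move: HII; lra.
Qed.

Lemma large_pair4 (p1 p2 : int * int) : n = 4%N ->
  approx p1 -> approx p2 -> 81 * (m + om) <= zeta p1 ->
  27 * zeta p1 <= zeta p2 -> False.
Proof.
move=> n4 h1 h2 z1U z12; have nR : n%:R = 4 :> R by rewrite n4.
have z1 : 0 < zeta p1 by have := om6; have := l20; have := m0; lra.
(* The T-th window of the family starts below 12 T and, for T >= 2, ends above 12 (T + 1); so T is
   taken to be the integer part of the ratio divided by 12. *)
pose X := zeta p2 / (12 * zeta p1).
have X2 : 2 <= X by rewrite ler_pdivlMr; lra.
have X0 : 0 <= X by lra.
have /andP[tX Xt] := truncn_itv X0.
have : (1 < Num.trunc X)%N by rewrite truncn_ge_nat.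
case E : (Num.trunc X) => [|t] // t1.
rewrite E in tX Xt; rewrite -natr1 in Xt; set T : R := t.+1%:R in tX Xt.
have T2 : 2 <= T by rewrite /T (ler_nat _ 2).
have lo : 12 * (T * zeta p1) <= zeta p2 by move: tX; rewrite ler_pdivlMr; lra.
have hi : zeta p2 < 12 * (T * zeta p1 + zeta p1) by move: Xt; rewrite ltr_pdivrMr; lra.
have Tz : 2 * zeta p1 <= T * zeta p1 by rewrite ler_wpM2r// ltW.
apply: (@large_pair_family p1 p2 t 81 h1 h2 _ z1U _); rewrite -/T ?nR; [lra|by rewrite n4; clear; lia|lra|lra].
Qed.

Lemma large_pair5 (p1 p2 : int * int) : n = 5%N ->
  approx p1 -> approx p2 -> 64 * (m + om) <= zeta p1 ->
  16 * zeta p1 <= zeta p2 -> False.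
Proof.
move=> n5 h1 h2 z1U z12; have nR : n%:R = 5 :> R by rewrite n5.
have z1 : 0 < zeta p1 by have := om6; have := l20; have := m0; lra.
(* The family leaves a gap between its windows for T = 1 and T = 2; the single choice d = 50, k = 20
   covers all ratios from 16 to 26. *)
have [c|c] := ltP (zeta p2) (26 * zeta p1).
  apply: (@large_pair_gen p1 p2 50 20 2 4 64) => //; rewrite ?nR ?n5//; lra.
pose X := zeta p2 / (12 * zeta p1).
have X2 : 2 <= X by rewrite ler_pdivlMr; lra.
have X0 : 0 <= X by lra.
have /andP[tX Xt] := truncn_itv X0.
have : (1 < Num.trunc X)%N by rewrite truncn_ge_nat.
case E : (Num.trunc X) => [|t] // t1.
rewrite E in tX Xt; rewrite -natr1 in Xt; set T : R := t.+1%:R in tX Xt.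
have T2 : 2 <= T by rewrite /T (ler_nat _ 2).
have lo : 12 * (T * zeta p1) <= zeta p2 by move: tX; rewrite ler_pdivlMr; lra.
have hi : zeta p2 < 12 * (T * zeta p1 + zeta p1) by move: Xt; rewrite ltr_pdivrMr; lra.
have Tz : 2 * zeta p1 <= T * zeta p1 by rewrite ler_wpM2r// ltW.
apply: (@large_pair_family p1 p2 t 64 h1 h2 _ z1U _); rewrite -/T ?nR; [lra|by rewrite n5; clear; lia|lra|lra].
Qed.

Lemma large_pair6 (p1 p2 : int * int) : (6 <= n)%N ->
  approx p1 -> approx p2 -> (n%:R - 1) ^+ 3 * (m + om) <= zeta p1 ->
  (n%:R - 1) ^+ 2 * zeta p1 <= zeta p2 -> False.
Proof.
move=> n6 h1 h2 z1U z12.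
have N6 : 6 <= n%:R :> R by rewrite (ler_nat _ 6).
set N : R := n%:R in N6 z1U z12.
have D125 : 125 <= (N - 1) ^+ 3.
  by rewrite (_ : 125 = 5 ^+ 3) ?lerXn2r ?nnegrE//; [lra|lra|rewrite -natrX].
set Del := (N - 1) ^+ 3 in D125 z1U.
have U0 : 0 < m + om by have := om6; have := l20; have := m0; lra.
have z1 : 0 < zeta p1 by apply: lt_le_trans z1U; rewrite mulr_gt0//; lra.
have n5 : 0 < 8 * N + 5 by lra.
(* Since 72 N - 52 <= 4 Del (shown in [D4]), the T-th window starts below (8 N + 5) T / (N - 1),
   which dictates this choice of T. *)
pose X := (N - 1) * zeta p2 / ((8 * N + 5) * zeta p1).
have den : 0 < (8 * N + 5) * zeta p1 by rewrite mulr_gt0.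
have XD : Del / (8 * N + 5) <= X.
  rewrite ler_pdivrMr// /X mulrAC ler_pdivlMr//.
  have : (N - 1) * ((N - 1) ^+ 2 * zeta p1) <= (N - 1) * zeta p2 by rewrite ler_wpM2l//; lra.
  rewrite /Del exprS mulrA => h.
  by have := ler_wpM2r (ltW n5) h; lra.
have X2 : 2 <= X.
  apply: le_trans XD; rewrite ler_pdivlMr// /Del.
  have : 0 <= (N - 6) * (N - 1) ^+ 2 by rewrite mulr_ge0 ?exprn_ge0//; lra.
  have : 0 <= (N - 6) * N by rewrite mulr_ge0//; lra.
  by rewrite !exprS expr0; lra.
have X0 : 0 <= X by lra.
have /andP[tX Xt] := truncn_itv X0.
have : (1 < Num.trunc X)%N by rewrite truncn_ge_nat.
case E : (Num.trunc X) => [|t] // t1.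
rewrite E in tX Xt; rewrite -natr1 in Xt; set T : R := t.+1%:R in tX Xt.
have T2 : 2 <= T by rewrite /T (ler_nat _ 2).
have DT : Del < (8 * N + 5) * (T + 1).
  by have := le_lt_trans XD Xt; rewrite ltr_pdivrMr// mulrC.
have lo : (8 * N + 5) * (T * zeta p1) <= (N - 1) * zeta p2.
  by move: tX; rewrite ler_pdivlMr//; lra.
have hi : (N - 1) * zeta p2 < (8 * N + 5) * ((T + 1) * zeta p1).
  by move: Xt; rewrite ltr_pdivrMr//; lra.
have NT : 6 * T <= N * T by rewrite ler_wpM2r//; lra.
have D4 : (72 * N - 52) * T <= 4 * Del * T.
  rewrite ler_wpM2r//.
  have h1' : 25 <= (N - 1) ^+ 2.
    by rewrite (_ : 25 = 5 ^+ 2) ?lerXn2r ?nnegrE//; [lra|lra|rewrite -natrX].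
  have : 25 * (N - 1) <= (N - 1) ^+ 2 * (N - 1) by rewrite ler_wpM2r//; lra.
  by rewrite /Del exprSr; lra.
apply: (@large_pair_family p1 p2 t Del) => //; rewrite -/T -/N.
- by lra.
- rewrite -(ler_nat R) natrD natrM -/T -/N.
  have : (N - 1) ^+ 2 * (N - 1) < (8 * N + 5) * (T + 1) by rewrite -exprSr.
  have h1' : 0 <= (N - 6) * N by rewrite mulr_ge0//; lra.
  rewrite expr2; nra.
- set C := (6 * N + 1) * T + 1 - (N - 1) * (N - 3).
  have key : (8 * N + 5) * (T + 1) + (N - 1) * (4 * T) <= (N - 1) * C.
    have e1 : (N - 1) * ((N - 1) * (N - 3)) <= (8 * N + 5) * (T + 1) - 2 * (N - 1) ^+ 2.
      by move: DT; rewrite /Del !exprS expr0; lra.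
    have e2 : 0 <= (N - 6) * (T - 2) by rewrite mulr_ge0//; lra.
    have e3 : 0 <= (N - 6) * N * T by rewrite !mulr_ge0//; lra.
    have e4 : 0 <= (N - 6) * N by rewrite mulr_ge0//; lra.
    rewrite /C !exprS expr0 in e1 *.
    by lra.
  have Dz : 0 < Del * zeta p1 by rewrite mulr_gt0//; lra.
  rewrite -(ltr_pM2l (_ : 0 < N - 1)); last by lra.
  apply: (@lt_le_trans _ _ (Del * ((8 * N + 5) * ((T + 1) * zeta p1)))).
    by rewrite mulrCA ltr_pM2l//; lra.
  have : (8 * N + 5) * (T + 1) * (Del * zeta p1) <= (N - 1) * (C - 4 * T) * (Del * zeta p1).
    by rewrite ler_wpM2r ?(ltW Dz)//; lra.
  have : (N - 1) * ((72 * N - 55) * T + 3) * zeta p1 <= (N - 1) * (4 * Del * T) * zeta p1.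
    by rewrite ler_wpM2r ?(ltW z1)// ler_wpM2l//; lra.
  lra.
- apply: (@lt_le_trans _ _ (Del * ((8 * N + 5) * (T * zeta p1)))); last first.
    by rewrite -mulrA ler_wpM2l//; lra.
  rewrite !mulrA ltr_pM2r//; lra.
Qed.

End AtLeastFour.

Definition large_bound : nat := if (n == 3)%N then 8%N else if (n == 4)%N then 7%N else 5%N.

(** With one solution more, 6, 4 or 3 gap steps (degree 3, 4, at least 5) raise zeta to Del times
    the unit, where Del is 71, 81 or (n - 1)^3; another 2, 3 or 2 steps produce the ratio required
    by the pair lemmas. In degree 3 the factor 10/9 in [zmin] lifts 2^6 = 64 over 71. *)
Lemma large_count (zmin : R) (sq : seq (int * int)) :
  (n = 3%N -> kap = m / 9 + 7 * ln 2 /\ 10 / 9 * (m + 6 * ln 2) <= zmin) ->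
  ((4 <= n)%N -> kap = n%:R * ln (7 / 2) - ln 2 /\ m + kap - ln 2 / 5 <= zmin) ->
  uniq sq -> {in sq, forall p, approx p /\ zmin <= zeta p} ->
  {in sq &, forall p p', p != p' -> p.1 * p'.2 != p'.1 * p.2} ->
  (size sq <= large_bound)%N.
Proof.
move=> H3 H4 usq hsq csq.
rewrite leqNgt; apply/negP => big.
pose le2 (p p' : int * int) := p.2 <= p'.2.
pose t := sort le2 sq.
have st : size t = size sq by rewrite size_sort.
have ut : uniq t by rewrite sort_uniq.
have mt p : (p \in t) = (p \in sq) by rewrite mem_sort.
have sort_t : sorted le2 t by apply: sort_sorted => p p'; exact: le_total.
have p0 : (int * int)%type := (0, 0).
pose u i := nth p0 t i.
have ut_in i : (i < size t)%N -> u i \in sq by move=> h; rewrite -mt mem_nth.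
have N1 : 2 <= n%:R - 1 :> R by rewrite -(natrB _ (ltnW (ltnW n_ge3))) (ler_nat _ 2); clear -n_ge3; lia.
have kap0 : 0 <= kap.
  have [n3|n3] := eqVneq n 3%N; first by have [-> _] := H3 n3; have := m0; have := l20; lra.
  have n4 : (4 <= n)%N by rewrite ltn_neqAle eq_sym n3.
  have [-> _] := H4 n4.
  have := ler_wpM2l (ler0n R n) (ln72_ge R).
  have : 4 * ln 2 <= n%:R * ln 2 :> R by rewrite ler_wpM2r ?(ltW l20)// (ler_nat _ 4).
  by have := l20; lra.
have step i : (i.+1 < size t)%N -> (n%:R - 1) * zeta (u i) <= zeta (u i.+1).
  move=> h; have hi := ltnW h.
  have [a1 _] := hsq _ (ut_in _ hi); have [a2 _] := hsq _ (ut_in _ h).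
  apply: zeta_gap a1 a2 _ _ => //.
    apply: csq; rewrite ?ut_in//.
    by rewrite /u nth_uniq//; clear; lia.
  by move/(sortedP p0): sort_t => /(_ i h).
have chain i e : (i + e < size t)%N -> (n%:R - 1) ^+ e * zeta (u i) <= zeta (u (i + e)%N).
  elim: e => [|e IH] h; first by rewrite expr0 mul1r addn0.
  rewrite addnS in h *; apply: le_trans (step _ h).
  rewrite exprS -mulrA ler_wpM2l ?IH ?(ltnW h)//; lra.
have zu i : (i < size t)%N -> approx (u i) /\ zmin <= zeta (u i).
  by move=> h; apply/hsq/ut_in.
move: big; rewrite -st /large_bound; case: eqP => [n3|n3].
  move=> big; have [kE zE] := H3 n3.
  have N2 : n%:R - 1 = 2 :> R by rewrite n3; lra.
  have lt6 : (0 + 6 < size t)%N by apply: leq_trans big.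
  have lt8 : (6 + 2 < size t)%N by apply: leq_trans big.
  have c1 := chain _ _ lt6; have c2 := chain _ _ lt8.
  have [_ z0] := zu _ (leq_ltn_trans (leq0n _) lt6).
  have [a6 _] := zu _ lt6; have [a8 _] := zu _ lt8.
  apply: (large_pair3 n3 kE a6 a8); rewrite N2 in c1 c2.
    apply: le_trans c1; rewrite !exprS expr0; have := m0; have := l20; lra.
  by apply: le_trans c2; rewrite !exprS expr0; lra.
have n4 : (4 <= n)%N by move: n3 n_ge3; clear; lia.
have [kE zE] := H4 n4.
case: eqP => [n4'|n4'].
  move=> big.
  have N3 : n%:R - 1 = 3 :> R by rewrite n4'; lra.
  have lt4 : (0 + 4 < size t)%N by apply: leq_trans big.
  have lt7 : (4 + 3 < size t)%N by apply: leq_trans big.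
  have c1 := chain _ _ lt4; have c2 := chain _ _ lt7.
  have [_ z0] := zu _ (leq_ltn_trans (leq0n _) lt4).
  have [a6 _] := zu _ lt4; have [a8 _] := zu _ lt7.
  apply: (large_pair4 n4 kE n4' a6 a8); rewrite N3 in c1 c2.
    by apply: le_trans c1; rewrite !exprS expr0; lra.
  by apply: le_trans c2; rewrite !exprS expr0; lra.
move=> big.
have lt3 : (0 + 3 < size t)%N by apply: leq_trans big.
have lt5 : (3 + 2 < size t)%N by apply: leq_trans big.
have c1 := chain _ _ lt3; have c2 := chain _ _ lt5.
have [_ z0] := zu _ (leq_ltn_trans (leq0n _) lt3).
have [a6 _] := zu _ lt3; have [a8 _] := zu _ lt5.
have c1' : (n%:R - 1) ^+ 3 * (m + (kap - ln 2 / 5)) <= zeta (u (0 + 3)%N).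
  by apply: le_trans c1; rewrite ler_wpM2l ?exprn_ge0//; lra.
have [n5|n5] := eqVneq n 5%N.
  have N4 : n%:R - 1 = 4 :> R by rewrite n5; lra.
  apply: (large_pair5 n4 kE n5 a6 a8); rewrite N4 in c1' c2.
    by apply: le_trans c1'; rewrite !exprS expr0; lra.
  by apply: le_trans c2; rewrite !exprS expr0; lra.
apply: (large_pair6 n4 kE _ a6 a8 c1' c2).
by move: n4 n4' n5; clear; lia.
Qed.

End LargeCount.

(** * Telescoping of weights along a sorted list *)

Section Telescope.
Variables (R : realType) (T : eqType).

(** Sort the elements satisfying [C] by [ly]: each weight but the last is at most the increment to
    the next element, and the increments telescope. Weights outside [C] are not positive, so their
    positive parts add nothing. *)
Lemma chain_last (t : seq T) (C : pred T) (w ly : T -> R) : uniq t ->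
  {in t, forall p, ~~ C p -> w p <= 0} ->
  {in t, forall p, 0 <= ly p} ->
  {in t &, forall p p', p != p' -> C p -> C p' -> ly p <= ly p' -> w p <= ly p' - ly p} ->
  (exists q, [/\ q \in t, C q & \sum_(p <- t | p != q) Num.max 0 (w p) <= ly q]) \/
  {in t, forall p, w p <= 0}.
Proof.
move=> ut hN ly0 hC.
pose le p p' := ly p <= ly p'.
pose r := sort le [seq p <- t | C p].
have rt p : (p \in r) = C p && (p \in t) by rewrite mem_sort mem_filter.
have ur : uniq r by rewrite sort_uniq filter_uniq.
have sr : sorted le r by apply: sort_sorted => p p'; exact: le_total.
case E : r => [|x s].
  right=> p pt; apply: hN => //; apply/negP => Cp.
  by have := rt p; rewrite E in_nil Cp pt.
left; pose q := last x s; exists q.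
have qr : q \in r by rewrite E mem_last.
have /andP[Cq qt] : C q && (q \in t) by rewrite -rt.
split=> //.
have tel : \sum_(p <- belast x s) Num.max 0 (w p) <= ly q - ly x.
  rewrite /q; move: ur sr; rewrite E /= => /andP[].
  have sub : {subset x :: s <= r} by rewrite E.
  elim: (s) (x) sub => [|y s' IH] z sub /=; first by rewrite big_nil subrr.
  move=> zn /andP[yn us] /andP[zy ps]; rewrite big_cons.
  have IH' := IH y (fun v vs => sub v (mem_behead (s := z :: _) vs)) yn us ps.
  have zr : z \in r by apply: sub; rewrite mem_head.
  have yr : y \in r by apply: sub; rewrite in_cons mem_head orbT.
  have zny : z != y by apply: contraNneq zn => ->; rewrite mem_head.
  move: zr yr; rewrite !rt => /andP[Cz zt] /andP[Cy yt].
  have wz : Num.max 0 (w z) <= ly y - ly z.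
    by rewrite ge_max subr_ge0 (zy : ly z <= ly y) hC.
  apply: le_trans (lerD wz IH') _; lra.
have -> : \sum_(p <- t | p != q) Num.max 0 (w p) = \sum_(p <- r | p != q) Num.max 0 (w p).
  have pr : perm_eq r [seq p <- t | C p] by rewrite perm_sort.
  rewrite [RHS](perm_big _ pr)/=.
  rewrite big_filter_cond/= [LHS]big_seq_cond [LHS](bigID C)/=.
  rewrite [X in _ + X]big1 ?addr0 => [|p /andP[/andP[pt _] nC]]; last first.
    by apply: max_l; apply: hN.
  rewrite [RHS]big_seq_cond; apply: eq_bigl => p.
  by rewrite -andbA [C p && _]andbC.
rewrite E lastI big_rcons/= -/q eqxx/=.
rewrite addr0 big_mkcond/=; apply: (@le_trans _ _ (\sum_(p <- belast x s) Num.max 0 (w p))).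
  by apply: ler_sum => p _; case: ifP => // _; rewrite le_max lexx.
apply: le_trans tel _; have := ly0 x; rewrite lerBlDr => h.
rewrite lerDl; apply: h; have := rt x; rewrite E mem_head => /esym.
by move=> /andP[].
Qed.

End Telescope.

Lemma ln_prod (R : realType) (I : finType) (P : pred I) (F : I -> R) :
  (forall i, P i -> 0 < F i) -> ln (\prod_(i | P i) F i) = \sum_(i | P i) ln (F i).
Proof.
move=> F0; have [] : 0 < \prod_(i | P i) F i /\ ln (\prod_(i | P i) F i) = \sum_(i | P i) ln (F i).
  elim/big_rec2: _ => [|i s q Pi [q0 qs]]; first by rewrite ltr01 ln1.
  by rewrite mulr_gt0 ?F0// lnM ?posrE ?F0// qs.
by [].
Qed.

(** * Weights of small solutions at the roots *)

Section SmallSolutions.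
Variable R : realType.
Variables (n : nat) (f : {poly int}) (al : 'I_n -> R[i]).
Hypothesis fal : root_system f al.
Hypothesis n_gt1 : (1 < n)%N.
Local Notation a0 := `|(lead_coef f)%:~R : R|.

Definition linf (i : 'I_n) (p : int * int) : R := cm (p.1%:~R - al i * p.2%:~R).
Definition fval (p : int * int) : R := a0 * \prod_(i < n) linf i p.
(** The absolute value of the discriminant of [f]; ordered pairs replace the squares. *)
Definition disc : R := a0 ^+ (2 * n.-1) * \prod_(i < n) \prod_(j < n | j != i) cm (al i - al j).

Lemma linf_gt0 i p : p.2 != 0 -> 0 < linf i p.
Proof.
move=> p0; rewrite cm_gt0 subr_eq0; have := rs_irrational fal n_gt1 p.1 i p0.
apply: contra_neq => ->; rewrite mulfK// intr_eq0.
by [].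
Qed.

Variables (M0 mm : R).
Hypothesis M01 : 1 <= M0.
Hypothesis mm1 : 1 <= mm.
Hypothesis M0min : forall x y x' y' : int, x * y' - x' * y = 1 ->
  M0 <= a0 * \prod_(i < n) Num.max (linf i (x, y)) (linf i (x', y')).
Let Lam := ln M0 - n%:R * ln (7 / 2) - ln mm.

(** The term 1/2 stems from |y'| <= y / 2 in [half_bezout]. The factor 2/7 distributes the (7/2)^n
    of [Lam] over the roots and makes the weight at a distant root nonpositive. *)
Definition wgt (i : 'I_n) (p : int * int) : R :=
  ln (2 / 7 * Num.max 1 (1 / 2 + (p.2%:~R * linf i p)^-1)).

Lemma half_bezout (x y : int) : 0 < y -> gcdz x y = 1 ->
  exists x' y' : int, x * y' - x' * y = 1 /\ 2 * `|y'| <= y.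
Proof.
move=> y0 g1; have [u [v uv]] := Bezoutz x y; rewrite g1 in uv.
have yn0 : y != 0 by rewrite gt_eqF.
have E := divz_eq u y; have r0 := modz_ge0 u yn0; have ry := ltz_pmod u y0.
set r := (u %% y)%Z in E r0 ry; set k := (u %/ y)%Z in E.
have [h|h] := lerP (2 * r) y.
  exists (- v - k * x), r; split; last by rewrite ger0_norm.
  by rewrite -uv E; ring.
exists (- v - k * x - x), (r - y); split.
  by rewrite -uv E; ring.
rewrite ltr0_norm ?subr_lt0//; lra.
Qed.

(** The product in [M0min] is the Mahler measure of the form transformed by the completed basis. As
    y (x' - al y') = y' (x - al y) - 1 and |y'| <= y / 2, its factor at each root is at most |x - al
    y| times the maximum occurring in [wgt]. *)
Lemma sum_wgt (p : int * int) : 0 < p.2 -> gcdz p.1 p.2 = 1 -> fval p <= mm ->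
  Lam <= \sum_(i < n) wgt i p.
Proof.
case: p => x y /= y0 g1 Fm.
have [x' [y' [dt y'h]]] := half_bezout y0 g1.
have yn0 : y != 0 by rewrite gt_eqF.
have yR : 0 < y%:~R :> R by rewrite ltr0z.
pose u i := linf i (x, y); have u0 i : 0 < u i by apply: linf_gt0.
pose V i := Num.max 1 (1 / 2 + (y%:~R * u i)^-1).
have V0 i : 0 < V i by rewrite lt_max ltr01.
have mx i : Num.max (u i) (linf i (x', y')) <= u i * V i.
  rewrite ge_max; apply/andP; split.
    by rewrite -[X in X <= _]mulr1 ler_wpM2l ?(ltW (u0 i))// le_max lexx.
  apply: (@le_trans _ _ (u i * (1 / 2 + (y%:~R * u i)^-1))); last first.
    by rewrite ler_wpM2l ?(ltW (u0 i))// le_max lexx orbT.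
  rewrite -(ler_pM2l yR).
  have -> : y%:~R * (u i * (1 / 2 + (y%:~R * u i)^-1)) = y%:~R / 2 * u i + 1.
    have u0' := gt_eqF (u0 i); have yR' := gt_eqF yR.
    rewrite !mulrDr [X in _ + X]mulrA divff; last by rewrite mulf_neq0 ?u0' ?yR'.
    by ring.
  have -> : y%:~R * linf i (x', y') = cm (y'%:~R * (x%:~R - al i * y%:~R) - 1).
    rewrite -[X in X * _](ger0_norm (ltW yR)) -cm_int -cmM /=; congr cm.
    have := congr1 (fun z : int => z%:~R : R[i]) dt; rewrite rmorphB !rmorphM/= => dt'.
    by rewrite -[X in _ = _ - X]dt'; ring.
  apply: le_trans (cmD _ _) _; rewrite cmN cm1 lerD2r cmM cm_int ler_wpM2r ?(ltW (u0 i))//.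
  rewrite ler_pdivlMr// -intr_norm mulrC -[2]/(2%:~R) -intrM ler_int.
  by [].
have h : M0 <= mm * \prod_(i < n) V i.
  apply: le_trans (M0min dt) _.
  apply: (@le_trans _ _ (a0 * \prod_(i < n) (u i * V i))).
    rewrite ler_wpM2l//; apply: ler_prod => i _; rewrite mx andbT le_max.
    by rewrite (ltW (u0 i)).
  rewrite big_split/= mulrA ler_wpM2r// prodr_ge0// => i _; exact: ltW.
have pV : 0 < \prod_(i < n) V i by apply: prodr_gt0.
have lV := ln_prod (P := predT) (fun i _ => V0 i).
have hl : ln M0 <= ln mm + \sum_(i < n) ln (V i).
  rewrite -lV -lnM ?posrE ?(lt_le_trans _ mm1)// ler_ln ?posrE ?mulr_gt0//.
  - exact: lt_le_trans M01.
  - exact: lt_le_trans mm1.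
have -> : \sum_(i < n) wgt i (x, y) = \sum_(i < n) ln (V i) - n%:R * ln (7 / 2).
  have -> : n%:R * ln (7 / 2 : R) = \sum_(i < n) ln (7 / 2 : R).
    by rewrite sumr_const card_ord mulr_natl.
  rewrite -sumrB.
  have p27 : 0 < 2 / 7 :> R by lra.
  have p72 : 0 < 7 / 2 :> R by lra.
  apply: eq_bigr => i _; rewrite /wgt -/(u i) -/(V i) lnM ?posrE ?p27 ?V0// addrC; congr (_ + _).
  by rewrite -lnV ?posrE ?p72// invf_div.
by rewrite /Lam; lra.
Qed.

Lemma wgt_le0 i (p : int * int) : 0 < p.2 -> 1 / 2 < p.2%:~R * linf i p -> wgt i p <= 0.
Proof.
move=> y0 h; rewrite /wgt -[X in _ <= X]ln1.
have v2 : (p.2%:~R * linf i p)^-1 <= 2.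
  by rewrite -[X in _ <= X]invrK lef_pV2 ?posrE//; lra.
have : Num.max 1 (1 / 2 + (p.2%:~R * linf i p)^-1) <= 7 / 2.
  by rewrite ge_max; apply/andP; split; lra.
have : 1 <= Num.max 1 (1 / 2 + (p.2%:~R * linf i p)^-1) by rewrite le_max lexx.
set V := Num.max _ _ => V1 V7; rewrite ler_ln ?posrE//; lra.
Qed.

(** With u, u' the values of [linf], non-proportionality gives 1 <= y u' + y' u. As y u' <= 1/2, v =
    1 / (y u) is at most 2 y' / y, and 2/7 (1/2 + v) <= v / 2 because v >= 2. *)
Lemma wgt_gap i (p p' : int * int) : 0 < p.2 -> p.2 <= p'.2 -> p.1 * p'.2 != p'.1 * p.2 ->
  p.2%:~R * linf i p <= 1 / 2 -> p'.2%:~R * linf i p' <= 1 / 2 ->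
  wgt i p <= ln p'.2%:~R - ln p.2%:~R.
Proof.
move=> y0 yy cr h h'.
have y0' : 0 < p'.2 by apply: lt_le_trans yy.
have Y0 : 0 < p.2%:~R :> R by rewrite ltr0z.
have Y0' : 0 < p'.2%:~R :> R by rewrite ltr0z.
have YY : p.2%:~R <= p'.2%:~R :> R by rewrite ler_int.
have u0 : 0 < linf i p by apply: linf_gt0; rewrite gt_eqF.
have u0' : 0 < linf i p' by apply: linf_gt0; rewrite gt_eqF.
have c1 : 1 <= p.2%:~R * linf i p' + p'.2%:~R * linf i p.
  have : 1 <= cm (p.2%:~R * (p'.1%:~R - al i * p'.2%:~R) - p'.2%:~R * (p.1%:~R - al i * p.2%:~R)).
    have -> : p.2%:~R * (p'.1%:~R - al i * p'.2%:~R) - p'.2%:~R * (p.1%:~R - al i * p.2%:~R)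
      = (p'.1 * p.2 - p.1 * p'.2)%:~R :> R[i].
      by rewrite rmorphB !rmorphM/=; ring.
    have nz : p'.1 * p.2 - p.1 * p'.2 != 0 by rewrite subr_eq0 eq_sym.
    by rewrite cm_int -intr_norm (ler_int _ 1) -gtz0_ge1 normr_gt0.
  move=> /le_trans; apply; apply: le_trans (cmD _ _) _.
  by rewrite cmN !cmM !cm_int !ger0_norm ?(ltW Y0) ?(ltW Y0').
have c2 : 1 / 2 <= p'.2%:~R * linf i p.
  have : p.2%:~R * linf i p' <= p'.2%:~R * linf i p' by rewrite ler_wpM2r// ltW.
  by lra.
set v := (p.2%:~R * linf i p)^-1.
have yu : 0 < p.2%:~R * linf i p by rewrite mulr_gt0.
have v2 : 2 <= v by rewrite -[X in X <= _]invrK lef_pV2 ?posrE//; lra.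
have key : v / 2 <= p'.2%:~R / p.2%:~R.
  have vy : v * p.2%:~R = (linf i p)^-1.
    by rewrite /v invfM mulrAC mulVf ?mul1r// gt_eqF.
  rewrite ler_pdivlMr//.
  have -> : v / 2 * p.2%:~R = (v * p.2%:~R) / 2 by ring.
  rewrite vy -(ler_pM2l u0) mulrA divff ?gt_eqF// mul1r; lra.
rewrite /wgt -/v -ln_div ?posrE// ler_ln ?posrE ?divr_gt0//; last first.
  by rewrite mulr_gt0 ?lt_max ?ltr01//; lra.
apply: le_trans key; rewrite max_r; lra.
Qed.

Variable cj : 'I_n -> 'I_n.
Hypothesis cjE : forall i, al (cj i) = (al i)^*.
Hypothesis cjK : involutive cj.
Let Ip : {set 'I_n} := [set i | 0 <= cIm (al i)].
Hypothesis Lam0 : 0 <= Lam.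

Lemma linf_cj i p : linf (cj i) p = linf i p.
Proof.
rewrite /linf cjE -[RHS]cm_conj rmorphB rmorphM/= !rmorph_int.
by [].
Qed.

(** Solutions that are last near some root are set aside. Conjugate roots have the same [linf], so
    one root of each pair is chosen to define the last solution, and at most #|Ip| are lost. Over
    the others [sum_wgt] is summed, and the weights at root i telescope to [B i]. *)
Lemma small_sum (t : seq (int * int)) : uniq t ->
  {in t, forall p, [/\ 0 < p.2, gcdz p.1 p.2 = 1 & fval p <= mm]} ->
  {in t &, forall p p', p != p' -> p.1 * p'.2 != p'.1 * p.2} ->
  exists B : 'I_n -> R,
    [/\ forall i, B (cj i) = B i,
        forall i, B i = 0 \/ exists q,
          [/\ q \in t, q.2%:~R * linf i q <= 1 / 2 & B i = ln q.2%:~R] &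
        (size t)%:R * Lam <= #|Ip|%:R * Lam + \sum_(i < n) B i].
Proof.
move=> ut ht ct.
have hl i : exists o : option (int * int),
    match o with
    | Some q => [/\ q \in t, q.2%:~R * linf i q <= 1 / 2 &
        \sum_(p <- t | p != q) Num.max 0 (wgt i p) <= ln q.2%:~R]
    | None => {in t, forall p, wgt i p <= 0} end.
  have [|||[q [qt Cq sq]]|hn] := @chain_last R _ t (fun p => p.2%:~R * linf i p <= 1 / 2)
     (wgt i) (fun p => ln p.2%:~R) ut.
  - by move=> p pt; rewrite -ltNge => h; apply: wgt_le0 => //; have [] := ht _ pt.
  - by move=> p pt; apply: ln_ge0; apply: intr_ge1; have [] := ht _ pt.
  - move=> p p' pt pt' pp' Cp Cp'; have [y0 _ _] := ht _ pt; have [y0' _ _] := ht _ pt'.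
    rewrite ler_ln ?posrE ?ltr0z// ler_int => yy.
    by apply: wgt_gap => //; apply: ct.
  - by exists (Some q).
  - by exists None.
pose lst i := projT1 (cid (hl i)).
have lstP i := projT2 (cid (hl i)).
pose rep i := if i \in Ip then i else cj i.
have ImJ i : cIm (al (cj i)) = - cIm (al i) by rewrite cjE; case: (al i).
have repI i : rep i \in Ip.
  rewrite /rep; case: ifP => //; rewrite !inE ImJ => /negbT; rewrite -ltNge => h.
  by rewrite oppr_ge0 ltW.
have lrep i p : linf (rep i) p = linf i p by rewrite /rep; case: ifP => // _; rewrite linf_cj.
have wrep i p : wgt (rep i) p = wgt i p by rewrite /wgt lrep.
have repcj i : rep (cj i) = rep i \/ al i = al (cj i).
  rewrite /rep cjK !inE ImJ oppr_ge0.
  have [h|h|h] := ltgtP 0 (cIm (al i)).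
  - by left.
  - by left.
  - right; rewrite cjE; move: h; case: (al i) => x y /= <-; by rewrite oppr0.
pose B i : R := if lst (rep i) is Some q then ln q.2%:~R else 0.
exists B; split.
- move=> i; have [E|E] := repcj i; first by rewrite /B E.
  by rewrite /B -(rs_inj fal E).
- move=> i; rewrite /B; have := lstP (rep i); rewrite -/(lst (rep i)).
  case: (lst (rep i)) => [q|_]; last by left.
  by move=> [qt Cq _]; right; exists q; rewrite -(lrep i).
pose bad p := [exists i in Ip, lst i == Some p].
have cbad : (size [seq p <- t | bad p] <= #|Ip|)%N.
  pose G := pmap lst (enum Ip).
  have sub : {subset [seq p <- t | bad p] <= G}.
    move=> p; rewrite mem_filter => /andP[/exists_inP[i iI /eqP E] _].
    by rewrite mem_pmap; apply/mapP; exists i; rewrite ?mem_enum.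
  apply: leq_trans (uniq_leq_size (filter_uniq _ ut) sub) _.
  by rewrite size_pmap cardE; apply: count_size.
have szE : (size t = size [seq p <- t | bad p] + size [seq p <- t | ~~ bad p])%N.
  by rewrite !size_filter count_predC.
have up : (size [seq p <- t | ~~ bad p])%:R * Lam <= \sum_(i < n) B i.
  apply: (@le_trans _ _ (\sum_(p <- t | ~~ bad p) \sum_(i < n) wgt i p)).
    rewrite -big_filter; set tb := [seq p <- t | ~~ bad p].
    have -> : (size tb)%:R * Lam = \sum_(p <- tb) Lam.
      elim: tb => [|p tb IH]; first by rewrite big_nil mul0r.
      by rewrite big_cons -IH /= -natr1 mulrDl mul1r addrC.
    rewrite big_seq [X in _ <= X]big_seq.
    apply: ler_sum => p; rewrite mem_filter => /andP[_ pt].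
    by have [? ? ?] := ht _ pt; apply: sum_wgt.
  rewrite exchange_big/=; apply: ler_sum => i _; rewrite /B.
  have := lstP (rep i); rewrite -/(lst (rep i)); case E : (lst (rep i)) => [q|].
    move=> [_ _]; apply: le_trans.
    rewrite [X in _ <= X](bigID (fun p => ~~ bad p))/=.
    apply: (@le_trans _ _ (\sum_(p <- t | (p != q) && ~~ bad p) Num.max 0 (wgt (rep i) p))).
      rewrite [X in X <= _](eq_bigl (fun p => (p != q) && ~~ bad p)).
        by apply: ler_sum => p _; rewrite wrep le_max lexx orbT.
      move=> p; case: eqP => //= ->; apply/negbTE; rewrite negbK.
      by apply/exists_inP; exists (rep i); rewrite ?repI ?E.
    rewrite lerDl; apply: sumr_ge0 => p _; by rewrite le_max lexx.
  move=> h; rewrite big_seq_cond; apply: sumr_le0 => p /andP[pt _].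
  by rewrite -wrep h.
rewrite szE natrD mulrDl lerD// ler_wpM2r// ler_nat.
by [].
Qed.

End SmallSolutions.

(** * Products of root differences, and non-proportional solutions *)

Lemma vandermonde_plain (R : realType) (n : nat) (b : 'I_n -> R[i]) :
  \prod_(i < n) \prod_(j < n | j != i) cm (b i - b j) <=
  n%:R ^+ n * (\prod_(i < n) Num.max 1 (cm (b i))) ^+ (2 * n.-1).
Proof.
(* No conjugation on the points is involved, so the bound survives the removal of a single root. *)
rewrite -vandermonde_sqr -det_tr; apply: le_trans (hadamard_cm _) _.
have -> : n%:R ^+ n * (\prod_(i < n) Num.max 1 (cm (b i))) ^+ (2 * n.-1) =
  \prod_(i < n) (n%:R * Num.max 1 (cm (b i)) ^+ (2 * n.-1)).
  by rewrite big_split/= prodr_const card_ord prodrXl.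
apply: ler_prod => i _; apply/andP; split.
  by apply: sumr_ge0 => k _; rewrite exprn_ge0 ?cm_ge0.
have -> : n%:R * Num.max 1 (cm (b i)) ^+ (2 * n.-1) =
    \sum_(k < n) Num.max 1 (cm (b i)) ^+ (2 * n.-1).
  by rewrite sumr_const card_ord mulr_natl.
apply: ler_sum => k _; rewrite !mxE cmX -exprM [(k * 2)%N]mulnC.
have A1 : 1 <= Num.max 1 (cm (b i)) by rewrite le_max lexx.
apply: (@le_trans _ _ (Num.max 1 (cm (b i)) ^+ (2 * k))).
  by rewrite lerXn2r ?nnegrE ?cm_ge0 ?(le_trans ler01 A1)// le_max lexx orbT.
by rewrite ler_weXn2l// leq_mul2l/=; have := ltn_ord k; clear; lia.
Qed.

Lemma vandermonde_split (R : realType) (n : nat) (b : 'I_n -> R[i]) (l : 'I_n) :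
  \prod_(i < n) \prod_(j < n | j != i) cm (b i - b j) =
  (\prod_(j < n | j != l) cm (b l - b j)) ^+ 2 *
  \prod_(i < n.-1) \prod_(j < n.-1 | j != i) cm (b (lift l i) - b (lift l j)).
Proof.
have dl (F : 'I_n -> R) : \prod_(j < n | j != l) F j = \prod_(j < n.-1) F (lift l j).
  rewrite big_mkcond/= (bigD1_ord l)//= eqxx mul1r.
  by apply: eq_bigr => j _; rewrite eq_sym neq_lift.
rewrite (bigD1_ord l)//= dl.
rewrite [X in _ * X = _](eq_bigr (fun i => cm (b l - b (lift l i)) *
    \prod_(j < n.-1 | j != i) cm (b (lift l i) - b (lift l j)))); last first.
  move=> i _; rewrite (bigD1_ord l) ?neq_lift//= -opprB cmN; congr (_ * _).
  by apply: eq_bigl => j; rewrite (inj_eq (@lift_inj _ l)).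
by rewrite big_split/= mulrA -expr2.
Qed.

Lemma coprime_nonprop (p p' : int * int) : 0 < p.2 -> 0 < p'.2 ->
  gcdz p.1 p.2 = 1 -> gcdz p'.1 p'.2 = 1 -> p != p' -> p.1 * p'.2 != p'.1 * p.2.
Proof.
move: p p' => [x y] [x' y'] /= y0 y0' g g'; apply: contra_neq => E.
have d1 : (y %| y')%Z.
  have : (y %| x * y')%Z by rewrite E dvdz_mull.
  by rewrite Gauss_dvdzr// /coprimez gcdzC g.
have d2 : (y' %| y)%Z.
  have : (y' %| x' * y)%Z by rewrite -E dvdz_mull.
  by rewrite Gauss_dvdzr// /coprimez gcdzC g'.
have yy : y = y'.
  move: d1 d2 y0 y0'; case: y {E g} => // y; case: y' {g'} => // y'; rewrite !dvdzE/=.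
  by move=> d1 d2 _ _; congr Posz; apply/eqP; rewrite eqn_dvd d1.
move: E; rewrite yy => /mulIf; rewrite gt_eqF// => ->//.
Qed.

(** * Linear arithmetic behind the estimates *)

Section CountArith.
Variable R : realFieldType.

(** Logarithms are abstracted to variables: u, y, g, b stand for those of |x - al y|, y, |f'(al)|,
    |Im al|; m, d, n, n1, M, A for those of the bound on the form, |D|, N, N - 1, the Mahler
    measure, max(1, |al|); t and K for ln 2 and ln (7/2). *)
Lemma nonreal_root_far (N u y t g m b d n n1 M A K : R) :
  3 <= N -> 0 < t -> 9 / 5 * t <= K -> 0 <= m -> n <= N * t -> n1 <= n -> A <= M -> 0 <= M ->
  u + (N - 1) * (y - t) + g <= m -> b + y <= u ->
  d <= 2 * g + (N - 1) * n1 + 2 * (N - 2) * (M - A) ->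
  d <= N * n + 2 * (N - 1) * M + 2 * (t + b + n) ->
  2 * M - t / 5 <= y + A ->
  2 * (N - 1) * (2 * m + N * K) + N * n <= d -> False.
Proof.
move=> N3 t0 Kt m0 nt n1n AM M0 h1 hb gap hd h2 dg.
have c1 : N * (2 * M - t / 5) <= N * (y + A) by rewrite ler_wpM2l//; lra.
have c2 : (N - 1) * n1 <= (N - 1) * n by rewrite ler_wpM2l//; lra.
have c0 : 9 / 5 * (N * t) <= N * K by rewrite mulrCA ler_wpM2l//; lra.
have c00 : 0 < N * t by rewrite mulr_gt0//; lra.
have c3 : 4 * (N * K) <= 2 * (N - 1) * (N * K) by rewrite ler_wpM2r; lra.
have c4 : 4 * (2 * m) <= 2 * (N - 1) * (2 * m) by rewrite ler_wpM2r; lra.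
lra.
Qed.

Lemma kap_bound (N t m d n n1 K : R) :
  3 <= N -> 0 < t -> 9 / 5 * t <= K -> 0 <= m -> 0 <= n -> n1 <= n ->
  2 * (N - 1) * (2 * m + N * K) + N * n <= d ->
  (N - 2) * (N * K - t) <= d / 2 - m - N * t - (N - 1) / 2 * n1.
Proof.
move=> N3 t0 Kt m0 n0 n1n dg.
have c2 : (N - 1) * n1 <= (N - 1) * n by rewrite ler_wpM2l//; lra.
have c3 : 0 <= N * (K - t) by rewrite mulr_ge0; lra.
have c4 : 4 * (2 * m) <= 2 * (N - 1) * (2 * m) by rewrite ler_wpM2r; lra.
have c5 : 0 <= (N - 2) * t by rewrite mulr_ge0; lra.
lra.
Qed.

Lemma kap_bound3 (M M0 t m K n c d : R) : 0 < t -> 9 / 5 * t <= K -> 0 <= m -> 3 / 2 * t <= n ->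
  M0 <= d / 2 + 7 / 2 * t -> M <= M0 + c -> c <= t / 10 ->
  2 * (3 - 1) * (2 * m + 3 * K) + 3 * n <= d ->
  (3 - 2) * (M / 9 + 7 * t) <= d / 2 - m - 3 * t - (3 - 1) / 2 * t.
Proof. move=> *; lra. Qed.

Lemma approx_arith (N u y t g m n1 M A d k : R) :
  d <= 2 * g + (N - 1) * n1 + 2 * (N - 2) * (M - A) ->
  (N - 2) * k <= d / 2 - m - N * t - (N - 1) / 2 * n1 ->
  u + (N - 1) * (y - t) + g <= m ->
  u - y <= (N - 2) * (M - A - k) - (t + N * y).
Proof. move=> *; lra. Qed.

Lemma real_count_arith (s s1 sb N L X Lam lM0 : R) : 0 < Lam ->
  2 * lM0 <= X * Lam -> 0 <= N ->
  s * Lam + s1 * Lam <= N * Lam + N * (2 * lM0) -> sb <= N * L ->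
  s1 + s + sb <= N + N * L + N * X.
Proof.
move=> L0 hX N0 h hb.
have : N * (2 * lM0) <= N * (X * Lam) by rewrite ler_wpM2l.
move=> h'; have : (s + s1) * Lam <= (N + N * X) * Lam by lra.
by rewrite ler_pM2r//; lra.
Qed.

(** Let b = lM0 - a. The right-hand side of the bound on s Lam contains b with coefficient 2 r + (N
    - 1) = 3 r + 2 q - 1; the term in X pays for 2 (r + q) and the slack of W for r - 1, exactly
    enough. The surplus 2 q a covers the terms in t and lnN. *)
Lemma nonreal_count_arith (s s1 sb N r q L W X e Lam a lM0 lM lm lnN t K : R) :
  0 < Lam -> X * e = 2 -> 2 <= X -> 0 <= r -> 1 <= q -> N = r + 2 * q ->
  e * a + (lM0 - a) + lm <= Lam -> 0 <= lm -> a <= lM0 -> lM <= lM0 + t / 10 -> 0 < t ->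
  lnN <= N * t -> N * K <= a -> 9 / 5 * t <= K ->
  s * Lam <= (r + q) * Lam + r * (2 * lM0) + ((N - 1) * (lM - a) + q * lnN) ->
  s1 <= 1 -> sb <= r * L -> r - 1 <= W - (1 + r + q + r * L) ->
  0 <= W - (1 + r + q + r * L) ->
  s1 + s + sb <= W + (N - q) * X.
Proof.
move=> L0 Xe X2 r0 q1 NE hL lm0 aM0 hM t0 hN ha hK hs h1 hb hW hW0.
set sl := W - _ in hW hW0.
pose b := lM0 - a; have b0 : 0 <= b by rewrite subr_ge0.
have ea : e * a + b <= Lam by rewrite /b; lra.
have N1 : 1 <= N by lra.
have c1 : (N - 1) * (lM - a) <= (N - 1) * (b + t / 10).
  by rewrite ler_wpM2l /b; lra.
have c2 : q * lnN <= q * (N * t) by rewrite ler_wpM2l; lra.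
have Nt : 9 / 5 * (N * t) <= a.
  by apply: le_trans ha; rewrite mulrCA ler_wpM2l; lra.
have Nt0 : 0 <= N * t by rewrite mulr_ge0; lra.
have a0 : 0 <= a by lra.
have c3 : q * (9 / 5 * (N * t)) <= q * a by rewrite ler_wpM2l; lra.
have c4 : N * t <= q * (N * t) by rewrite -[X in X <= _]mul1r ler_wpM2r.
have ea0 : 0 <= e * a.
  rewrite mulr_ge0//; have : 0 < X * e by rewrite Xe.
  by rewrite pmulr_rgt0 => [/ltW//|]; lra.
have c5 : sl * b <= sl * Lam by rewrite ler_wpM2l; lra.
have c6 : (r - 1) * b <= sl * b by rewrite ler_wpM2r.
have c7 : (r + q) * (2 * a + X * b) <= (r + q) * (X * Lam).
  have XeA : X * (e * a) = 2 * a by rewrite mulrA Xe.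
  have : X * (e * a + b) <= X * Lam by rewrite ler_wpM2l; lra.
  by move=> h; rewrite ler_wpM2l; lra.
have c8 : (r + q) * (2 * b) <= (r + q) * (X * b).
  by rewrite ler_wpM2l ?ler_wpM2r//; lra.
have fin : s * Lam <= (r + q + sl + (r + q) * X) * Lam.
  apply: le_trans hs _; move: c1 c2; rewrite /b in c5 c6 c7 c8 *; rewrite NE in c3 c4 Nt0 *.
  lra.
rewrite ler_pM2r// in fin; move: fin; rewrite NE /sl; lra.
Qed.

End CountArith.

(** * Counting the solutions of a nearly minimal form *)

Section ReducedCount.
Variable R : realType.
Variables (n : nat) (f : {poly int}) (al : 'I_n -> R[i]).
Hypothesis fal : root_system f al.
Hypothesis n_ge3 : (3 <= n)%N.
Variables (M0 mm : R).
Hypothesis M01 : 1 <= M0.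
Hypothesis mm1 : 1 <= mm.
Hypothesis M0min : forall x y x' y' : int, x * y' - x' * y = 1 ->
  M0 <= `|(lead_coef f)%:~R : R| *
    \prod_(i < n) Num.max (linf al i (x, y)) (linf al i (x', y')).
Hypothesis MM0 : mahler f al <= 17 / 16 * M0.
Local Notation a0 := `|(lead_coef f)%:~R : R|.
Local Notation N := (n%:R : R).
Local Notation K := (ln (7 / 2) : R).
Local Notation l2 := (ln 2 : R).
Local Notation del := (ln (disc f al)).
Local Notation lM := (ln (mahler f al)).
Local Notation lM0 := (ln M0).
Local Notation lm := (ln mm).
Local Notation A i := (Num.max 1 (cm (al i))).
Variables (a e : R).
Hypothesis aE : 2 * (N - 1) * a = del - N * ln N.
Hypothesis aM0 : a <= lM0.
Hypothesis e01 : 0 < e < 1.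
Hypothesis hA : 2 * lm + N * K <= (1 - e) * a.
Hypothesis cubic : n = 3%N -> lM0 <= del / 2 + 7 / 2 * l2.

Lemma nR_ge3 : 3 <= N.
Proof. by rewrite (ler_nat _ 3). Qed.

Lemma n_gt1 : (1 < n)%N.
Proof. exact: ltnW. Qed.

Lemma natr_pred : (n.-1)%:R = N - 1.
Proof. by rewrite -[in RHS](prednK (ltnW n_gt1)) -natr1 addrK. Qed.

Lemma lead_ge1 : 1 <= a0.
Proof. exact: abs_lead_ge1 fal. Qed.

Lemma lead_gt0 : 0 < a0.
Proof. exact: lt_le_trans lead_ge1. Qed.

Lemma root_max_ge1 i : 1 <= A i.
Proof. by rewrite le_max lexx. Qed.

Lemma root_max_gt0 i : 0 < A i.
Proof. exact: lt_le_trans (root_max_ge1 i). Qed.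

Lemma mahler_gt0 : 0 < mahler f al.
Proof. exact: lt_le_trans (mahler_ge1 fal). Qed.

Lemma M0_gt0 : 0 < M0.
Proof. exact: lt_le_trans M01. Qed.

Lemma diff_gt0 i j : j != i -> 0 < cm (al i - al j).
Proof.
by move=> ji; rewrite cm_gt0 subr_eq0; apply: contra_neq ji => /(rs_inj fal).
Qed.

Lemma disc_gt0 : 0 < disc f al.
Proof.
rewrite mulr_gt0 ?exprn_gt0 ?lead_gt0//; apply: prodr_gt0 => i _.
by apply: prodr_gt0 => j; apply: diff_gt0.
Qed.

Lemma M0_le_mahler : M0 <= mahler f al.
Proof.
have := @M0min 1 0 0 1 erefl; rewrite /linf /= => h; apply: le_trans h _.
rewrite le_eqVlt; apply/orP; left; apply/eqP; congr (_ * _).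
by apply: eq_bigr => i _; rewrite mulr0 subr0 mulr1 sub0r cmN cm1.
Qed.

(** This fixes the tolerance 17/16: twice its logarithm and the loss 99/100 in [near_bounds] stay
    together below ln 2 / 5. *)
Lemma ln_num : 10 * ln (17 / 16) <= 5 * ln (99 / 100) + ln 2 :> R.
Proof.
have h : ln ((17 / 16) ^+ 10) <= ln ((99 / 100) ^+ 5 * 2) :> R.
  by rewrite ler_ln ?posrE ?mulr_gt0 ?exprn_gt0//; lra.
move: h; rewrite [ln (_ * 2)]lnM ?posrE; [|by apply: exprn_gt0; lra|lra].
rewrite !lnXn; [|lra|lra].
rewrite -[ln _ *+ 10]mulr_natl -[ln _ *+ 5]mulr_natl; lra.
Qed.

Lemma lM_lM0 : lM <= lM0 + ln (17 / 16).
Proof.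
have p : 0 < 17 / 16 :> R by lra.
by rewrite addrC -lnM ?posrE ?M0_gt0// ler_ln ?posrE ?mahler_gt0// mulr_gt0 ?M0_gt0.
Qed.

Lemma ln_1716 : ln (17 / 16) <= ln 2 / 10 :> R.
Proof.
have := ln_num; have : ln (99 / 100) <= 0 :> R by apply: ln_le0; lra.
lra.
Qed.

Lemma lM0_lM : lM0 <= lM.
Proof. by rewrite ler_ln ?posrE ?M0_gt0 ?mahler_gt0 ?M0_le_mahler. Qed.

Lemma lm_ge0 : 0 <= lm.
Proof. exact: ln_ge0. Qed.

Lemma K_facts : [/\ 0 < l2, 9 / 5 * l2 <= K & 0 < K].
Proof.
have h := ln_nat2_gt0 R; have h' := ln72_ge R; split=> //; lra.
Qed.

Lemma lnn_facts : 0 <= ln N /\ ln N <= N * l2.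
Proof.
have n3 := nR_ge3; split; first by apply: ln_ge0; lra.
rewrite mulr_natl -lnXn// ler_ln ?posrE ?exprn_gt0//; last by lra.
by rewrite -natrX ler_nat ltnW// ltn_expl.
Qed.

Lemma a_ge : 0 < a /\ 2 * lm + N * K <= a.
Proof.
have [l20 K2 K0] := K_facts; have lm0 := lm_ge0; have n3 := nR_ge3.
have /andP[e0 e1] := e01; have hA' := hA.
have NK : 0 < N * K by rewrite mulr_gt0//; lra.
have a0 : 0 < a.
  rewrite ltNge; apply/negP => an.
  have : (1 - e) * a <= 0 by rewrite mulr_ge0_le0//; lra.
  lra.
split=> //; have : 0 <= e * a by rewrite mulr_ge0// ltW.
lra.
Qed.

(** The cube of 7/2 exceeds 42. The bound makes [mm] negligible against M0^2. *)
Lemma M0_ge : 42 * mm <= M0.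
Proof.
have [l20 K2 K0] := K_facts; have lm0 := lm_ge0; have n3 := nR_ge3.
have [a0 ha] := a_ge; have aM0' := aM0.
have mm0 : 0 < mm by apply: lt_le_trans mm1.
have NK : 3 * K <= N * K by rewrite ler_wpM2r// ltW.
have : ln ((7 / 2) ^+ 3 * mm) <= lM0.
  have p72 : 0 < 7 / 2 :> R by lra.
  rewrite lnM ?posrE ?exprn_gt0// lnXn// -[ln _ *+ 3]mulr_natl; lra.
have p72 : 0 < 7 / 2 :> R by lra.
have q0 : 0 < (7 / 2) ^+ 3 * mm by apply: mulr_gt0 => //; exact: exprn_gt0.
rewrite ler_ln ?posrE ?M0_gt0// => h; apply: le_trans h.
by rewrite ler_wpM2r ?ltW// !exprS expr0; lra.
Qed.

(** The absolute value of the derivative of [f] at the root al l. *)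
Definition dprod (l : 'I_n) : R := a0 * \prod_(j < n | j != l) cm (al l - al j).

Lemma dprod_gt0 l : 0 < dprod l.
Proof. by rewrite mulr_gt0 ?lead_gt0//; apply: prodr_gt0 => j; apply: diff_gt0. Qed.

(** The discriminant is |f'(al_l)|^2 times the discriminant of the other n - 1 roots, which
    [vandermonde_plain] bounds by the Mahler measure without its factor at al_l. *)
Lemma root_gap l :
  del <= 2 * ln (dprod l) + (N - 1) * ln (N - 1) + 2 * (N - 2) * (lM - ln (A l)).
Proof.
have n3 := nR_ge3; have Al0 := root_max_gt0 l.
pose P := \prod_(i < n.-1) A (lift l i).
have P0 : 0 < P by apply: prodr_gt0 => i _; apply: root_max_gt0.
have ME : mahler f al = A l * (a0 * P).
  by rewrite /mahler (bigD1_ord l)//= mulrCA.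
have aP : 0 < a0 * P by rewrite mulr_gt0 ?lead_gt0.
have E : disc f al = dprod l ^+ 2 * (a0 ^+ (2 * n.-2) *
  \prod_(i < n.-1) \prod_(j < n.-1 | j != i) cm (al (lift l i) - al (lift l j))).
  rewrite /disc (vandermonde_split al l) /dprod exprMn.
  have -> : (2 * n.-1 = 2 + 2 * n.-2)%N by move: n_ge3; clear; lia.
  by rewrite exprD; ring.
have V := vandermonde_plain (fun i => al (lift l i)); rewrite -/P in V.
have h : disc f al <= dprod l ^+ 2 * ((N - 1) ^+ n.-1 * (a0 * P) ^+ (2 * n.-2)).
  rewrite E ler_wpM2l ?exprn_ge0 ?(ltW (dprod_gt0 l))// exprMn -natr_pred mulrCA.
  by rewrite ler_wpM2l ?exprn_ge0 ?(ltW lead_gt0).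
have n10 : 0 < N - 1 by lra.
have g0 := dprod_gt0 l.
have : del <= ln (dprod l ^+ 2 * ((N - 1) ^+ n.-1 * (a0 * P) ^+ (2 * n.-2))).
  rewrite ler_ln ?posrE ?disc_gt0//; apply: mulr_gt0; first exact: exprn_gt0.
  by apply: mulr_gt0; apply: exprn_gt0.
rewrite lnM ?posrE; [|exact: exprn_gt0|by apply: mulr_gt0; apply: exprn_gt0].
rewrite lnM ?posrE; [|exact: exprn_gt0|exact: exprn_gt0].
rewrite !lnXn//.
have -> : lM - ln (A l) = ln (a0 * P).
  by rewrite ME lnM ?posrE// addrC addKr.
rewrite -[ln (dprod l) *+ 2]mulr_natl -[_ *+ n.-1]mulr_natl -[_ *+ (2 * n.-2)]mulr_natl natr_pred natrM.
have -> : (n.-2)%:R = N - 2 by rewrite -subn2 natrB// ltnW.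
lra.
Qed.

(** When al_l is nearest, each other factor |x - al_j y| is at least y |al_l - al_j| / 2, so the
    value is at least |x - al_l y| (y / 2)^(n-1) |f'(al_l)|. Moreover |x - al_l y| <= mm, so a
    solution beyond M0^2 has y max(1, |al_l|) >= 99/100 M0^2. *)
Lemma near_bounds p l : 0 < p.2 -> fval f al p <= mm ->
  (forall j, linf al l p <= linf al j p) ->
  M0 ^+ 2 < Num.max `|p.1%:~R| p.2%:~R ->
  ln (linf al l p) + (N - 1) * (ln p.2%:~R - l2) + ln (dprod l) <= lm /\
  2 * lM - l2 / 5 <= ln p.2%:~R + ln (A l).
Proof.
move=> p0 pm near big; have n3 := nR_ge3.
have y0 : 0 < p.2%:~R :> R by rewrite ltr0z.
have pn0 : p.2 != 0 by rewrite gt_eqF.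
have u0 j : 0 < linf al j p by apply: (linf_gt0 fal n_gt1).
have g0 := dprod_gt0 l; have m0 : 0 < mm by apply: lt_le_trans mm1.
have Al0 := root_max_gt0 l; have Al1 := root_max_ge1 l.
have h2 : 0 < p.2%:~R / 2 :> R by lra.
split.
  have h : linf al l p * ((p.2%:~R / 2) ^+ n.-1 * dprod l) <= mm.
    apply: le_trans pm; rewrite /fval (bigD1 l)//= /dprod.
    rewrite [X in _ <= X]mulrCA ler_wpM2l ?(ltW (u0 l))// mulrCA ler_wpM2l ?(ltW lead_gt0)//.
    have -> : (p.2%:~R / 2) ^+ n.-1 = \prod_(j < n | j != l) (p.2%:~R / 2 : R).
      by rewrite prodr_const cardC1 card_ord.
    rewrite -big_split/=; apply: ler_prod => j jl; apply/andP; split.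
      by rewrite mulr_ge0 ?cm_ge0// ltW.
    have : p.2%:~R * cm (al l - al j) <= linf al j p + linf al l p.
      have -> : p.2%:~R * cm (al l - al j) =
          cm ((p.1%:~R - al j * p.2%:~R) - (p.1%:~R - al l * p.2%:~R)).
        rewrite -[X in X * _](ger0_norm (ltW y0)) -cm_int -cmM; congr cm; ring.
      by apply: le_trans (cmD _ _) _; rewrite cmN.
    by have := near j; lra.
  have : ln (linf al l p * ((p.2%:~R / 2) ^+ n.-1 * dprod l)) <= lm.
    rewrite ler_ln ?posrE//; apply: mulr_gt0 => //.
    by apply: mulr_gt0 => //; apply: exprn_gt0.
  rewrite lnM ?posrE//; last by apply: mulr_gt0 => //; apply: exprn_gt0.
  rewrite lnM ?posrE//; last exact: exprn_gt0.
  rewrite lnXn// -[_ *+ n.-1]mulr_natl natr_pred.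
  rewrite [ln (p.2%:~R / 2)]ln_div ?posrE//; lra.
have um : linf al l p <= mm.
  have [|h] := leP (linf al l p) 1; first by move=> /le_trans; apply.
  apply: le_trans pm; apply: le_trans (ler_eXnr (ltnW n_gt1) (ltW h)) _.
  have -> : linf al l p ^+ n = \prod_(j < n) linf al l p by rewrite prodr_const card_ord.
  apply: (@le_trans _ _ (1 * \prod_(j < n) linf al j p)).
    by rewrite mul1r; apply: ler_prod => j _; rewrite near ltW.
  by rewrite ler_wpM2r ?lead_ge1// prodr_ge0// => j _; rewrite ltW.
have yA : M0 ^+ 2 <= p.2%:~R * A l + mm.
  apply: le_trans (ltW big) _; rewrite ge_max; apply/andP; split; last first.
    have : p.2%:~R * 1 <= p.2%:~R * A l by rewrite ler_wpM2l// ltW.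
    lra.
  have -> : `|p.1%:~R : R| = cm ((p.1%:~R - al l * p.2%:~R) + al l * p.2%:~R).
    by rewrite subrK cm_int.
  apply: le_trans (cmD _ _) _; rewrite addrC lerD// cmM mulrC cm_int (ger0_norm (ltW y0)).
  by rewrite ler_wpM2l ?(ltW y0)// le_max lexx orbT.
have m42 := M0_ge; have M00 := M0_gt0; have M01' := M01; have mm1' := mm1.
have MM : 42 * M0 <= M0 ^+ 2 by rewrite expr2 ler_wpM2r//; lra.
have low : 99 / 100 * M0 ^+ 2 <= p.2%:~R * A l by lra.
have p99 : 0 < 99 / 100 :> R by lra.
have M2 : 0 < M0 ^+ 2 by apply: exprn_gt0.
have : ln (99 / 100 * M0 ^+ 2) <= ln (p.2%:~R * A l).
  by rewrite ler_ln ?posrE//; apply: mulr_gt0.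
rewrite [ln (p.2%:~R * _)]lnM ?posrE// [ln (99 / 100 * _)]lnM ?posrE// lnXn// -[_ *+ 2]mulr_natl.
have := lM_lM0; have := ln_num; lra.
Qed.

Lemma del_ge : 2 * (N - 1) * (2 * lm + N * K) + N * ln N <= del.
Proof.
have [a0 ha] := a_ge; have aE' := aE; have n3 := nR_ge3.
have : 2 * (N - 1) * (2 * lm + N * K) <= 2 * (N - 1) * a by rewrite ler_wpM2l//; lra.
lra.
Qed.

Lemma ln_pred : ln (N - 1) <= ln N.
Proof. by have n3 := nR_ge3; rewrite ler_ln ?posrE; lra. Qed.

Lemma lA_lM l : 0 <= ln (A l) /\ ln (A l) <= lM.
Proof.
split; first exact: ln_ge0 (root_max_ge1 l).
by rewrite ler_ln ?posrE ?root_max_gt0 ?mahler_gt0// (max_le_mahler fal).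
Qed.

Variable cj : 'I_n -> 'I_n.
Hypothesis cjE : forall i, al (cj i) = (al i)^*.
Hypothesis cjK : involutive cj.

Lemma Im_cj i : cIm (al (cj i)) = - cIm (al i).
Proof. by rewrite cjE; case: (al i). Qed.

Lemma disc_bound (S : {set 'I_n}) : (forall i, i \in S -> 0 < cIm (al i)) ->
  del <= N * ln N + 2 * (N - 1) * lM + \sum_(i in S) 2 * (ln (2 * cIm (al i)) + ln N).
Proof.
move=> S0; have n3 := nR_ge3; have N0 : 0 < N by lra.
have Scj i : i \in S -> cj i \notin S.
  move=> iS; apply/negP => /S0; rewrite Im_cj oppr_gt0 => h.
  by have := lt_trans h (S0 _ iS); rewrite ltxx.
have V := vandermonde_bound cjK cjE Scj.
have T0 i : i \in S -> 0 < (2 * `|cIm (al i)| * N) ^+ 2.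
  by move=> /S0 h; rewrite exprn_gt0// !mulr_gt0// normr_gt0 gt_eqF.
have T1 : 0 < \prod_(i in S) (2 * `|cIm (al i)| * N) ^+ 2 by apply: prodr_gt0.
have h : disc f al <= N ^+ n * mahler f al ^+ (2 * n.-1) *
    \prod_(i in S) (2 * `|cIm (al i)| * N) ^+ 2.
  rewrite /disc /mahler exprMn.
  rewrite [X in _ <= X * _]mulrCA -[X in _ <= X]mulrA; apply: ler_wpM2l; last exact: V.
  exact/exprn_ge0/normr_ge0.
have M0' := mahler_gt0.
have : del <= ln (N ^+ n * mahler f al ^+ (2 * n.-1) *
    \prod_(i in S) (2 * `|cIm (al i)| * N) ^+ 2).
  rewrite ler_ln ?posrE ?disc_gt0//; apply: mulr_gt0 => //.
  by apply: mulr_gt0; apply: exprn_gt0.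
rewrite lnM ?posrE//; last by apply: mulr_gt0; apply: exprn_gt0.
rewrite lnM ?posrE; [|exact: exprn_gt0|exact: exprn_gt0].
rewrite !lnXn//.
rewrite (ln_prod T0) -[_ *+ n]mulr_natl -[_ *+ (2 * n.-1)]mulr_natl natrM natr_pred.
rewrite [X in _ <= _ + X -> _](eq_bigr (fun i => 2 * (ln (2 * cIm (al i)) + ln N)))//.
move=> i /S0 ci0; rewrite gtr0_norm// lnXn ?mulr_gt0// [ln (2 * _ * _)]lnM ?posrE ?mulr_gt0//.
by rewrite [RHS]mulr_natl.
Qed.

Lemma Im_linf p l : 0 < p.2 -> `|cIm (al l)| * p.2%:~R <= linf al l p.
Proof.
move=> p0; have y0 : 0 < p.2%:~R :> R by rewrite ltr0z.
have -> : `|cIm (al l)| * p.2%:~R = `|cIm (p.1%:~R - al l * p.2%:~R)|.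
  have -> : p.1%:~R - al l * p.2%:~R = p.1%:~R%:C - al l * p.2%:~R%:C :> R[i].
    by rewrite !rmorph_int.
  rewrite -[X in _ * X](ger0_norm (ltW y0)) -normrM.
  by case: (al l) => u v /=; rewrite mulr0 !add0r normrN.
exact: cm_geIm.
Qed.

(** At a non-real root [linf] is at least |Im al| y, and [disc_bound] for that root alone keeps |Im
    al| away from 0, which is incompatible with [near_bounds]. *)
Lemma big_real p l : 0 < p.2 -> fval f al p <= mm ->
  (forall j, linf al l p <= linf al j p) ->
  M0 ^+ 2 < Num.max `|p.1%:~R| p.2%:~R -> cIm (al l) = 0.
Proof.
move=> p0 pm near big; apply/eqP; apply/negPn/negP => im0.
have [h1 h2] := near_bounds p0 pm near big.
have gap := root_gap l; have n3 := nR_ge3; have dg := del_ge; have lp := ln_pred.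
have [l20 K2 K0] := K_facts; have lm0 := lm_ge0; have [ln0 ln2] := lnn_facts.
have [A0 AM] := lA_lM l.
have y0 : 0 < p.2%:~R :> R by rewrite ltr0z.
pose b := `|cIm (al l)|; have b0 : 0 < b by rewrite normr_gt0.
have hb : ln b + ln p.2%:~R <= ln (linf al l p).
  rewrite -lnM ?posrE// ler_ln ?posrE ?mulr_gt0//; last first.
    by apply: (linf_gt0 fal n_gt1); rewrite gt_eqF.
  exact: Im_linf.
have hd : del <= N * ln N + 2 * (N - 1) * lM + 2 * (ln 2 + ln b + ln N).
  have [ip|ip] : 0 < cIm (al l) \/ 0 < cIm (al (cj l)).
  - by rewrite Im_cj oppr_gt0; case: (ltgtP (cIm (al l)) 0) im0 => // h _; [right|left].
  - have := @disc_bound [set l]; rewrite big_set1 -(gtr0_norm ip) lnM ?posrE ?normr_gt0//.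
    by apply => i; rewrite inE => /eqP ->.
  - have := @disc_bound [set cj l]; rewrite big_set1 -(gtr0_norm ip) Im_cj normrN.
    rewrite lnM ?posrE ?normr_gt0//.
    by apply => i; rewrite inE => /eqP ->.
have M1 : 0 <= lM by apply: ln_ge0; apply: (mahler_ge1 fal).
exact: (nonreal_root_far n3 l20 K2 lm0 ln2 lp AM M1 h1 hb gap hd h2 dg).
Qed.

(** In degree 3 the margin has to grow with lM in order to give the factor 10/9 in [lzmin]; the
    hypothesis [cubic] makes room for the term lM / 9. *)
Definition lkap : R := if (n == 3)%N then lM / 9 + 7 * l2 else N * K - l2.
Definition lzmin : R :=
  if (n == 3)%N then 10 / 9 * (lM + 6 * l2) else lM + lkap - l2 / 5.

Lemma big_approx p l : 0 < p.2 -> fval f al p <= mm ->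
  (forall j, linf al l p <= linf al j p) ->
  M0 ^+ 2 < Num.max `|p.1%:~R| p.2%:~R ->
  approx f al (cRe (al l)) lkap p /\ lzmin <= zeta f al (cRe (al l)) lkap p.
Proof.
move=> p0 pm near big; have im0 := big_real p0 pm near big.
have [h1 h2] := near_bounds p0 pm near big.
have gap := root_gap l; have n3 := nR_ge3; have dg := del_ge; have lp := ln_pred.
have [l20 K2 K0] := K_facts; have lm0 := lm_ge0; have [ln0 ln2] := lnn_facts.
have alE : al l = (cRe (al l))%:C by move: im0; case: (al l) => u v /= ->.
have AE : Num.max 1 `|cRe (al l)| = A l by rewrite [in RHS]alE cm_real.
have y0 : 0 < p.2%:~R :> R by rewrite ltr0z.
have u0 : 0 < linf al l p by apply: (linf_gt0 fal n_gt1); rewrite gt_eqF.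
split; last first.
  rewrite /zeta /lzmin /lkap AE; case: eqP => _; lra.
split=> //; rewrite AE.
have -> : `|p.1%:~R / p.2%:~R - cRe (al l)| = linf al l p / p.2%:~R.
  have yn : p.2%:~R != 0 :> R by rewrite gt_eqF.
  apply: (mulIf yn); rewrite [RHS]divfK//.
  rewrite -[X in _ * X = _](ger0_norm (ltW y0)) -normrM mulrBl divfK//.
  rewrite /linf [in RHS]alE -(rmorph_int (real_complex R)) -(rmorph_int (real_complex R) p.2).
  by rewrite -rmorphM -rmorphB cm_real.
have p2n : 0 < 2 * p.2%:~R ^+ n :> R by rewrite mulr_gt0 ?exprn_gt0.
rewrite -[X in X <= _]lnK ?posrE ?divr_gt0// -[2 * _ ^+ n]lnK ?posrE// -expRN -expRD ler_expR.
rewrite ln_div ?posrE// [ln (2 * _)]lnM ?posrE//; last exact: exprn_gt0.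
rewrite lnXn// -[ln _ *+ n]mulr_natl.
have key : (N - 2) * lkap <= del / 2 - lm - N * l2 - (N - 1) / 2 * ln (N - 1).
  rewrite /lkap; case: (eqVneq n 3%N) => [n3E|nn3]; last first.
    exact: (kap_bound n3 l20 K2 lm0 ln0 lp dg).
  have NE : N = 3 by rewrite n3E.
  have ln2E : ln (N - 1) = l2 by rewrite NE; congr ln; lra.
  have ln3 : 3 / 2 * l2 <= ln N.
    have : ln (2 ^+ 3) <= ln (3 ^+ 2) :> R.
      by rewrite ler_ln ?posrE ?exprn_gt0//; lra.
    rewrite !lnXn// -[_ *+ 3]mulr_natl -[_ *+ 2]mulr_natl NE; lra.
  rewrite ln2E NE; apply: (@kap_bound3 _ _ lM0 _ _ K (ln N) (ln (17 / 16))) => //.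
  - exact: (cubic n3E).
  - exact: lM_lM0.
  - exact: ln_1716.
  - by move: dg; rewrite NE.
exact: approx_arith gap key h1.
Qed.

Lemma big_count (t : seq (int * int)) : uniq t ->
  {in t, forall p : int * int, [/\ 0 < p.2, gcdz p.1 p.2 = 1, fval f al p <= mm &
    M0 ^+ 2 < Num.max `|p.1%:~R| p.2%:~R]} ->
  (size t <= #|[set i | cIm (al i) == 0%R]| * large_bound n)%N.
Proof.
move=> ut ht.
have i0 : 'I_n := Ordinal (ltnW n_gt1).
pose near p := [arg min_(i < i0) linf al i p]%O.
have nearP p j : linf al (near p) p <= linf al j p.
  by rewrite /near; case: arg_minP => // i _; apply.
have -> : size t = (\sum_(i < n) size [seq p <- t | near p == i])%N.
  under eq_bigr => i _ do rewrite size_filter -sum1_count.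
  by rewrite -sum1_size (partition_big near predT).
rewrite -sum_nat_const [X in (_ <= X)%N]big_mkcond/=; apply: leq_sum => i _.
rewrite inE; case: eqP => im0.
  have alE : al i = (cRe (al i))%:C by move: im0; case: (al i) => u v /= ->.
  apply: (@large_count R n f al fal n_ge3 i (cRe (al i)) alE lkap lzmin).
  - by move=> n3; rewrite /lkap /lzmin; have -> : (n == 3)%N by rewrite n3.
  - move=> n4; rewrite /lzmin /lkap.
    by have -> : (n == 3)%N = false by move: n4; clear; lia.
  - exact: filter_uniq.
  - move=> p; rewrite mem_filter => /andP[/eqP pi pt]; have [p0 _ pm pb] := ht _ pt.
    by rewrite -pi; apply: big_approx => // j; apply: nearP.
  - move=> p p'; rewrite !mem_filter => /andP[_ pt] /andP[_ pt'].
    have [p0 g _ _] := ht _ pt; have [p0' g' _ _] := ht _ pt'.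
    exact: coprime_nonprop.
have -> : [seq p <- t | near p == i] = [::].
  apply/eqP; rewrite -[_ == _]negbK -has_filter; apply/hasPn => p pt.
  have [p0 _ pm pb] := ht _ pt; apply/eqP => pi; apply: im0; rewrite -pi.
  by apply: (big_real p0 pm) pb => j; apply: nearP.
by [].
Qed.

Local Notation Re0 := [set i | cIm (al i) == 0%R].
Local Notation Pos := [set i | 0%R < cIm (al i)].
Local Notation Lam := (lM0 - N * K - lm).

Lemma card_predE (P : pred 'I_n) : #|[set i | P i]| = (\sum_(i < n) P i)%N.
Proof.
by rewrite -sum1dep_card big_mkcond; apply: eq_bigr => i _; case: (P i).
Qed.

Lemma card_Re_Pos : (#|Re0| + 2 * #|Pos| = n)%N.
Proof.
have E : #|[set i | cIm (al i) < 0%R]| = #|Pos|.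
  rewrite -(card_preimset _ (inv_inj cjK)); congr #|pred_of_set _|.
  by apply/setP => i; rewrite !inE Im_cj oppr_lt0.
rewrite mul2n -addnn -{2}E !card_predE -!big_split/= -[RHS]card_ord -sum1_card.
by apply: eq_bigr => i _; case: (ltgtP (cIm (al i)) 0).
Qed.

Lemma card_Ip : #|[set i | 0%R <= cIm (al i)]| = (#|Re0| + #|Pos|)%N.
Proof.
by rewrite !card_predE -big_split/=; apply: eq_bigr => i _; case: (ltgtP (cIm (al i)) 0).
Qed.

Lemma sum_Re_Pos (B : 'I_n -> R) : (forall i, B (cj i) = B i) ->
  \sum_(i < n) B i = \sum_(i in Re0) B i + 2 * \sum_(i in Pos) B i.
Proof.
move=> BJ; rewrite (bigID (fun i => cIm (al i) == 0))/=; congr (_ + _).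
  by apply: eq_bigl => i; rewrite inE.
rewrite (bigID (fun i => 0 < cIm (al i)))/= mulr_natl mulr2n; congr (_ + _).
  by apply: eq_bigl => i; rewrite inE; case: (ltgtP (cIm (al i)) 0).
rewrite [RHS](reindex_inj (inv_inj cjK))/=; apply: eq_big => i; last by rewrite BJ.
by rewrite inE Im_cj oppr_gt0; case: (ltgtP (cIm (al i)) 0).
Qed.

Lemma Lam_ge : e * a + (lM0 - a) + lm <= Lam.
Proof. by have hA' := hA; lra. Qed.

Lemma Lam_gt0 : 0 < Lam.
Proof.
have [a0 _] := a_ge; have /andP[e0 _] := e01; have aM0' := aM0; have lm0 := lm_ge0.
have ea : 0 < e * a by rewrite mulr_gt0.
by have h := Lam_ge; lra.
Qed.

(** Near a real root the last solution has y <= M0^2, and also y max(1, |al|) <= 2 M0^2 because |x|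
    <= M0^2; this saving is kept for [sum_real_bound1]. Near a non-real root 2 |Im al| y^2 <= 1, so
    large y means small imaginary part, and [disc_bound] limits all these terms together. *)
Lemma small_bound (t : seq (int * int)) : uniq t ->
  {in t, forall p : int * int, [/\ 0 < p.2, gcdz p.1 p.2 = 1, fval f al p <= mm &
    Num.max `|p.1%:~R| p.2%:~R <= M0 ^+ 2]} ->
  (size t)%:R * Lam <= (#|Re0| + #|Pos|)%:R * Lam +
    \sum_(i in Re0) (2 * lM0 - Num.max 0 (ln (A i) - l2)) +
    (if #|Pos| == 0%N then 0 else (N - 1) * (lM - a) + #|Pos|%:R * ln N).
Proof.
move=> ut ht; have l0 := ltW Lam_gt0.
have [||B [BJ BP BS]] := @small_sum R n f al fal n_gt1 M0 mm M01 mm1 M0min cj cjE cjK l0 t ut.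
- by move=> p /ht[].
- move=> p p' /ht[p0 g _ _] /ht[p0' g' _ _]; exact: coprime_nonprop.
rewrite card_Ip (sum_Re_Pos BJ) in BS; apply: le_trans BS _.
rewrite -[X in _ <= X]addrA lerD2l; have M00 := M0_gt0; have [l20 _ _] := K_facts.
have M01' := M01; have MM0' := MM0.
have M2 : M0 <= M0 ^+ 2 by rewrite expr2 -[X in X <= _]mul1r ler_wpM2r// ltW.
have M20 : 0 < M0 ^+ 2 by apply: exprn_gt0.
have lM2 : ln (M0 ^+ 2) = 2 * lM0 by rewrite lnXn// mulr_natl.
apply: lerD.
  apply: ler_sum => i; rewrite inE => /eqP im0; have A0 := root_max_gt0 i.
  have [y [y1 yB yA yM]] : exists y : R, [/\ 1 <= y, B i = ln y, y * A i <= 2 * M0 ^+ 2 & y <= M0 ^+ 2].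
    have [->|[p [pt Cp ->]]] := BP i.
      exists 1; rewrite ln1 mul1r; split=> //; last lra.
      by have := max_le_mahler fal i; lra.
    have [p0 _ _] := ht _ pt; rewrite ge_max => /andP[xM yM].
    have y0 : 0 < p.2%:~R :> R by rewrite ltr0z.
    have y1 : 1 <= p.2%:~R :> R by apply: intr_ge1.
    exists p.2%:~R; split=> //.
    have u0 : 0 < linf al i p by apply: (linf_gt0 fal n_gt1); rewrite gt_eqF.
    have u2 : linf al i p <= 1 / 2.
      by apply: le_trans Cp; rewrite -[X in X <= _]mul1r ler_wpM2r// ltW.
    rewrite maxr_pMr ?(ltW y0)// ge_max mulr1; apply/andP; split; first lra.
    have -> : p.2%:~R * cm (al i) = cm (p.1%:~R - (p.1%:~R - al i * p.2%:~R)).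
      by rewrite opprB addrC subrK cmM cm_int ger0_norm ?(ltW y0)// mulrC.
    by apply: le_trans (cmD _ _) _; rewrite cmN cm_int -/(linf al i p); lra.
  have y0 : 0 < y by apply: lt_le_trans y1.
  have h1 : ln y <= 2 * lM0 by rewrite -lM2 ler_ln ?posrE.
  have h2 : ln y + ln (A i) <= l2 + 2 * lM0.
    rewrite -lM2 -!lnM ?posrE// ler_ln ?posrE//; exact: mulr_gt0.
  have : Num.max 0 (ln (A i) - l2) <= 2 * lM0 - ln y by rewrite ge_max; apply/andP; split; lra.
  by rewrite yB; lra.
case: eqP => q0.
  rewrite big_pred0 ?mulr0// => i; apply/negbTE; apply/negP => ip.
  by have := cards0_eq q0 => /setP/(_ i); rewrite ip inE.
pose S := [set i | (0 < cIm (al i)) && (B i != 0)].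
have SE : \sum_(i in Pos) B i = \sum_(i in S) B i.
  rewrite (bigID (fun i => B i == 0))/= big1 ?add0r => [|i /andP[_ /eqP]//].
  by apply: eq_bigl => i; rewrite !inE.
have S0 i : i \in S -> 0 < cIm (al i) by rewrite inE => /andP[].
have hd := disc_bound S0.
have hS : \sum_(i in S) 2 * (ln (2 * cIm (al i)) + ln N) <=
    \sum_(i in S) (2 * ln N - 4 * B i).
  apply: ler_sum => i iS; have i0 := S0 _ iS; move: iS; rewrite inE => /andP[_ B0].
  have [B0'|[p [pt Cp ->]]] := BP i; first by rewrite B0' eqxx in B0.
  have [p0 _ _ _] := ht _ pt; have y0 : 0 < p.2%:~R :> R by rewrite ltr0z.
  have : ln (2 * cIm (al i) * p.2%:~R ^+ 2) <= 0.
    apply: ln_le0; have := Im_linf i p0; rewrite gtr0_norm// => h.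
    have : p.2%:~R * (cIm (al i) * p.2%:~R) <= p.2%:~R * linf al i p.
      by rewrite ler_wpM2l// ltW.
    by rewrite expr2; lra.
  rewrite [ln (_ * _ ^+ 2)]lnM ?posrE; [|exact: mulr_gt0|exact: exprn_gt0].
  by rewrite [ln (_ ^+ 2)]lnXn// -[_ *+ 2]mulr_natl; lra.
have SB : \sum_(i in S) (2 * ln N - 4 * B i) = #|S|%:R * (2 * ln N) - 4 * \sum_(i in Pos) B i.
  by rewrite sumrB sumr_const -mulr_sumr SE [#|S|%:R * _]mulr_natl.
rewrite SB in hS.
have cS : #|S|%:R * (2 * ln N) <= #|Pos|%:R * (2 * ln N).
  rewrite ler_wpM2r//; first by have [? _] := lnn_facts; lra.
  by rewrite ler_nat subset_leq_card//; apply/fintype.subsetP => i; rewrite !inE => /andP[].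
by have aE' := aE; lra.
Qed.

Lemma sum_real_bound : \sum_(i in Re0) (2 * lM0 - Num.max 0 (ln (A i) - l2)) <=
  #|Re0|%:R * (2 * lM0).
Proof.
have -> : #|Re0|%:R * (2 * lM0) = \sum_(i in Re0) (2 * lM0).
  by rewrite sumr_const mulr_natl.
by apply: ler_sum => i _; rewrite lerBlDr lerDl le_max lexx.
Qed.

(** If (1, 0) is a solution then a0 <= mm, and the sum of the ln (A i) is at least lM0 - lm. The
    savings of [small_bound] thus amount to one further Lam, the price of (1, 0). *)
Lemma sum_real_bound1 : #|Pos| = 0%N -> a0 <= mm ->
  \sum_(i in Re0) (2 * lM0 - Num.max 0 (ln (A i) - l2)) <= N * (2 * lM0) - Lam.
Proof.
move=> q0 am; have rn := card_Re_Pos; rewrite q0 muln0 addn0 in rn.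
have allR i : i \in Re0.
  have : Re0 == [set: 'I_n] by rewrite eqEcard finset.subsetT cardsT card_ord rn/=.
  by move=> /eqP ->; rewrite inE.
have -> : \sum_(i in Re0) (2 * lM0 - Num.max 0 (ln (A i) - l2)) =
    \sum_(i < n) (2 * lM0 - Num.max 0 (ln (A i) - l2)) by apply: eq_bigl => i; rewrite allR.
have h : \sum_(i < n) (2 * lM0 - Num.max 0 (ln (A i) - l2)) <=
    \sum_(i < n) (2 * lM0 + l2 - ln (A i)).
  apply: ler_sum => i _; rewrite -addrA lerD2l lerNl opprB le_max.
  by rewrite lexx orbT.
apply: le_trans h _; rewrite sumrB sumr_const card_ord -[_ *+ n]mulr_natl.
have MA : lM = ln a0 + \sum_(i < n) ln (A i).
  rewrite -(ln_prod (P := predT) (fun i _ => root_max_gt0 i)) /mahler lnM ?posrE ?lead_gt0//.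
  by apply: prodr_gt0 => i _; apply: root_max_gt0.
have lam : ln a0 <= lm by rewrite ler_ln ?posrE ?lead_gt0// (lt_le_trans _ mm1).
have [l20 K2 K0] := K_facts; have n3 := nR_ge3; have MM := lM0_lM.
clear rn q0; have c : N * l2 <= N * K by rewrite ler_wpM2l; lra.
lra.
Qed.

Lemma reduced_count (t : seq (int * int)) : uniq t ->
  {in t, forall p : int * int, [/\ 0 < p.2 \/ p = (1, 0), gcdz p.1 p.2 = 1 & fval f al p <= mm]} ->
  (size t)%:R <= (if (n <= 4)%N then 9 * N - 16 * #|Pos|%:R else 7 * N - 12 * #|Pos|%:R)
    + (N - #|Pos|%:R) * (2 / e).
Proof.
move=> ut ht.
pose sm (p : int * int) := Num.max `|p.1%:~R| p.2%:~R <= M0 ^+ 2 :> R.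
pose t1 := [seq p <- t | p.2 == 0].
pose t' := [seq p <- t | p.2 != 0].
pose ts := [seq p <- t' | sm p].
pose tb := [seq p <- t' | ~~ sm p].
have szE : (size t = size t1 + size ts + size tb)%N.
  rewrite -addnA [(size ts + _)%N](_ : _ = size t'); last first.
    by rewrite [size ts]size_filter [size tb]size_filter count_predC.
  by rewrite !size_filter count_predC.
have h1 p : p \in t1 -> p = (1, 0).
  rewrite mem_filter => /andP[/eqP p0 /ht[[|//]]]; by rewrite p0 ltxx.
have s1 : (size t1 <= 1)%N.
  have : {subset t1 <= [:: (1, 0)]} by move=> p /h1 ->; rewrite mem_seq1.
  exact: uniq_leq_size (filter_uniq _ ut).
have ht' p : p \in t' -> [/\ 0 < p.2, gcdz p.1 p.2 = 1 & fval f al p <= mm].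
  rewrite mem_filter => /andP[p0 /ht[h g m']]; split=> //.
  by case: h p0 => // ->; rewrite eqxx.
have hs := @small_bound ts (filter_uniq _ (filter_uniq _ ut)).
have hb := @big_count tb (filter_uniq _ (filter_uniq _ ut)).
have {}hs := hs (fun p pts => let: And3 x y z := ht' p (mem_subseq (filter_subseq _ _) pts) in
   And4 x y z (proj1 (andP (eq_rect _ is_true pts _ (mem_filter _ _ _))))).
have {}hb : (size tb <= #|Re0| * large_bound n)%N.
  apply: hb => p; rewrite mem_filter => /andP[]; rewrite /sm -ltNge => hp /ht'[? ? ?].
  by split.
have rn := card_Re_Pos; have rnR : N = #|Re0|%:R + 2 * #|Pos|%:R.
  by rewrite -[in LHS]rn natrD natrM.
clear rn.
have L0 := Lam_gt0; have [a_0 ha] := a_ge; have /andP[e0 e1] := e01; have lm0 := lm_ge0.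
have Xe : 2 / e * e = 2 by rewrite divfK// gt_eqF.
have X2 : 2 <= 2 / e by rewrite ler_pdivlMr//; lra.
have hbR : (size tb)%:R <= #|Re0|%:R * (large_bound n)%:R :> R by rewrite -natrM ler_nat.
have s1R : (size t1)%:R <= 1 :> R by rewrite (ler_nat _ _ 1).
have hL := Lam_ge; have aM0' := aM0.
rewrite szE !natrD; clear szE; have [q0|q0] := eqVneq #|Pos| 0%N.
  have rN : #|Re0|%:R = N by rewrite rnR q0 mulr0 addr0.
  rewrite q0 eqxx addr0 addn0 rN in hs; rewrite q0 !mulr0 !subr0.
  have hsr := sum_real_bound1 q0; clear q0.
  have hX : 2 * lM0 <= 2 / e * Lam.
    have : 2 / e * (e * a + (lM0 - a)) <= 2 / e * Lam by rewrite ler_wpM2l; lra.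
    rewrite mulrDr mulrA Xe; have : 2 * (lM0 - a) <= 2 / e * (lM0 - a).
      by rewrite ler_wpM2r// subr_ge0.
    lra.
  have hs1 : (size ts)%:R * Lam + (size t1)%:R * Lam <= N * Lam + N * (2 * lM0).
    case E : (size t1) s1 => [|[|//]] _.
      rewrite mul0r addr0; apply: le_trans hs _; rewrite lerD2l -rN; exact: sum_real_bound.
    have am : a0 <= mm.
      have : nth (0, 0) t1 0 \in t1 by rewrite mem_nth// E.
      move=> pt; have pE := h1 _ pt; move: pt; rewrite pE mem_filter => /andP[_ /ht[_ _]].
      rewrite /fval big1 ?mulr1// => i _.
      by rewrite /linf /= mulr0 subr0 cm1.
    have h := hsr am; rewrite mul1r; lra.
  have N0 : 0 <= N by [].
  have hb' : (size tb)%:R <= N * (large_bound n)%:R by rewrite -rN.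
  apply: le_trans (real_count_arith L0 hX N0 hs1 hb') _; rewrite lerD2r.
  rewrite /large_bound; move: n_ge3.
  case: (ltngtP n 4) => n4 n3'.
  - have -> : (n == 3)%N by move: n4 n3'; clear; lia.
    by lra.
  - by rewrite gtn_eqF ?(ltn_trans _ n4)//=; lra.
  - have -> : (n == 3)%N = false by rewrite n4.
    by clear n4; lra.
rewrite (negbTE q0) in hs.
have q1 : 1 <= #|Pos|%:R :> R by rewrite (ler_nat _ 1) lt0n.
have [l20 K2 K0] := K_facts; have [ln0 lnN] := lnn_facts.
have lMt : lM <= lM0 + l2 / 10 by have := lM_lM0; have := ln_1716; lra.
have NKa : N * K <= a by lra.
have r0 : 0 <= #|Re0|%:R :> R by [].
have {}hs : (size ts)%:R * Lam <= (#|Re0|%:R + #|Pos|%:R) * Lam + #|Re0|%:R * (2 * lM0) +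
    ((N - 1) * (lM - a) + #|Pos|%:R * ln N).
  by apply: le_trans hs _; rewrite natrD lerD2r lerD2l sum_real_bound.
(* With N = r + 2 q the linear terms are 9 r + 2 q and 7 r + 2 q. In degree 3 both r and q are 1 and
   the slack is exactly 0; in the other degrees it is r + q - 1. *)
have slack : #|Re0|%:R - 1 <= (if (n <= 4)%N then 9 * N - 16 * #|Pos|%:R else 7 * N - 12 * #|Pos|%:R)
      - (1 + #|Re0|%:R + #|Pos|%:R + #|Re0|%:R * (large_bound n)%:R) /\
    0 <= (if (n <= 4)%N then 9 * N - 16 * #|Pos|%:R else 7 * N - 12 * #|Pos|%:R)
      - (1 + #|Re0|%:R + #|Pos|%:R + #|Re0|%:R * (large_bound n)%:R).
  rewrite rnR /large_bound; move: n_ge3; case: (ltngtP n 4) => n4 n3'.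
  - have n3 : n = 3%N by move: n4 n3'; clear; lia.
    have [-> ->] : #|Re0| = 1%N /\ #|Pos| = 1%N.
      by move: (etrans card_Re_Pos n3) q0; move: #|Re0| #|Pos| => ? ?; clear; lia.
    have -> : (n == 3)%N by rewrite n3.
    by clear n3; split; lra.
  - by rewrite gtn_eqF ?(ltn_trans _ n4)//=; split; lra.
  - have -> : (n == 3)%N = false by rewrite n4.
    by clear n4; split; lra.
exact: (nonreal_count_arith L0 Xe X2 r0 q1 rnR hL lm0 aM0' lMt l20 lnN NKa K2 hs s1R hbR slack.1 slack.2).
Qed.
End ReducedCount.

(** * Cubic forms and a positive definite covariant *)

Section CubicReduction.
Variable R : realType.

Definition qform (al be ga : R) (x y : int) : R :=
  al * x%:~R ^+ 2 - 2 * be * x%:~R * y%:~R + ga * y%:~R ^+ 2.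

(** Gauss reduction with an approximate minimum: A is taken within the factor 9/8 of the infimum
    over coprime pairs. Rounding to the nearest integer gives |B| <= A / 2, hence B^2 <= 9/32 A C,
    and 23/32 = 1 - 9/32. *)
Lemma reduced_pair (al be ga kap : R) : 0 < kap ->
  (forall x y : int, gcdz x y = 1 -> kap <= qform al be ga x y) ->
  exists x y x' y' : int, [/\ x * y' - x' * y = 1,
    qform al be ga x y <= 9 / 8 * qform al be ga x' y' &
    23 / 32 * (qform al be ga x y * qform al be ga x' y') <= al * ga - be ^+ 2].
Proof.
move=> kap0 hk; pose q := qform al be ga.
pose E : set R := [set z | exists x y : int, gcdz x y = 1 /\ z = q x y]%classic.
have E1 : E (q 1 0) by exists 1, 0.
have lbE : lbound E kap by move=> _ [x [y [g ->]]]; apply: hk.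
have hE : has_inf E by split; [exists (q 1 0)|exists kap].
have infk : kap <= inf E by apply: lb_le_inf => //; exists (q 1 0).
have inf0 : 0 < inf E by apply: lt_le_trans infk.
have e0 : 0 < inf E / 8 by lra.
have [_ [x [y [g ->]]] Alt] := inf_adherent e0 hE.
have infq x' y' : gcdz x' y' = 1 -> inf E <= q x' y'.
  by move=> g'; apply: ge_inf; [exact: hE.2|exists x', y'].
have [u [v uv]] := Bezoutz x y; rewrite g in uv.
pose A := q x y; have A0 : 0 < A by apply: lt_le_trans (infq _ _ g).
pose B0 := - al * x%:~R * v%:~R - be * (x%:~R * u%:~R - v%:~R * y%:~R) + ga * y%:~R * u%:~R.
pose k := Num.floor (B0 / A + 1 / 2).
pose x' := - v - k * x; pose y' := u - k * y.
have dt : x * y' - x' * y = 1 by rewrite -uv /x' /y'; ring.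
have g' : gcdz x' y' = 1.
  apply/eqP; rewrite -/(coprimez _ _); apply/coprimezP; exists (- y, x) => /=.
  by rewrite -dt; ring.
pose B := B0 - k%:~R * A.
have kl : k%:~R <= B0 / A + 1 / 2 by apply: floor_le.
have kr : B0 / A + 1 / 2 < k%:~R + 1 by have := floorD1_gt (B0 / A + 1 / 2); rewrite rmorphD.
have [w wE] : exists w : R, w = B0 / A by exists (B0 / A).
have BA : B0 = w * A by rewrite wE divfK// gt_eqF.
rewrite -wE in kl kr.
have B1 : B <= A / 2.
  have h : w - k%:~R - 1 / 2 <= 0 by lra.
  by have := mulr_le0_ge0 h (ltW A0); rewrite /B BA !mulrBl; lra.
have B2 : - (A / 2) <= B.
  have h : 0 <= w - k%:~R + 1 / 2 by lra.
  by have := mulr_ge0 h (ltW A0); rewrite /B BA mulrDl mulrBl; lra.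
have BB : B ^+ 2 <= A ^+ 2 / 4 by nra.
have key : A * q x' y' - B ^+ 2 = al * ga - be ^+ 2.
  have uvR : u%:~R * x%:~R + v%:~R * y%:~R = 1 :> R.
    by rewrite -!intrM -intrD uv.
  transitivity ((al * ga - be ^+ 2) * (u%:~R * x%:~R + v%:~R * y%:~R) ^+ 2); last first.
    by rewrite uvR expr1n mulr1.
  rewrite /B /B0 /A /q /qform /x' /y' !(rmorphB, rmorphM, rmorphN)/=.
  ring.
have C0 := infq _ _ g'.
exists x, y, x', y'; split=> //; rewrite -/q -/A.
  by rewrite /A; lra.
have AleC : A <= 9 / 8 * q x' y' by rewrite /A; lra.
have AC : A * A <= A * (9 / 8 * q x' y') by rewrite ler_pM2l.
have : A ^+ 2 = A * A by rewrite expr2.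
lra.
Qed.

(** Lagrange's identity for three weighted points of the plane with coordinates (r i, s i); the
    hypothesis removes the second coordinate of the weighted sum. *)
Lemma cubic_det (r s c : 'I_3 -> R) :
  let i0 := ord0 in let i1 := lift ord0 ord0 in let i2 := lift ord0 (lift ord0 ord0) in
  let D i j := (r i - r j) ^+ 2 + (s i - s j) ^+ 2 in
  \sum_(i < 3) c i * s i = 0 ->
  (\sum_(i < 3) c i) * (\sum_(i < 3) c i * (r i ^+ 2 + s i ^+ 2)) - (\sum_(i < 3) c i * r i) ^+ 2
  = c i0 * c i1 * D i0 i1 + c i0 * c i2 * D i0 i2 + c i1 * c i2 * D i1 i2.
Proof.
move=> i0 i1 i2 D h.
have -> : (\sum_(i < 3) c i * r i) ^+ 2 =
  (\sum_(i < 3) c i * r i) ^+ 2 + (\sum_(i < 3) c i * s i) ^+ 2.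
  by rewrite h expr0n addr0.
by rewrite !big_ord_recl !big_ord0 /D /i0 /i1 /i2; ring.
Qed.

Variables (f : {poly int}) (al : 'I_3 -> R[i]).
Hypothesis fal : root_system f al.
Local Notation a0 := `|(lead_coef f)%:~R : R|.

(** For y != 0 this is the absolute value of a resultant, an integer by [norm_int] and nonzero
    because the roots are irrational. *)
Lemma fval_ge1 (x y : int) : gcdz x y = 1 -> 1 <= fval f al (x, y).
Proof.
move=> g; have a1 : 1 <= a0 := abs_lead_ge1 fal.
have a00 : 0 < a0 by apply: lt_le_trans a1.
have [y0|yn0] := eqVneq y 0.
  have x1 : `|x| = 1.
    by move: g; rewrite y0 gcdz0 => h; rewrite -h.
  rewrite /fval big1 ?mulr1// => i _; rewrite /linf/= y0 mulr0 subr0 cm_int -intr_norm x1.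
  by [].
have sz : (size (x%:P - y%:P * 'X : {poly int})%R <= 2)%N.
  apply: leq_trans (size_polyD _ _) _; rewrite size_polyN geq_max.
  apply/andP; split; first by rewrite (leq_trans (size_polyC_leq1 _)).
  by rewrite mul_polyC (leq_trans (size_scale_leq _ _))// size_polyX.
have [z hz] := norm_int fal sz.
have E : fval f al (x, y) = `|z%:~R|.
  rewrite -cm_int -hz cmM expr1 cm_int cm_prod /fval; congr (_ * _).
  apply: eq_bigr => i _; rewrite /linf rmorphB rmorphM/= !map_polyC map_polyX/= !hornerE.
  by rewrite mulrC.
have f0 : 0 < fval f al (x, y).
  by rewrite mulr_gt0//; apply: prodr_gt0 => i _; apply: (linf_gt0 fal).
by rewrite E norm_intr_ge1//; apply: contraTneq f0 => z0; rewrite E z0 normr0 ltxx.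
Qed.

Let P i := \prod_(j < 3 | j != i) cm (al i - al j).

Lemma cubic_weight_zero : \sum_(i < 3) (P i ^+ 2)^-1 * cIm (al i) = 0.
Proof.
have [cj [cjE cjK]] := conj_index fal.
have PJ i : P (cj i) = P i.
  rewrite /P (reindex_inj (inv_inj cjK))/=; apply: eq_big => j.
    by rewrite (inj_eq (inv_inj cjK)).
  by move=> _; rewrite !cjE -rmorphB cm_conj.
have : \sum_(i < 3) (P i ^+ 2)^-1 * cIm (al i) = - \sum_(i < 3) (P i ^+ 2)^-1 * cIm (al i).
  rewrite [LHS](reindex_inj (inv_inj cjK))/= -sumrN; apply: eq_bigr => i _.
  by rewrite PJ cjE; case: (al i) => u v /=; rewrite mulrN.
by move=> h; lra.
Qed.

(** The quadratic form with weights [c i] is proportional to the sum of |al_j - al_k|^2 |x - al_i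
    y|^2, for real roots the Hessian up to a factor; its determinant is 3 / V^2. Each of its three
    terms is at most the whole, so their product and [fval_ge1] give A^3 >= kap. With A C <= 96 /
    (23 V^2) this bounds C, and C bounds the maxima. The constant obtained is (9/8 * 96/23)^3, about
    103.5, rounded up to 2^7. *)
Lemma cubic_bound : exists x y x' y' : int, x * y' - x' * y = 1 /\
  (a0 * \prod_(i < 3) Num.max (linf al i (x, y)) (linf al i (x', y'))) ^+ 2 <= 128 * disc f al.
Proof.
have a1 : 1 <= a0 := abs_lead_ge1 fal.
have a00 : 0 < a0 by apply: lt_le_trans a1.
have dij i j : j != i -> 0 < cm (al i - al j).
  by move=> ji; rewrite cm_gt0 subr_eq0; apply: contra_neq ji => /(rs_inj fal).
pose d01 := cm (al ord0 - al (lift ord0 ord0)).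
pose d02 := cm (al ord0 - al (lift ord0 (lift ord0 ord0))).
pose d12 := cm (al (lift ord0 ord0) - al (lift ord0 (lift ord0 ord0))).
have d010 : 0 < d01 by apply: dij.
have d020 : 0 < d02 by apply: dij.
have d120 : 0 < d12 by apply: dij.
have cmC (z w : R[i]) : cm (z - w) = cm (w - z) by rewrite -opprB cmN.
have P0E : P ord0 = d01 * d02.
  by rewrite /P big_mkcond !big_ord_recl big_ord0 /= !mul1r mulr1.
have P1E : P (lift ord0 ord0) = d01 * d12.
  by rewrite /P big_mkcond !big_ord_recl big_ord0 /= mulr1 mul1r cmC.
have P2E : P (lift ord0 (lift ord0 ord0)) = d02 * d12.
  by rewrite /P big_mkcond !big_ord_recl big_ord0 /= !mulr1 cmC [cm (al (lift _ (lift _ _)) - _)]cmC.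
pose V := d01 * d02 * d12; have V0 : 0 < V by rewrite !mulr_gt0.
have discE : disc f al = a0 ^+ 4 * V ^+ 2.
  rewrite /disc !big_ord_recl big_ord0 -/(P _) -/(P _) -/(P _) P0E P1E P2E /V.
  by ring.
pose c i := (P i ^+ 2)^-1.
have Pp i : 0 < P i by apply: prodr_gt0 => j; apply: dij.
have c0 i : 0 < c i by rewrite invr_gt0 exprn_gt0.
pose aq := \sum_(i < 3) c i.
pose bq := \sum_(i < 3) c i * cRe (al i).
pose gq := \sum_(i < 3) c i * (cRe (al i) ^+ 2 + cIm (al i) ^+ 2).
have linfE i (x y : int) : linf al i (x, y) ^+ 2 =
    (x%:~R - cRe (al i) * y%:~R) ^+ 2 + (cIm (al i) * y%:~R) ^+ 2.
  rewrite /linf cm_sqr -[X in X - _](rmorph_int (real_complex R) x).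
  rewrite -(rmorph_int (real_complex R) y); case: (al i) => u v /=.
  by rewrite !mulr0 subr0 !add0r sqrrN.
have qE (x y : int) : qform aq bq gq x y = \sum_(i < 3) c i * linf al i (x, y) ^+ 2.
  under eq_bigr => i _ do rewrite linfE.
  by rewrite /qform /aq /bq /gq !big_ord_recl !big_ord0; ring.
have detE : aq * gq - bq ^+ 2 = 3 / V ^+ 2.
  rewrite /aq /gq /bq cubic_det; last exact: cubic_weight_zero.
  have Dd i j : (cRe (al i) - cRe (al j)) ^+ 2 + (cIm (al i) - cIm (al j)) ^+ 2 = cm (al i - al j) ^+ 2.
    by rewrite cm_sqr; case: (al i) (al j) => u v [u' v'].
  rewrite !Dd -/d01 -/d02 -/d12 /c P0E P1E P2E /V.
  by field; rewrite !gt_eqF.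
have cV : c ord0 * c (lift ord0 ord0) * c (lift ord0 (lift ord0 ord0)) = (V ^+ 4)^-1.
  rewrite /c P0E P1E P2E /V; by field; rewrite !gt_eqF.
have prod3 (G : 'I_3 -> R) : \prod_(i < 3) G i = G ord0 * G (lift ord0 ord0) * G (lift ord0 (lift ord0 ord0)).
  by rewrite !big_ord_recl big_ord0 mulr1 mulrA.
pose kap := ((a0 ^+ 2) * V ^+ 4)^-1.
have kap0 : 0 < kap by rewrite invr_gt0 mulr_gt0 ?exprn_gt0.
have cube (x y : int) : gcdz x y = 1 -> kap <= qform aq bq gq x y ^+ 3.
  move=> g; have F1 := fval_ge1 g.
  have le i : c i * linf al i (x, y) ^+ 2 <= qform aq bq gq x y.
    rewrite qE (bigD1 i)//= lerDl sumr_ge0// => j _.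
    by rewrite mulr_ge0 ?exprn_ge0 ?cm_ge0 ?(ltW (c0 j)).
  have : \prod_(i < 3) (c i * linf al i (x, y) ^+ 2) <= \prod_(i < 3) qform aq bq gq x y.
    by apply: ler_prod => i _; rewrite le mulr_ge0 ?exprn_ge0 ?cm_ge0 ?(ltW (c0 i)).
  rewrite prodr_const card_ord => h; apply: le_trans h.
  rewrite big_split/= prod3 cV prodrXl /kap invfM mulrC ler_pM2l ?invr_gt0 ?exprn_gt0//.
  rewrite -[X in X <= _]mul1r ler_pdivrMr ?exprn_gt0// mulrC -exprMn.
  exact: exprn_ege1.
have q0 (x y : int) : 0 <= qform aq bq gq x y.
  rewrite qE; apply: sumr_ge0 => i _.
  by rewrite mulr_ge0 ?exprn_ge0 ?cm_ge0 ?(ltW (c0 i)).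
have low (x y : int) : gcdz x y = 1 -> Num.min 1 kap <= qform aq bq gq x y.
  move=> g; rewrite ge_min; case: (leP 1 (qform aq bq gq x y)) => //= h.
  apply: le_trans (cube _ _ g) _; rewrite exprS -[X in _ <= X]mulr1 ler_wpM2l//.
  by rewrite exprn_ile1// ltW.
have mk : 0 < Num.min 1 kap by rewrite lt_min ltr01.
have [x [y [x' [y' [dt AC ACd]]]]] := reduced_pair mk low.
exists x, y, x', y'; split=> //.
set A := qform aq bq gq x y in AC ACd *; set C := qform aq bq gq x' y' in AC ACd *.
have g : gcdz x y = 1.
  apply/eqP; rewrite -/(coprimez _ _); apply/coprimezP; exists (y', - x') => /=.
  by rewrite -dt; ring.
have A3 : kap <= A ^+ 3 by apply: cube.
have A0 : 0 < A by apply: lt_le_trans mk (low _ _ g).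
have C0 : 0 < C by lra.
pose mx i := Num.max (linf al i (x, y)) (linf al i (x', y')).
have mx2 i : c i * mx i ^+ 2 <= 9 / 8 * C.
  have h1 : c i * linf al i (x, y) ^+ 2 <= A.
    rewrite /A qE (bigD1 i)//= lerDl sumr_ge0// => j _.
    by rewrite mulr_ge0 ?exprn_ge0 ?cm_ge0 ?(ltW (c0 j)).
  have h2 : c i * linf al i (x', y') ^+ 2 <= C.
    rewrite /C qE (bigD1 i)//= lerDl sumr_ge0// => j _.
    by rewrite mulr_ge0 ?exprn_ge0 ?cm_ge0 ?(ltW (c0 j)).
  by rewrite /mx; case: (leP (linf al i (x, y)) (linf al i (x', y'))) => _; lra.
have pm : (\prod_(i < 3) mx i) ^+ 2 / V ^+ 4 <= (9 / 8 * C) ^+ 3.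
  have -> : (\prod_(i < 3) mx i) ^+ 2 / V ^+ 4 = \prod_(i < 3) (c i * mx i ^+ 2).
    by rewrite big_split/= (prod3 c) cV prodrXl mulrC.
  have -> : (9 / 8 * C) ^+ 3 = \prod_(i < 3) (9 / 8 * C) by rewrite prodr_const card_ord.
  apply: ler_prod => i _; rewrite mx2 andbT mulr_ge0 ?exprn_ge0 ?(ltW (c0 i))//.
  by rewrite le_max cm_ge0.
have ACV : 23 / 96 * (A * C) * V ^+ 2 <= 1.
  have V2 : 0 < V ^+ 2 by apply: exprn_gt0.
  have := ACd; rewrite detE ler_pdivlMr//; lra.
set p2 := (\prod_(i < 3) mx i) ^+ 2 in pm.
rewrite exprMn -/p2 discE.
have pm' : p2 <= (9 / 8 * C) ^+ 3 * V ^+ 4 by rewrite -ler_pdivrMr ?exprn_gt0.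
have A3' : 1 <= A ^+ 3 * (a0 ^+ 2 * V ^+ 4).
  by rewrite -ler_pdivrMr ?mulr_gt0 ?exprn_gt0// mul1r.
have T3 : (23 / 96 * (A * C) * V ^+ 2) ^+ 3 <= 1.
  by rewrite exprn_ile1// !mulr_ge0 ?exprn_ge0 ?ltW//; lra.
have fin : p2 <= 128 * (a0 ^+ 2 * V ^+ 2).
  rewrite -[X in X <= _]mulr1; apply: (@le_trans _ _ (p2 * (A ^+ 3 * (a0 ^+ 2 * V ^+ 4)))).
    by rewrite ler_wpM2l// exprn_ge0// prodr_ge0// => i _; rewrite le_max cm_ge0.
  apply: (@le_trans _ _ ((9 / 8 * C) ^+ 3 * V ^+ 4 * (A ^+ 3 * (a0 ^+ 2 * V ^+ 4)))).
    by rewrite ler_wpM2r// !mulr_ge0 ?exprn_ge0// ltW.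
  have -> : (9 / 8 * C) ^+ 3 * V ^+ 4 * (A ^+ 3 * (a0 ^+ 2 * V ^+ 4)) =
     (9 / 8 * (96 / 23)) ^+ 3 * (23 / 96 * (A * C) * V ^+ 2) ^+ 3 * (a0 ^+ 2 * V ^+ 2) by field.
  have aV : 0 <= a0 ^+ 2 * V ^+ 2.
    by apply: mulr_ge0; apply: exprn_ge0; apply: ltW.
  apply: (ler_wpM2r aV).
  have : (9 / 8 * (96 / 23)) ^+ 3 * (23 / 96 * (A * C) * V ^+ 2) ^+ 3 <= (9 / 8 * (96 / 23)) ^+ 3 * 1.
    by rewrite ler_wpM2l// exprn_ge0//; lra.
  by move=> h; apply: le_trans h _; lra.
have := ler_wpM2l (exprn_ge0 2 (ltW a00)) fin.
by rewrite (exprD _ 2 2 : a0 ^+ 4 = _) => h; apply: le_trans h _; rewrite le_eqVlt; apply/orP; left; apply/eqP; ring.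
Qed.

End CubicReduction.

(** * Homogenization of a polynomial at two elements *)

Section Homogenization.
Variables (A S : comNzRingType) (g : {rmorphism A -> S}) (u v : S).
Implicit Types p q : {poly A}.

(** The degree [N] is a parameter instead of being read off from [p], so that a drop of the degree
    shows up as a factor [v] ([hmg_widen]). *)
Definition hmg (N : nat) p : S := \sum_(i < N.+1) g p`_i * (u ^+ i * v ^+ (N - i)).

Lemma hmgD N p q : hmg N (p + q) = hmg N p + hmg N q.
Proof.
by rewrite /hmg -big_split/=; apply: eq_bigr => i _; rewrite coefD rmorphD mulrDl.
Qed.

Lemma hmgCM N c p : hmg N (c%:P * p) = g c * hmg N p.
Proof.
by rewrite /hmg mulr_sumr; apply: eq_bigr => i _; rewrite coefCM rmorphM -mulrA.
Qed.

Lemma hmgMX N p : hmg N.+1 (p * 'X) = u * hmg N p.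
Proof.
rewrite /hmg big_ord_recl coefMX /= rmorph0 mul0r add0r mulr_sumr.
apply: eq_bigr => i _; rewrite coefMX /= /bump /= add1n subSS exprS.
by rewrite -mulrA mulrCA.
Qed.

Lemma hmg_widen k N p : (size p <= N.+1)%N -> hmg (k + N) p = v ^+ k * hmg N p.
Proof.
move=> sp; elim: k => [|k IH]; first by rewrite add0n mul1r.
rewrite addSn /hmg big_ord_recr /= nth_default; last first.
  by rewrite (leq_trans sp)// ltnS; clear; lia.
rewrite rmorph0 mul0r addr0 exprS -mulrA -IH /hmg mulr_sumr.
apply: eq_bigr => i _; rewrite subSn ?exprS; last by rewrite -ltnS.
by rewrite [RHS]mulrCA; congr (_ * _); rewrite [RHS]mulrCA.
Qed.

Lemma hmgC N c : hmg N c%:P = g c * v ^+ N.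
Proof.
rewrite /hmg big_ord_recl coefC eqxx /= expr0 mul1r subn0 big1 ?addr0// => i _.
by rewrite coefC /= rmorph0 mul0r.
Qed.

Lemma hmgM N N' p q : (size p <= N.+1)%N -> (size q <= N'.+1)%N ->
  hmg (N + N') (p * q) = hmg N p * hmg N' q.
Proof.
move=> sp sq; elim/poly_ind: p N sp => [|p c IH] N sp.
  have h0 k : hmg k 0 = 0 by rewrite -[0 : {poly A}]polyC0 hmgC rmorph0 mul0r.
  by rewrite mul0r !h0 mul0r.
case: N sp => [|N] sp.
  have -> : p = 0.
    apply/eqP; move: sp; rewrite size_MXaddC; case: (altP (p =P 0)) => //= p0.
    by rewrite ltnS leqn0 size_poly_eq0 (negbTE p0).
  by rewrite mul0r add0r hmgCM hmgC expr0 mulr1.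
have sp' : (size p <= N.+1)%N.
  move: sp; rewrite size_MXaddC; case: ifP => [/andP[/eqP -> _] _|_]; last by [].
  by rewrite size_poly0.
rewrite mulrDl hmgD mulrAC addSn hmgMX IH// hmgCM -addSn hmg_widen//.
by rewrite hmgD hmgMX hmgC mulrDl !mulrA.
Qed.

Lemma hmg_prod_linear n (c d : 'I_n -> A) :
  (size (\prod_(i < n) ((c i)%:P * 'X + (d i)%:P))%R <= n.+1)%N /\
  hmg n (\prod_(i < n) ((c i)%:P * 'X + (d i)%:P)) = \prod_(i < n) (g (c i) * u + g (d i) * v).
Proof.
elim: n c d => [|n IH] c d.
  by rewrite !big_ord0 size_poly1 -polyC1 hmgC rmorph1 expr0 mulr1.
rewrite !big_ord_recr/=.
have [sz hm] := IH (fun i => c (widen_ord (leqnSn n) i)) (fun i => d (widen_ord (leqnSn n) i)).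
have sl : (size ((c ord_max)%:P * 'X + (d ord_max)%:P)%R <= 2)%N.
  rewrite size_MXaddC; case: ifP => // _.
  by rewrite ltnS size_polyC leq_b1.
split.
  apply: leq_trans (size_polyMleq _ _) _.
  by have := leq_add sz sl; move: (size _ + size _)%N => s; clear; lia.
have E := hmgM sz sl; rewrite addn1 in E.
rewrite E hm hmgD hmgMX !hmgC expr0 mulr1 expr1.
by rewrite [u * _]mulrC.
Qed.

End Homogenization.

Lemma rmorph_hmg (A A' S S' : comNzRingType) (g : {rmorphism A -> S}) (g' : {rmorphism A' -> S'})
    (h : {rmorphism A -> A'}) (phi : {rmorphism S -> S'}) u v N (p : {poly A}) :
  (forall c, phi (g c) = g' (h c)) ->
  phi (hmg g u v N p) = hmg g' (phi u) (phi v) N (map_poly h p).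
Proof.
move=> gh; rewrite /hmg rmorph_sum; apply: eq_bigr => i _.
by rewrite rmorphM gh rmorphM !rmorphXn coef_map.
Qed.

Lemma rmorph_mmap (k : nat) (A A' S S' : comNzRingType) (f : {rmorphism A -> S})
    (f' : {rmorphism A' -> S'}) (h : {rmorphism A -> A'}) (phi : {rmorphism S -> S'})
    (w : 'I_k -> S) (p : {mpoly A[k]}) :
  (forall c, phi (f c) = f' (h c)) ->
  phi (mmap f w p) = mmap f' (phi \o w) (map_mpoly h p).
Proof.
move=> fh; pose j := maxn (msize p) (msize (map_mpoly h p)).
rewrite (mmapE j) ?leq_maxl// (mmapE j) ?leq_maxr// rmorph_sum; apply: eq_bigr => m _.
rewrite rmorphM fh mcoeff_map_mpoly; congr (_ * _).
by rewrite /mmap1 rmorph_prod; apply: eq_bigr => i _; rewrite rmorphXn.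
Qed.

Lemma det_one_linear (S : comNzRingType) (A B x y x' y' U V : S) : x * y' - x' * y = 1 ->
  A * U - B * V = (A * x - B * y) * (y' * U - x' * V) + (A * x' - B * y') * (x * V - y * U).
Proof.
by move=> dt; rewrite -[LHS]mul1r -dt; ring.
Qed.

(** * Unimodular substitutions acting on forms and roots *)

Section FormTransform.
Variables (R : realType) (n : nat) (F : {mpoly int[2]}) (a b : 'I_n -> R[i]).
Hypothesis Fab : map_mpoly (intr : int -> R[i]) F =
  \prod_(i < n) (a i *: 'X_ord0 - b i *: 'X_ord_max).
Hypothesis Firr : irreducible_elt (map_mpoly (intr : int -> rat) F : {mpoly rat[2]}).
Hypothesis n_gt1 : (1 < n)%N.

(** Values of the form and its transforms are all evaluations of F; this lemma derives their
    factorizations from the single one over the complex numbers. *)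
Lemma mmap_form (S S' : comNzRingType) (f : {rmorphism int -> S}) (f' : {rmorphism R[i] -> S'})
    (phi : {rmorphism S -> S'}) (w : 'I_2 -> S) :
  (forall c, phi (f c) = f' c%:~R) ->
  phi (mmap f w F) = \prod_(i < n) (f' (a i) * phi (w ord0) - f' (b i) * phi (w ord_max)).
Proof.
move=> fh; rewrite (@rmorph_mmap _ _ _ _ _ f f' intr phi w F fh) Fab rmorph_prod.
by apply: eq_bigr => i _; rewrite rmorphB/= !mmapZ !mmapX !mmap1U.
Qed.

Definition la (i : 'I_n) (p : int * int) : R[i] := a i * p.1%:~R - b i * p.2%:~R.

Lemma form_value x y : (F.@[coords x y])%:~R = \prod_(i < n) la i (x, y).
Proof.
have := @mmap_form _ _ idfun idfun intr (coords x y) (fun c => erefl).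
by [].
Qed.

Variables (x y x' y' : int).
Hypothesis dt : x * y' - x' * y = 1.

(** The form after a substitution of determinant 1, dehomogenized. Homogenizing at [L1], [L2], the
    inverse substitution, gives F back. *)
Definition ft : {poly int} :=
  mmap polyC (coords (x%:P * 'X + x'%:P) (y%:P * 'X + y'%:P)) F.

Lemma map_ft : map_poly intr ft =
  \prod_(i < n) ((la i (x, y))%:P * 'X + (la i (x', y'))%:P).
Proof.
have h (c : int) : map_poly (intr : int -> R[i]) c%:P = (c%:~R)%:P by rewrite map_polyC.
have := @mmap_form _ _ polyC polyC (map_poly intr) (coords (x%:P * 'X + x'%:P) (y%:P * 'X + y'%:P)) h.
rewrite /ft => ->; apply: eq_bigr => i _.
have laP p : (la i p)%:P = (a i)%:P * (p.1%:~R)%:P - (b i)%:P * (p.2%:~R)%:P.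
  by rewrite -!polyCM -polyCB.
rewrite !laP /coords /= !rmorphD !rmorphM/= !map_polyC !map_polyX/=.
by ring.
Qed.

Let fQ : {poly rat} := map_poly intr ft.
Local Notation mC := (@mpolyC 2 rat).
Local Notation mCC := (@mpolyC 2 R[i]).
Let L1 : {mpoly rat[2]} := mC y'%:~R * 'X_ord0 - mC x'%:~R * 'X_ord_max.
Let L2 : {mpoly rat[2]} := mC x%:~R * 'X_ord_max - mC y%:~R * 'X_ord0.
Let LC1 : {mpoly R[i][2]} := mCC y'%:~R * 'X_ord0 - mCC x'%:~R * 'X_ord_max.
Let LC2 : {mpoly R[i][2]} := mCC x%:~R * 'X_ord_max - mCC y%:~R * 'X_ord0.

Lemma hmg_ft_complex : map_mpoly intr F = hmg mCC LC1 LC2 n (map_poly intr ft).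
Proof.
have [_ h] := @hmg_prod_linear _ _ mCC LC1 LC2 n (fun i => la i (x, y)) (fun i => la i (x', y')).
rewrite map_ft h Fab; apply: eq_bigr => i _.
rewrite -!mul_mpolyC /=.
have laM p : mCC (la i p) = mCC (a i) * mCC p.1%:~R - mCC (b i) * mCC p.2%:~R.
  by rewrite /la rmorphB !rmorphM.
rewrite !laM; apply: det_one_linear.
have <- : mCC ((x * y' - x' * y)%:~R) = 1 by rewrite dt !rmorph1.
by rewrite !(rmorphB, rmorphM).
Qed.

Lemma map_L1 : map_mpoly (ratr : rat -> R[i]) L1 = LC1.
Proof.
by rewrite /L1 /LC1 rmorphB !rmorphM/= !map_mpolyC !map_mpolyX /= !ratr_int.
Qed.

Lemma map_L2 : map_mpoly (ratr : rat -> R[i]) L2 = LC2.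
Proof.
by rewrite /L2 /LC2 rmorphB !rmorphM/= !map_mpolyC !map_mpolyX /= !ratr_int.
Qed.

Lemma map_fQ : map_poly ratr fQ = map_poly intr ft :> {poly R[i]}.
Proof. by rewrite /fQ -map_poly_comp; apply: eq_map_poly => c /=; rewrite ratr_int. Qed.

Lemma map_hmg_ft : map_mpoly (ratr : rat -> R[i]) (hmg mC L1 L2 n fQ) =
  map_mpoly (intr : int -> R[i]) F.
Proof.
rewrite hmg_ft_complex -map_fQ -map_L1 -map_L2.
apply: (rmorph_hmg (phi := map_mpoly ratr)) => c.
by apply/mpolyP => m; rewrite mcoeff_map_mpoly /= !mcoeffC rmorphM/= rmorph_nat.
Qed.

(** The factorization proves this over the complex numbers, and injectivity of [ratr] brings it down
    to the rationals, where irreducibility can be applied. *)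
Lemma hmg_ft : map_mpoly intr F = hmg mC L1 L2 n fQ.
Proof.
apply/mpolyP => m; apply: (fmorph_inj (ratr : {rmorphism rat -> R[i]})).
have /mpolyP/(_ m) := map_hmg_ft; rewrite !mcoeff_map_mpoly => E.
by rewrite /= ratr_int; exact: esym E.
Qed.

Lemma hmg_nonunit N p : (0 < N)%N -> hmg mC L1 L2 N p \isn't a GRing.unit.
Proof.
move=> N0.
have m1 : meval (fun _ => 0 : rat) L1 = 0 by rewrite rmorphB !rmorphM/= !mevalXU !mulr0 subr0.
have m2 : meval (fun _ => 0 : rat) L2 = 0 by rewrite rmorphB !rmorphM/= !mevalXU !mulr0 subr0.
apply/negP => /(rmorph_unit (meval (fun _ => 0 : rat))).
have hC (c : rat) : meval (fun _ => 0) (mC c) = idfun c by rewrite mevalC.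
rewrite (@rmorph_hmg _ _ _ _ mC idfun idfun (meval (fun _ => 0)) L1 L2 N p hC).
rewrite /= m1 m2 /hmg big1 ?unitr0// => i _; rewrite -exprD subnKC; last by rewrite -ltnS.
by rewrite expr0n eqn0Ngt N0 mulr0.
Qed.

(** Were this coefficient 0, homogenizing in degree n would split the linear form [L2] off F,
    against irreducibility. *)
Lemma ft_coef_neq0 : ft`_n != 0.
Proof.
apply/negP => /eqP f0.
have c0 : fQ`_n = 0 by rewrite /fQ coef_map f0.
have szC : (size (map_poly (intr : int -> R[i]) ft) <= n.+1)%N.
  rewrite map_ft; exact: (hmg_prod_linear (@idfun R[i]) 0 0 _ _).1.
have szf : (size ft <= n.+1)%N by rewrite size_map_inj_poly in szC => //; apply: intr_inj.
have sz : (size fQ <= n.-1.+1)%N.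
  rewrite prednK; last exact: ltnW.
  have s1 : (size fQ <= n.+1)%N by apply: leq_trans (size_poly _ _) szf.
  rewrite leqNgt; apply/negP => s2.
  have sE : size fQ = n.+1 by apply/eqP; rewrite eqn_leq s1.
  have : lead_coef fQ != 0 by rewrite lead_coef_eq0 -size_poly_eq0 sE.
  by rewrite lead_coefE sE /= c0 eqxx.
have E := hmg_ft; rewrite -[n in hmg _ _ _ n]prednK ?(ltnW n_gt1)// in E.
rewrite -[n.-1.+1]add1n hmg_widen// expr1 in E.
have [_ _ /(_ _ _ E)] := Firr.
have L2E : L2 = hmg mC L1 L2 1 1.
  by rewrite -polyC1 hmgC rmorph1 mul1r expr1.
case; first by rewrite L2E; apply/negP/hmg_nonunit.
by apply/negP/hmg_nonunit; move: n_gt1; clear; lia.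
Qed.

Lemma la_neq0 i : la i (x, y) != 0.
Proof.
have := ft_coef_neq0; rewrite -(intr_eq0 R[i]) -coef_map map_ft.
have -> : (\prod_(i < n) ((la i (x, y))%:P * 'X + (la i (x', y'))%:P))`_n = \prod_(i < n) la i (x, y).
  have := (hmg_prod_linear (@idfun R[i]) 1 0 (fun i => la i (x, y)) (fun i => la i (x', y'))).2.
  rewrite /hmg big_ord_recr /= subnn expr0 expr1n !mulr1 big1 ?add0r => [->|j _].
    by apply: eq_bigr => j _; rewrite mulr1 mulr0 addr0.
  by rewrite expr0n subn_eq0 leqNgt ltn_ord mulr0 mulr0.
by move=> h; apply: contraNneq h => h; rewrite (bigD1 i)//= h mul0r.
Qed.

Definition be (i : 'I_n) : R[i] := - la i (x', y') / la i (x, y).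

Lemma map_ft_be : map_poly intr ft =
  (\prod_(i < n) la i (x, y)) *: \prod_(i < n) ('X - (be i)%:P).
Proof.
rewrite map_ft -scaler_prod; apply: eq_bigr => i _; rewrite scalerBr -!mul_polyC -polyCM.
rewrite /be mulrCA divff ?la_neq0// mulr1 polyCN opprK.
by [].
Qed.

Lemma lead_ft : (lead_coef ft)%:~R = \prod_(i < n) la i (x, y).
Proof.
rewrite -[LHS](lead_coef_map_inj (intr_inj : injective (intr : int -> R[i])))//.
by rewrite map_ft_be lead_coefZ (monicP (monic_prod_XsubC _ _ _)) mulr1.
Qed.

(** Homogenizing fQ = e d, with d the gcd of [fQ] and [gQ], gives a factorization of F. As d has the
    root be i, it is not constant, so e is; hence every root of [ft] is a root of [g]. *)
Lemma be_conj (g : {poly int}) i j :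
  root (map_poly intr g) (be i) -> root (map_poly intr g) (be j).
Proof.
move=> gi.
pose gQ : {poly rat} := map_poly intr g.
have rQ (p : {poly int}) : map_poly ratr (map_poly intr p : {poly rat}) = map_poly intr p :> {poly R[i]}.
  by rewrite -map_poly_comp; apply: eq_map_poly => c /=; rewrite ratr_int.
have P0 : \prod_(i < n) la i (x, y) != 0 by apply/prodf_neq0 => l _; exact: la_neq0.
have rf k : root (map_poly intr ft) (be k).
  by rewrite map_ft_be rootZ// /root horner_prod (bigD1 k)//= hornerXsubC subrr mul0r.
pose d := gcdp fQ gQ; pose e := fQ %/ d.
have fE : fQ = e * d by rewrite divpK ?dvdp_gcdl.
have rd k : root (map_poly ratr d) (be k) = root (map_poly intr g) (be k).
  by rewrite /d gcdp_map !rQ root_gcd rf.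
have f0 : fQ != 0.
  by apply: contraNneq ft_coef_neq0 => h; rewrite -(intr_eq0 rat) -coef_map -/fQ h coef0.
have /andP[e0 d0] : (e != 0) && (d != 0) by rewrite -negb_or -mulf_eq0 -fE.
have sd : (1 < size d)%N.
  rewrite ltnNge; apply/negP => s1; have := rd i; rewrite gi.
  rewrite (size1_polyC s1) map_polyC rootC fmorph_eq0 => /eqP c0.
  by rewrite (size1_polyC s1) c0 eqxx in d0.
have szC : (size (map_poly (intr : int -> R[i]) ft) = n.+1)%N.
  by rewrite map_ft_be size_scale// size_prod_XsubC /index_enum unlock -enumT size_enum_ord.
have szf : size fQ = n.+1.
  by rewrite /fQ size_map_inj_poly ?rmorph0//; [rewrite -szC size_map_inj_poly ?rmorph0//; exact: intr_inj|exact: intr_inj].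
have [se|se] := leqP (size e) 1; last first.
  exfalso; have E := hmg_ft; have szM := size_mul e0 d0; rewrite -fE szf in szM.
  have nE : n = ((size e).-1 + (size d).-1)%N by move: szM se sd; move: (size e) (size d) => s1 s2; clear; lia.
  rewrite fE [X in hmg _ _ _ X]nE hmgM ?prednK ?(ltnW se) ?(ltnW sd)// in E.
  have [_ _ /(_ _ _ E)] := Firr.
  case; apply/negP/hmg_nonunit; [move: se|move: sd]; clear; lia.
have fj : root (map_poly ratr fQ) (be j) by rewrite rQ.
rewrite -rd; move: fj; rewrite fE rmorphM/= rootM => /orP[|//].
rewrite (size1_polyC se) map_polyC/= rootC fmorph_eq0 => /eqP c0.
by rewrite (size1_polyC se) c0 eqxx in e0.
Qed.

Lemma be_sub i j : be i - be j = (a j * b i - a i * b j) / (la i (x, y) * la j (x, y)).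
Proof.
have dtR := congr1 (fun z : int => z%:~R : R[i]) dt; rewrite /= rmorphB !rmorphM/= in dtR.
have li := la_neq0 i; have lj := la_neq0 j.
have -> : a j * b i - a i * b j = (a j * b i - a i * b j) * (x%:~R * y'%:~R - x'%:~R * y%:~R).
  by rewrite dtR mulr1.
have -> : be i - be j = (la i (x, y) * la j (x', y') - la i (x', y') * la j (x, y)) /
    (la i (x, y) * la j (x, y)).
  by rewrite /be; field; rewrite li lj.
by congr (_ / _); rewrite /la /=; ring.
Qed.

Hypothesis ab_neq0 : forall i j, i != j -> a i * b j - a j * b i != 0.

Lemma ft_root_system : root_system ft be.
Proof.
split.
- by rewrite map_ft_be lead_ft.
- by apply: contraNneq ft_coef_neq0 => ->; rewrite coef0.
- move=> i j /eqP; rewrite -subr_eq0 be_sub mulf_eq0 invr_eq0 mulf_eq0 !(negbTE (la_neq0 _)) !orbF.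
  by case: (eqVneq i j) => // ij; rewrite (negbTE (ab_neq0 _)) 1?eq_sym.
- exact: be_conj.
Qed.

Lemma linf_be i (X Y : int) : linf be i (X, Y) =
  cm (la i (x * X + x' * Y, y * X + y' * Y)) / cm (la i (x, y)).
Proof.
have li := la_neq0 i; rewrite /linf -cmV -cmM /=; congr cm.
rewrite /be; apply: (mulIf li); rewrite mulfVK// mulrBl mulrAC -[_ / _ * _]mulrA mulVf// mulr1.
by rewrite /la /= !rmorphD !rmorphM/=; ring.
Qed.

Lemma abs_lead_ft : `|(lead_coef ft)%:~R : R| = \prod_(i < n) cm (la i (x, y)).
Proof. by rewrite -cm_int lead_ft cm_prod. Qed.

Lemma cm_la_gt0 i : 0 < cm (la i (x, y)).
Proof. by rewrite cm_gt0 la_neq0. Qed.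

Lemma hval_be (X Y X' Y' : int) : `|(lead_coef ft)%:~R : R| *
    \prod_(i < n) Num.max (linf be i (X, Y)) (linf be i (X', Y')) =
  \prod_(i < n) Num.max (cm (la i (x * X + x' * Y, y * X + y' * Y)))
    (cm (la i (x * X' + x' * Y', y * X' + y' * Y'))).
Proof.
rewrite abs_lead_ft -big_split/=; apply: eq_bigr => i _; have l0 := cm_la_gt0 i.
by rewrite maxr_pMr ?ltW// !linf_be ![cm (la i (x, y)) * _]mulrC !divfK ?gt_eqF.
Qed.

Lemma fval_be (X Y : int) :
  fval ft be (X, Y) = `|(F.@[coords (x * X + x' * Y) (y * X + y' * Y)])%:~R : R|.
Proof.
rewrite -cm_int form_value cm_prod /fval abs_lead_ft -big_split/=; apply: eq_bigr => i _.
by rewrite linf_be mulrC divfK// gt_eqF// cm_la_gt0.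
Qed.

(** By [be_sub] every difference carries two denominators la i (x, y); over ordered pairs each
    occurs 2 (n - 1) times, which the power of the leading coefficient cancels. *)
Lemma disc_be : disc ft be = \prod_(i < n) \prod_(j < n | j != i) cm (a i * b j - a j * b i).
Proof.
rewrite /disc abs_lead_ft.
pose c i := cm (la i (x, y)).
have E i : \prod_(j < n | j != i) cm (be i - be j) =
   (\prod_(j < n | j != i) cm (a i * b j - a j * b i)) *
   ((c i ^+ n.-2 * \prod_(j < n) c j)^-1).
  rewrite (eq_bigr (fun j => cm (a i * b j - a j * b i) / (c i * c j))); last first.
    by move=> j _; rewrite be_sub cmM cmV cmM -opprB cmN.
  rewrite big_split/=; congr (_ * _); rewrite prodfV big_split/= prodr_const cardC1 card_ord.
  congr (_^-1); rewrite [\prod_(j < n) c j](bigD1 i)//= mulrA -exprSr.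
  by congr (_ ^+ _ * _); move: n_gt1; clear; lia.
rewrite (eq_bigr _ (fun i _ => E i)) big_split/= prodfV big_split/= prodrXl prodr_const card_ord.
rewrite -/c mulrCA -exprD; set P := \prod_(i < n) c i.
have P0 : 0 < P by apply: prodr_gt0 => i _; apply: cm_la_gt0.
have -> : (2 * n.-1 = n.-2 + n)%N by move: n_gt1; clear; lia.
by rewrite divff ?mulr1// expf_neq0// gt_eqF.
Qed.

End FormTransform.

(** * Cardinality bounds, Mahler's inequality and the size of m *)

Lemma prod_neq_lt (R : comNzRingType) (n : nat) (c : 'I_n -> 'I_n -> R) :
  (forall i j, c i j = c j i) ->
  \prod_(i < n) \prod_(j < n | j != i) c i j =
  \prod_(i < n) \prod_(j < n | (i < j)%N) c i j ^+ 2.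
Proof.
move=> sym.
rewrite (eq_bigr (fun i : 'I_n => \prod_(j < n | (i < j)%N) c i j *
    \prod_(j < n | (j < i)%N) c i j)); last first.
  move=> i _; rewrite (bigID (fun j : 'I_n => (i < j)%N))/=; congr (_ * _); apply: eq_bigl => j.
    by rewrite -val_eqE /=; case: (ltngtP i j).
  by rewrite -val_eqE /=; case: (ltngtP i j).
rewrite big_split/= [X in _ * X](exchange_big_dep predT)//= -big_split/=.
apply: eq_bigr => i _; rewrite -big_split/=; apply: eq_bigr => j _.
by rewrite expr2 [in X in _ * X]sym.
Qed.

Lemma card_seq (T : choiceType) (l : seq T) : uniq l -> ([set x | x \in l] #= `I_(size l))%classic%card.
Proof.
move=> ul; apply/pcard_eqP/bijPex; exists (fun z => index z l); split.
- by move=> z /= zl; rewrite index_mem.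
- move=> z w; rewrite !inE/= => zl wl E.
  by rewrite -(nth_index z zl) E nth_index.
- case: l ul => [//|x0 l] ul i /= il; exists (nth x0 (x0 :: l) i); first exact: mem_nth.
  exact: (@index_uniq _ x0 i (x0 :: l) il ul).
Qed.

(** Bounding all duplicate-free lists also yields finiteness, since an infinite set contains more
    than |B| elements. *)
Lemma card_at_most_inj (R : realType) (T : choiceType) (U : Type) (A : set T) (h : T -> U) (B : R) :
  {in A &, injective h} ->
  (forall t : seq T, uniq t -> {in t, forall x, A x} -> (size t)%:R <= B) ->
  card_at_most (h @` A)%classic B.
Proof.
move=> hinj hB.
have fA : finite_set A.
  apply: contrapT => /(infinite_set_fset (Num.trunc `|B|).+1)[X XA Xn].
  have := hB _ (finmap.fset_uniq X) (fun x xX => XA x xX).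
  apply/negP; rewrite -ltNge; apply: (@lt_le_trans _ _ (Num.trunc `|B|).+1%:R).
    by apply: le_lt_trans (ler_norm _) _; have /andP[] := truncn_itv (normr_ge0 B).
  by rewrite ler_nat.
have /finite_fsetP[X XE] := fA.
exists (size (finmap.enum_fset X)); split.
  apply: card_eq_trans (inj_card_eq hinj) _; rewrite XE.
  by apply/card_eq_fsetP.
apply: (hB _ (finmap.fset_uniq X)) => x xX.
by rewrite XE.
Qed.

Lemma card_at_most_le (R : realType) (T : Type) (A : set T) (B B' : R) :
  B <= B' -> card_at_most A B -> card_at_most A B'.
Proof. by move=> BB [k [Ak kB]]; exists k; split=> //; apply: le_trans BB. Qed.

Lemma mahler_disc (R : realType) (n : nat) (f : {poly int}) (al : 'I_n -> R[i]) :
  root_system f al -> (1 < n)%N ->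
  ln (disc f al) <= n%:R * ln n%:R + 2 * (n%:R - 1) * ln (mahler f al).
Proof.
move=> fal n1; have V := vandermonde_plain al.
have a0 : 0 < `|(lead_coef f)%:~R : R| by apply: lt_le_trans (abs_lead_ge1 fal).
have M0 : 0 < mahler f al by apply: lt_le_trans (mahler_ge1 fal).
have n0 : 0 < n%:R :> R by rewrite ltr0n ltnW.
have h : disc f al <= n%:R ^+ n * mahler f al ^+ (2 * n.-1).
  rewrite /disc /mahler exprMn [X in _ <= X]mulrCA; apply: ler_wpM2l => //.
  exact/exprn_ge0/normr_ge0.
have : ln (disc f al) <= ln (n%:R ^+ n * mahler f al ^+ (2 * n.-1)).
  rewrite ler_ln ?posrE ?(disc_gt0 fal)//; apply: mulr_gt0; exact: exprn_gt0.
rewrite lnM ?posrE ?exprn_gt0// !lnXn// -[ln n%:R *+ n]mulr_natl -[ln _ *+ (2 * _)]mulr_natl natrM.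
have -> : (n.-1)%:R = n%:R - 1 :> R by rewrite -subn1 natrB// ltnW.
by [].
Qed.

(** Used with k = 1 / (2 (N - 1)) and e = 4 (N - 1) eps: twice the logarithmic hypothesis on [m],
    weakened by the nonnegative term 2 eps N lN. *)
Lemma height_arith (R : realFieldType) (N K lm lN d eps k e : R) :
  e * k = 2 * eps -> 0 <= eps -> 0 <= N * lN ->
  lm + N / 2 * K + N * (k / 2) * lN <= (k / 2 - eps) * d ->
  2 * lm + N * K <= (1 - e) * (k * (d - N * lN)).
Proof.
move=> ek eps0 NlN h.
have -> : (1 - e) * (k * (d - N * lN)) = k * d - (e * k) * d - k * (N * lN) + (e * k) * (N * lN) by ring.
rewrite ek; have : 0 <= eps * (N * lN) by rewrite mulr_ge0.
lra.
Qed.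

(** * From a form to a nearly minimal transform *)

Section FormCount.
Variables (R : realType) (n : nat) (F : {mpoly int[2]}) (a b : 'I_n -> R[i]).
Hypothesis Fab : map_mpoly (intr : int -> R[i]) F =
  \prod_(i < n) (a i *: 'X_ord0 - b i *: 'X_ord_max).
Hypothesis Firr : irreducible_elt (map_mpoly (intr : int -> rat) F : {mpoly rat[2]}).
Hypothesis n_ge3 : (3 <= n)%N.
Hypothesis ab_neq0 : forall i j, i != j -> a i * b j - a j * b i != 0.
Let n_gt1 : (1 < n)%N := ltnW n_ge3.
Local Notation la := (la a b).
Local Notation be := (be a b).

(** The Mahler measure of the transformed form (see [mahler_be]), written without the roots of the
    transform. *)
Definition hval (x y x' y' : int) : R :=
  \prod_(i < n) Num.max (cm (la i (x, y))) (cm (la i (x', y'))).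

Lemma abs_form x y : (`|F.@[coords x y]|)%:~R = \prod_(i < n) cm (la i (x, y)) :> R.
Proof. by rewrite intr_norm -cm_int (form_value Fab) cm_prod. Qed.

Lemma abs_formN x y : `|F.@[coords (- x) (- y)]| = `|F.@[coords x y]|.
Proof.
apply: (@intr_inj R); rewrite !abs_form; apply: eq_bigr => i _.
by rewrite -cmN /la/=; congr cm; rewrite !rmorphN/=; ring.
Qed.

Section Transform.
Variables (x y x' y' : int).
Hypothesis dt : x * y' - x' * y = 1.
Local Notation fT := (ft F x y x' y').
Local Notation beT := (be x y x' y').

Lemma rsT : root_system fT beT.
Proof. exact: (ft_root_system Fab Firr n_gt1 dt ab_neq0). Qed.

Lemma mahler_be : mahler fT beT = hval x y x' y'.
Proof.
rewrite /mahler (abs_lead_ft Fab Firr n_gt1 dt) -big_split/=; apply: eq_bigr => i _.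
have l0 := cm_la_gt0 Fab Firr n_gt1 dt i.
rewrite maxr_pMr ?(ltW l0)// mulr1 /be cmM cmN cmV [_ * (_ / _)]mulrC divfK ?gt_eqF//.
Qed.

Lemma hval_ge1 : 1 <= hval x y x' y'.
Proof. by rewrite -mahler_be; apply: mahler_ge1 rsT. Qed.

(** Each of the two roots is the image of the other under a Moebius map with integer coefficients,
    which commutes with conjugation. *)
Lemma be_real i : (cIm (beT i) == 0) = (cIm (be 1 0 0 1 i) == 0).
Proof.
have realE (z : R[i]) : (cIm z == 0) = (z^* == z).
  case: z => u v; by rewrite eq_complex /= eqxx /= eqNr.
have dt1 : 1 * 1 - 0 * 0 = 1 :> int by [].
have a0 : a i != 0 by have := la_neq0 Fab Firr n_gt1 dt1 i; rewrite /la/= mulr1 mulr0 subr0.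
have l0 := la_neq0 Fab Firr n_gt1 dt i.
set be1 := be 1 0 0 1 i; set z := beT i.
have b1 : be1 = b i / a i.
  by rewrite /be1 /be /la /= !mulr0 !mulr1 sub0r subr0 opprK.
have d0 : x%:~R - be1 * y%:~R != 0.
  apply: contraNneq l0 => h; rewrite /la/=; apply/eqP; transitivity (a i * (x%:~R - be1 * y%:~R)).
    by rewrite b1; field.
  by rewrite h mulr0.
have zE : z = - (x'%:~R - be1 * y'%:~R) / (x%:~R - be1 * y%:~R).
  rewrite /z /be; have -> : la i (x, y) = a i * (x%:~R - be1 * y%:~R) by rewrite b1 /la/=; field.
  have -> : la i (x', y') = a i * (x'%:~R - be1 * y'%:~R) by rewrite b1 /la/=; field.
  by field; rewrite a0 d0.
have dtR := congr1 (fun z : int => z%:~R : R[i]) dt; rewrite /= rmorphB !rmorphM/= mulr1z in dtR.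
have w1 : y%:~R * z + y'%:~R = (x%:~R - be1 * y%:~R)^-1.
  transitivity ((x%:~R * y'%:~R - x'%:~R * y%:~R) / (x%:~R - be1 * y%:~R)).
    by rewrite zE; field.
  by rewrite dtR mul1r.
have w2 : x%:~R * z + x'%:~R = be1 / (x%:~R - be1 * y%:~R).
  transitivity (be1 * (x%:~R * y'%:~R - x'%:~R * y%:~R) / (x%:~R - be1 * y%:~R)).
    by rewrite zE; field.
  by rewrite dtR mulr1.
have beE : be1 = (x%:~R * z + x'%:~R) / (y%:~R * z + y'%:~R).
  by rewrite w1 w2 invrK divfK.
have lin (w : R[i]) (k l : int) : w^* = w -> (k%:~R * w + l%:~R)^* = k%:~R * w + l%:~R.
  by move=> h; rewrite rmorphD rmorphM/= !rmorph_int h.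
have fr (u v : R[i]) : u^* = u -> v^* = v -> (u / v)^* = u / v.
  by move=> hu hv; rewrite rmorphM fmorphV/= hu hv.
rewrite !realE; apply/eqP/eqP => h.
  by rewrite beE; apply: fr; apply: lin.
have -> : z = ((y'%:~R * be1 + (- x')%:~R) / ((- y)%:~R * be1 + x%:~R)).
  by rewrite zE; congr (_ / _); rewrite !rmorphN/=; ring.
by apply: fr; apply: lin.
Qed.

End Transform.

Lemma dt_id : 1 * 1 - 0 * 0 = 1 :> int.
Proof. by []. Qed.

Lemma non_real_rootsE : non_real_roots R F =
  [set z | z \in [seq be 1 0 0 1 i | i <- enum [set i | cIm (be 1 0 0 1 i) != 0%R]%SET]]%classic.
Proof.
have fE : dehomogenize F = ft F 1 0 0 1.
  rewrite /dehomogenize /ft; congr (mmap _ (coords _ _) _).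
    by rewrite polyC1 polyC0 mul1r addr0.
  by rewrite polyC1 polyC0 mul0r add0r.
apply/seteqP; rewrite /non_real_roots fE; split=> z /=.
  move=> -[/(rs_rootP (rsT dt_id))[i ->] im].
  by apply/mapP; exists i; rewrite // mem_enum inE.
move=> zs; case: (elimT mapP zs) => i; rewrite mem_enum inE => im ->; split=> //.
exact: rs_root (rsT dt_id) i.
Qed.

Variables (m : int) (eps : R).
Hypothesis m_gt0 : 0 < m.
Local Notation N := (n%:R : R).
Hypothesis heps : 0 < eps < 1 / (4 * (N - 1)).
Let dsc := disc (ft F 1 0 0 1) (be 1 0 0 1).
Hypothesis hlog : ln m%:~R + N / 2 * ln (7 / 2) + N / (4 * (N - 1)) * ln N <=
  (1 / (4 * (N - 1)) - eps) * ln dsc.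

Lemma disc_dsc x y x' y' : x * y' - x' * y = 1 -> disc (ft F x y x' y') (be x y x' y') = dsc.
Proof.
by move=> dt; rewrite /dsc (disc_be Fab Firr n_gt1 dt) (disc_be Fab Firr n_gt1 dt_id).
Qed.

Lemma reduced_transform : exists (x y x' y' : int) (q : nat), [/\ x * y' - x' * y = 1,
  (#|[set i | cIm (be 1 0 0 1 i) != 0%R]%SET| = 2 * q)%N &
  forall t : seq (int * int), uniq t ->
  {in t, forall p : int * int, [/\ 0 < p.2 \/ p = (1, 0), gcdz p.1 p.2 = 1 &
     fval (ft F x y x' y') (be x y x' y') p <= m%:~R]} ->
  (size t)%:R <= (if (n <= 4)%N then 9 * N - 16 * q%:R else 7 * N - 12 * q%:R)
    + (N - q%:R) / (2 * (N - 1) * eps)].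
Proof.
have n3 : 3 <= N by rewrite (ler_nat _ 3).
have /andP[eps0 eps1] := heps.
pose E : set R := [set z | exists x y x' y' : int, x * y' - x' * y = 1 /\ z = hval x y x' y']%classic.
have E1 : E (hval 1 0 0 1) by exists 1, 0, 0, 1.
have lb1 : lbound E 1 by move=> _ [x [y [x' [y' [dt ->]]]]]; apply: hval_ge1.
have hE : has_inf E by split; [exists (hval 1 0 0 1)|exists 1].
pose M0 := inf E.
have M01 : 1 <= M0 by apply: lb_le_inf => //; exists (hval 1 0 0 1).
have e0 : 0 < M0 / 16 by lra.
have [_ [x [y [x' [y' [dt ->]]]]] Mlt] := inf_adherent e0 hE.
have fal := rsT dt; have dE := disc_dsc dt.
set f := ft F x y x' y' in fal dE *; set al := be x y x' y' in fal dE *.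
have M0le X Y X' Y' : X * Y' - X' * Y = 1 -> M0 <= hval X Y X' Y'.
  by move=> d; apply: ge_inf; [exact: hE.2|exists X, Y, X', Y'].
have M0min X Y X' Y' : X * Y' - X' * Y = 1 ->
    M0 <= `|(lead_coef f)%:~R : R| * \prod_(i < n) Num.max (linf al i (X, Y)) (linf al i (X', Y')).
  move=> d; rewrite (hval_be Fab Firr n_gt1 dt); apply: M0le.
  transitivity ((x * y' - x' * y) * (X * Y' - X' * Y)); first by ring.
  by rewrite dt d.
have MM0 : mahler f al <= 17 / 16 * M0.
  by rewrite mahler_be//; apply: le_trans (ltW Mlt) _; rewrite -/M0; lra.
pose k := (2 * (N - 1))^-1; pose ac := k * (ln dsc - N * ln N); pose e := 4 * (N - 1) * eps.
have N1 : 2 * (N - 1) != 0 by rewrite gt_eqF//; lra.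
have N1' : N - 1 != 0 by rewrite gt_eqF//; lra.
have aE : 2 * (N - 1) * ac = ln (disc f al) - N * ln N.
  by rewrite dE /ac /k mulrA divff// mul1r.
have k0 : 0 < k by rewrite invr_gt0; lra.
(* All transforms have the same discriminant, so Mahler's inequality bounds each of their Mahler
   measures below by the same quantity, and hence the infimum. *)
have aM0 : ac <= ln M0.
  rewrite -ler_expR lnK ?posrE; last exact: lt_le_trans M01.
  apply: lb_le_inf; first by exists (hval 1 0 0 1).
  move=> _ [X [Y [X' [Y' [d ->]]]]].
  have h0 : 0 < hval X Y X' Y' by apply: lt_le_trans (hval_ge1 d).
  rewrite -[X in _ <= X]lnK ?posrE// ler_expR.
  have := mahler_disc (rsT d) n_gt1; rewrite mahler_be// disc_dsc// => h.
  have -> : ln (hval X Y X' Y') = k * (2 * (N - 1) * ln (hval X Y X' Y')).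
    by rewrite mulrA mulVf// mul1r.
  by rewrite /ac ler_pM2l//; lra.
have N40 : 0 < 4 * (N - 1) by lra.
have e01 : 0 < e < 1.
  apply/andP; split; first by rewrite mulr_gt0.
  by move: eps1; rewrite ltr_pdivlMr// mulrC.
have mm1 : 1 <= m%:~R :> R by apply: intr_ge1.
have hA : 2 * ln m%:~R + N * ln (7 / 2) <= (1 - e) * ac.
  apply: (@height_arith _ N (ln (7 / 2)) (ln m%:~R) (ln N) (ln dsc) eps k e).
  - by rewrite /e /k; field.
  - exact: ltW.
  - by rewrite mulr_ge0 ?ln_ge0//; lra.
  - have kE : k / 2 = 1 / (4 * (N - 1)) by rewrite /k; field.
    have NE : N / (4 * (N - 1)) = N * (1 / (4 * (N - 1))) by rewrite mul1r.
    by rewrite kE -NE.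
have cubic : n = 3%N -> ln M0 <= ln (disc f al) / 2 + 7 / 2 * ln 2.
  move=> nE; have M00 : 0 < M0 by apply: lt_le_trans M01.
  have [X [Y [X' [Y' [d h]]]]] : exists X Y X' Y' : int, X * Y' - X' * Y = 1 /\
      (`|(lead_coef f)%:~R : R| * \prod_(i < n) Num.max (linf al i (X, Y)) (linf al i (X', Y'))) ^+ 2
      <= 128 * disc f al.
    move: al fal {dE M0min MM0 aE}; rewrite nE => al fal; exact: cubic_bound fal.
  have h2 : M0 ^+ 2 <= 2 ^+ 7 * disc f al.
    have -> : 2 ^+ 7 = 128 :> R by rewrite !exprS expr0; lra.
    by apply: le_trans h; rewrite lerXn2r ?nnegrE ?(ltW M00) ?(le_trans (ltW M00) (M0min _ _ _ _ d))// M0min.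
  have d0 := disc_gt0 fal.
  have : ln (M0 ^+ 2) <= ln (2 ^+ 7 * disc f al).
    rewrite ler_ln ?posrE ?exprn_gt0//; apply: mulr_gt0 => //; exact: exprn_gt0.
  rewrite [ln (2 ^+ 7 * _)]lnM ?posrE//; last exact: exprn_gt0.
  by rewrite !lnXn// -[ln M0 *+ 2]mulr_natl -[ln 2 *+ 7]mulr_natl; lra.
have [cj [cjE cjK]] := conj_index fal.
have RC := reduced_count fal n_ge3 M01 mm1 M0min MM0 aE aM0 e01 hA cubic cjE cjK.
exists x, y, x', y', #|[set i | 0%R < cIm (al i)]%SET|; split=> //.
  have cR := card_Re_Pos cjE cjK.
  have := cardsC [set i | cIm (be 1 0 0 1 i) == 0%R]%SET; rewrite card_ord.
  have -> : [set i | cIm (be 1 0 0 1 i) == 0%R]%SET = [set i | cIm (al i) == 0%R]%SET.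
    by apply/setP => i; rewrite !inE -(be_real dt).
  have -> : (~: [set i | cIm (al i) == 0%R])%SET = [set i | cIm (be 1 0 0 1 i) != 0%R]%SET.
    by apply/setP => i; rewrite !inE -(be_real dt).
  by move=> E'; apply: (@addnI #|[set i | cIm (al i) == 0%R]%SET|); exact: etrans E' (esym cR).
move=> t ut ht; have := RC t ut ht.
have -> : 2 / e = (2 * (N - 1) * eps)^-1 by rewrite /e; field; rewrite N1' gt_eqF.
by [].
Qed.

Lemma form_count : exists q : nat,
  (#|[set i | cIm (be 1 0 0 1 i) != 0%R]%SET| = 2 * q)%N /\
  card_at_most (primitive_solution_classes F m)
    ((if (n <= 4)%N then 9 * N - 16 * q%:R else 7 * N - 12 * q%:R)
      + (N - q%:R) / (2 * (N - 1) * eps)).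
Proof.
have [x [y [x' [y' [q [dt cq RT]]]]]] := reduced_transform.
exists q; split=> //.
pose tau (p : int * int) : int * int := (x * p.1 + x' * p.2, y * p.1 + y' * p.2).
pose sig (p : int * int) : int * int := (y' * p.1 - x' * p.2, x * p.2 - y * p.1).
have tauK p : sig (tau p) = p.
  case: p => u v; rewrite /sig /tau /=; congr (_, _).
    by transitivity ((x * y' - x' * y) * u); [ring|rewrite dt mul1r].
  by transitivity ((x * y' - x' * y) * v); [ring|rewrite dt mul1r].
have sigK p : tau (sig p) = p.
  case: p => u v; rewrite /sig /tau /=; congr (_, _).
    by transitivity ((x * y' - x' * y) * u); [ring|rewrite dt mul1r].
  by transitivity ((x * y' - x' * y) * v); [ring|rewrite dt mul1r].
have oppE (p : int * int) : - p = (- p.1, - p.2) by case: p.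
have tauN p : tau (- p) = - tau p.
  by rewrite !oppE /tau /=; congr (_, _); ring.
(* [nrm] selects one of p and -p; when p.2 = 0, coprimality leaves only (1, 0) and (-1, 0). *)
pose nrm (p : int * int) := 0 < p.2 \/ p = (1, 0).
pose Sol : set (int * int) := [set p | nrm p /\ primitive_solutions F m (tau p)]%classic.
pose h p : set (int * int) := [set tau p; - tau p]%classic.
have solN p : primitive_solutions F m p -> primitive_solutions F m (- p).
  move=> -[h1 h2]; split; last by rewrite oppE /= gcdNz gcdzN.
  by rewrite oppE /= abs_formN.
have gcdtau p : gcdz (tau p).1 (tau p).2 = 1 -> gcdz p.1 p.2 = 1.
  move=> g; have [u [v uv]] := Bezoutz (tau p).1 (tau p).2; rewrite g in uv.
  apply/eqP; rewrite -/(coprimez _ _); apply/coprimezP.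
  exists (u * x + v * y, u * x' + v * y') => /=.
  by rewrite -uv /tau /=; ring.
have -> : primitive_solution_classes F m = (h @` Sol)%classic.
  apply/seteqP; split=> A /=.
    move=> [p ps <-].
    have g : gcdz (sig p).1 (sig p).2 = 1 by apply: gcdtau; rewrite sigK; case: ps.
    have [nr|nr] : nrm (sig p) \/ nrm (- sig p).
      have [lt|gt|eq0] := ltgtP 0 (sig p).2; first by left; left.
        by right; left; rewrite oppE /= oppr_gt0.
      have : `|(sig p).1| = 1 by move: g; rewrite -eq0 gcdz0 => gg; rewrite -gg.
      move=> /eqP; rewrite eqr_norml ler01 andbT => /orP[] /eqP s1.
        by left; right; rewrite [LHS]surjective_pairing s1 -eq0.
      by right; right; rewrite oppE s1 -eq0 opprK oppr0.
    - exists (sig p); first by split; rewrite ?sigK.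
      by rewrite /h sigK.
    - exists (- sig p); first by split=> //; rewrite tauN sigK; apply: solN.
      by rewrite /h tauN sigK opprK setUC.
  by move=> [p [_ ps] <-]; exists (tau p).
apply: card_at_most_inj => [p p'|t ut ht].
  rewrite !inE => -[np _] [np' _] E.
  have tp : h p' (tau p) by rewrite -E; left.
  have : p = p' \/ p = - p'.
    case: tp => /= tp; [left|right]; rewrite -[LHS]tauK tp ?tauK//.
    by rewrite -tauN tauK.
  case=> // pp; move: np np'; rewrite pp oppE /nrm /=; case: p' {E tp pp} => u v /=.
  case=> [v0|[u1 v0]] [v0'|[u1' v0']].
  - by move: v0; rewrite oppr_gt0 => /(lt_trans v0'); rewrite ltxx.
  - by move: v0; rewrite v0' oppr0 ltxx.
  - by move: v0 v0' => /eqP; rewrite oppr_eq0 => /eqP ->; rewrite ltxx.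
  - by rewrite u1' in u1.
apply: RT => // p /ht[np ps]; split=> //; first by apply: gcdtau; case: ps.
case: p np ps => u v np [/andP[_ Fm] _].
by rewrite (fval_be Fab Firr n_gt1 dt) -intr_norm ler_int.
Qed.

End FormCount.

(** * The bounds in terms of the discriminant of the form *)

Lemma count_with_nonreal (R : realType) (n : nat) (F : {mpoly int[2]}) (D : int)
    (eps : R) (m : int) :
  (3 <= n)%N -> irreducible_binary_form n F -> is_discriminant R n F D ->
  0 < eps < 1 / (4 * (n%:R - 1)) -> 0 < m ->
  m%:~R <= `|D|%:~R `^ (1 / (4 * (n%:R - 1)) - eps)
          / ((7 / 2) `^ (n%:R / 2) * n%:R `^ (n%:R / (4 * (n%:R - 1)))) ->
  exists q : nat, (non_real_roots R F #= `I_(2 * q))%card /\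
    card_at_most (primitive_solution_classes F m)
      ((if (n <= 4)%N then 9 * n%:R - 16 * q%:R else 7 * n%:R - 12 * q%:R)
        + (n%:R - q%:R) / (2 * (n%:R - 1) * eps)).
Proof.
move=> hn [_ Firr] [a [b [Fab DE]]] heps hm0 hm.
have m0 : 0 < m%:~R :> R by rewrite ltr0z.
have /andP[eps0 eps1] := heps.
have n0 : 0 < n%:R :> R by rewrite ltr0n (leq_trans _ hn).
have p72 : 0 < 7 / 2 :> R by lra.
(* For D = 0 the right-hand side of [hm] would be 0, the exponent being positive; so [hm] itself
   guarantees distinct roots. *)
have D0 : D != 0.
  apply/eqP => D0; move: hm; rewrite D0 normr0 powR0 ?mul0r; last by rewrite gt_eqF// subr_gt0.
  by rewrite leNgt m0.
have abl (i j : 'I_n) : (i < j)%N -> a i * b j - a j * b i != 0.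
  move=> ij; have : D%:~R != 0 :> R[i] by rewrite intr_eq0.
  rewrite DE => /prodf_neq0/(_ i isT)/prodf_neq0/(_ j ij).
  by rewrite expf_eq0.
have ab (i j : 'I_n) : i != j -> a i * b j - a j * b i != 0.
  rewrite -val_eqE neq_ltn => /orP[|ji]; first exact: abl.
  by rewrite -oppr_eq0 opprB abl.
have cD : disc (ft F 1 0 0 1) (be a b 1 0 0 1) = `|D|%:~R.
  rewrite (disc_be Fab Firr (ltnW hn) dt_id) prod_neq_lt => [|i j]; last by rewrite -opprB cmN.
  rewrite intr_norm -cm_int DE cm_prod; apply: eq_bigr => i _; rewrite cm_prod.
  by apply: eq_bigr => j _; rewrite cmX.
have Dp : 0 < `|D|%:~R :> R by rewrite ltr0z normr_gt0.
have hlog : ln m%:~R + n%:R / 2 * ln (7 / 2) + n%:R / (4 * (n%:R - 1)) * ln n%:R <=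
    (1 / (4 * (n%:R - 1)) - eps) * ln (disc (ft F 1 0 0 1) (be a b 1 0 0 1)).
  have P1 := powR_gt0 (1 / (4 * (n%:R - 1)) - eps) Dp.
  have P2 := powR_gt0 (n%:R / 2) p72.
  have P3 := powR_gt0 (n%:R / (4 * (n%:R - 1))) n0.
  have P4 := mulr_gt0 P2 P3.
  move: hm; rewrite -ler_ln ?posrE//; last exact: divr_gt0.
  by rewrite ln_div ?posrE// lnM ?posrE// !ln_powR cD; lra.
have [q [cq C]] := form_count Fab Firr hn ab hm0 heps hlog.
exists q; split=> //.
rewrite (non_real_rootsE Fab Firr hn ab) -cq cardE -(size_map (be a b 1 0 0 1)).
apply: card_seq; rewrite map_inj_uniq ?enum_uniq//.
exact: rs_inj (rsT Fab Firr hn ab dt_id).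
Qed.

Local Open Scope classical_set_scope.
Local Open Scope ring_scope.

Theorem theorem1p1 (R : realType) (n : nat) (F : {mpoly int[2]}) (D : int)
    (eps : R) (m : int)
    (hn : (3 <= n)%N)
    (hF : irreducible_binary_form n F)
    (hD : is_discriminant R n F D)
    (heps : 0 < eps < 1 / (4 * (n%:R - 1)))
    (hm0 : 0 < m)
    (hm : m%:~R <=
          `|D|%:~R `^ (1 / (4 * (n%:R - 1)) - eps)
          / ((7 / 2) `^ (n%:R / 2) * n%:R `^ (n%:R / (4 * (n%:R - 1))))) :
  [/\ (5 <= n)%N ->
        card_at_most (primitive_solution_classes F m)
          (7 * n%:R + n%:R / (2 * (n%:R - 1) * eps)),
      n = 3%N \/ n = 4%N ->
        card_at_most (primitive_solution_classes F m)
          (9 * n%:R + n%:R / (2 * (n%:R - 1) * eps)) &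
      forall q : nat,
        (non_real_roots R F #= `I_(2 * q))%card ->
        ((5 <= n)%N ->
           card_at_most (primitive_solution_classes F m)
             (7 * n%:R - 12 * q%:R
              + (n%:R - q%:R) / (2 * (n%:R - 1) * eps))) /\
        (n = 3%N \/ n = 4%N ->
           card_at_most (primitive_solution_classes F m)
             (9 * n%:R - 16 * q%:R
              + (n%:R - q%:R) / (2 * (n%:R - 1) * eps)))].
Proof.
have [q0 [hq C]] := count_with_nonreal hn hF hD heps hm0 hm.
have n3 : 3 <= n%:R :> R by rewrite (ler_nat _ 3).
have /andP[eps0 _] := heps.
have q0R : 0 <= q0%:R :> R by [].
have den : 0 <= (2 * (n%:R - 1) * eps)^-1 :> R.
  by rewrite invr_ge0 !mulr_ge0 ?(ltW eps0)//; lra.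
have qden : 0 <= q0%:R / (2 * (n%:R - 1) * eps) :> R by rewrite mulr_ge0.
have le4 : n = 3%N \/ n = 4%N -> (n <= 4)%N by case=> ->.
split.
(* The terms in the actual number q0 of conjugate pairs only lower the bound, so the bounds without
   q follow by dropping them. *)
- move=> n5; apply: card_at_most_le C; rewrite leqNgt n5/=.
  by rewrite mulrBl; lra.
- move=> /le4 n4; apply: card_at_most_le C; rewrite n4.
  by rewrite mulrBl; lra.
move=> q hq'; have qE : q = q0.
  have /card_eq_II : (`I_(2 * q) #= `I_(2 * q0))%card.
    exact: card_eq_trans (card_esym hq') hq.
  by clear; lia.
rewrite qE; split=> [n5|/le4 n4].
  by move: C; rewrite leqNgt n5.
by move: C; rewrite n4.
Qed.
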